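(* Let $m\ge1$. Every map $u\in\dot H^{1/2}(\mathbb{R},S^{m-1})$ satisfies $$\Delta^{1/4}\big(u\cdot\Delta^{1/4}u\big)=S(u\cdot,u)-\mathcal{R}\big(\Delta^{1/4}u\cdot\mathcal{R}\Delta^{1/4}u\big),$$ where $S(Q,u):=\Delta^{1/4}[Q\,\Delta^{1/4}u]-\mathcal{R}(Q\nabla u)+\mathcal{R}\big(\Delta^{1/4}Q\;\mathcal{R}\Delta^{1/4}u\big)$, taken here with $Q=u\cdot$.
   Context: The Fourier transform is $\hat v(\xi)=\int v(x)e^{-ix\xi}dx$. $\Delta^{1/4}$ is the Fourier multiplier with symbol $|\xi|^{1/2}$, $\mathcal{R}$ is the Fourier multiplier with symbol $i\xi/|\xi|$, and $\nabla$ is the derivative on $\mathbb{R}$; they act componentwise. $\dot H^{1/2}(\mathbb{R},\mathbb{R}^m)$ is the homogeneous Sobolev space with seminorm $\|u\|_{\dot H^{1/2}}=\||\xi|^{1/2}\hat u\|_{L^2}$, and $\dot H^{1/2}(\mathbb{R},S^{m-1})=\{u\in\dot H^{1/2}(\mathbb{R},\mathbb{R}^m):u(x)\in S^{m-1}\text{ a.e.}\}$, with $S^{m-1}$ the unit sphere of $\mathbb{R}^m$. $u\cdot$ denotes the $1\times m$ matrix-valued function representing $v\mapsto u(x)\cdot v$ (scalar product in $\mathbb{R}^m$). Thus $S(u\cdot,u)=\Delta^{1/4}[u\cdot\Delta^{1/4}u]-\mathcal{R}(u\cdot\nabla u)+\mathcal{R}(\Delta^{1/4}u\cdot\mathcal{R}\Delta^{1/4}u)$.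 The identity is understood in the sense of distributions. *)

(* Defs.v *)
From HB Require Import structures.
From mathcomp Require Import all_boot all_order all_algebra.
From mathcomp Require Import complex.
From mathcomp Require Import all_classical all_reals all_analysis.

Set Implicit Arguments.
Unset Strict Implicit.
Unset Printing Implicit Defensive.

Import Order.TTheory GRing.Theory Num.Theory.
Import numFieldNormedType.Exports.

Local Open Scope classical_set_scope.
Local Open Scope complex_scope.
Local Open Scope ring_scope.

Section defs.
Context {R : realType}.
Local Notation C := R[i].
Local Notation mu := (@lebesgue_measure R).
Local Notation ReC := (@complex.Re R).
Local Notation ImC := (@complex.Im R).

(** ** Complex-valued functions on the real line *)

Definition cmeasurable (f : R -> C) : Prop :=
  measurable_fun [set: R] (fun x => ReC (f x)) /\
  measurable_fun [set: R] (fun x => ImC (f x)).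

Definition cintegrable (f : R -> C) : Prop :=
  mu.-integrable [set: R] (fun x => (ReC (f x))%:E) /\
  mu.-integrable [set: R] (fun x => (ImC (f x))%:E).

Definition cintegral (f : R -> C) : C :=
  (\int[mu]_x ReC (f x)) +i* (\int[mu]_x ImC (f x)).

Definition L2 (f : R -> C) : Prop :=
  cmeasurable f /\ (\int[mu]_x (Normc.normc (f x) ^+ 2)%:E < +oo)%E.

Definition cis (t : R) : C := cos t +i* sin t.

(** ** Schwartz functions and the Fourier transform *)

Definition rschwartz (f : R -> R) : Prop :=
  (forall n x, derivable (derive1n n f) x 1) /\
  (forall k n, exists M : R, forall x, `|x| ^+ k * `|derive1n n f x| <= M).

Definition schwartz (phi : R -> C) : Prop :=
  rschwartz (fun x => ReC (phi x)) /\ rschwartz (fun x => ImC (phi x)).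

Definition fourier (phi : R -> C) : R -> C :=
  fun xi => cintegral (fun x => phi x * cis (- (x * xi))).

Definition inv_fourier (phi : R -> C) : R -> C :=
  fun x => ((2 * pi)^-1)%:C * cintegral (fun xi => phi xi * cis (x * xi)).

(** Measurable functions of polynomial growth in the mean, i.e. functions that
    define a tempered distribution by integration. *)
Definition tempered (v : R -> C) : Prop :=
  cmeasurable v /\
  exists N : nat, (\int[mu]_x (Normc.normc (v x) / (1 + `|x|) ^+ N)%:E < +oo)%E.

(** [is_fourier v g]: the Fourier transform of the tempered distribution [v]
    is the function [g] up to a multiple of the Dirac mass at the origin
    (test functions vanish at [0]). This is the Fourier transform of [v]
    modulo constants: homogeneous Sobolev functions, e.g. constants, need not
    decay, and [g] need not be integrable at the origin. The Dirac mass is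
    annihilated by |xi|^(1/2) and xi, and the symbol of the Riesz transform is
    only applied to L^2 functions. Such a [g] is unique almost everywhere. *)
Definition is_fourier (v g : R -> C) : Prop :=
  [/\ tempered v, cmeasurable g &
      forall phi, schwartz phi -> phi 0 = 0 ->
        cintegrable (fun xi => g xi * phi xi) /\
        cintegral (fun x => v x * fourier phi x) =
        cintegral (fun xi => g xi * phi xi)].

(** The Fourier transform of [v] as a function ([0] if it is not a function). *)
Definition fhat (v : R -> C) : R -> C := xget (fun=> 0) [set g | is_fourier v g].

(** ** The space $\dot H^{1/2}$ *)

Definition half_power (xi : R) : C := (Num.sqrt `|xi|)%:C.

Definition dotHhalf (v : R -> C) : Prop :=
  is_fourier v (fhat v) /\ L2 (fun xi => half_power xi * fhat v xi).

(** Vectors of R^m and matrices act on C-valued functions by this embedding. *)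
Definition toC (p q : nat) (F : R -> 'M[R]_(p, q)) : R -> 'M[C]_(p, q) :=
  fun x => map_mx (fun a : R => a%:C) (F x).

Definition dotHhalf_sphere (m : nat) (u : R -> 'cV[R]_m) : Prop :=
  (forall k, dotHhalf (fun x => toC u x k 0)) /\
  {ae mu, forall x, \sum_k (u x k 0) ^+ 2 = 1}.

(** ** Fourier multipliers *)

Definition riesz_symbol (xi : R) : C := 0 +i* (xi / `|xi|).

Definition grad_symbol (xi : R) : C := 0 +i* xi.

(** The multiplier of symbol [s] applied to a function, when the result is
    in L^2: being in L^2 selects it among the functions with the prescribed
    Fourier transform away from the origin. *)
Definition fmult1 (s : R -> C) (v : R -> C) : R -> C :=
  xget (fun=> 0) [set w | L2 w /\ is_fourier w (fun xi => s xi * fhat v xi)].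

Definition fmult (s : R -> C) (p q : nat) (F : R -> 'M[C]_(p, q)) :
    R -> 'M[C]_(p, q) :=
  fun x => \matrix_(i, j) fmult1 s (fun y => F y i j) x.

(** A matrix-valued distribution, given by its values on test functions. The
    functionals below are defined on all functions because images of Schwartz
    functions under the multipliers are not Schwartz functions. *)
Definition functional (p q : nat) := (R -> C) -> 'M[C]_(p, q).

Definition eq_distr (p q : nat) (S T : functional p q) : Prop :=
  forall phi, schwartz phi -> S phi = T phi.

Definition of_fun (p q : nat) (F : R -> 'M[C]_(p, q)) : functional p q :=
  fun phi => \matrix_(i, j) cintegral (fun x => F x i j * phi x).

(** The multiplier of symbol [s] on distributions, defined by duality:
    < F^-1 (s F T), phi > = < T, F (s F^-1 phi) >. *)
Definition dmult (s : R -> C) (p q : nat) (T : functional p q) : functional p q :=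
  fun phi => T (fourier (fun xi => s xi * inv_fourier phi xi)).

(** The duality between $\dot H^{-1/2}$ and $\dot H^{1/2}$: the pairing with
    [v] of the distribution with Fourier transform [G]. *)
Definition pairing (G v : R -> C) : C :=
  ((2 * pi)^-1)%:C * cintegral (fun xi => G xi * fhat v (- xi)).

(** The product of the function [Q] with the distribution [grad u], which is
    in $\dot H^{-1/2}$: < Q grad u, psi > = < grad u, Q psi >. *)
Definition mul_grad (l m : nat) (Q : R -> 'M[C]_(l, m)) (u : R -> 'cV[C]_m) :
    functional l 1 :=
  fun psi => \matrix_(i, j)
    \sum_k pairing (fun xi => grad_symbol xi * fhat (fun x => u x k j) xi)
                   (fun x => Q x i k * psi x).

(** The function-level operators produce L^2 functions, the distribution-level
    ones distributions. *)
Definition fquarter (p q : nat) := @fmult half_power p q.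
Definition friesz (p q : nat) := @fmult riesz_symbol p q.
Definition dquarter (p q : nat) := @dmult half_power p q.
Definition driesz (p q : nat) := @dmult riesz_symbol p q.

Definition fmulmx (l m n : nat) (A : R -> 'M[C]_(l, m)) (B : R -> 'M[C]_(m, n)) :
    R -> 'M[C]_(l, n) :=
  fun x => A x *m B x.

(** The 1 x m matrix-valued function v |-> u(x) . v. *)
Definition dot_row (m : nat) (u : R -> 'cV[C]_m) : R -> 'rV[C]_m :=
  fun x => (u x)^T.

(** The three-term operator S(Q, u). *)
Definition S3 (l m : nat) (Q : R -> 'M[C]_(l, m)) (u : R -> 'cV[C]_m) :
    functional l 1 :=
  fun phi =>
    dquarter (of_fun (fmulmx Q (fquarter u))) phi
    - driesz (mul_grad Q u) phi
    + driesz (of_fun (fmulmx (fquarter Q) (friesz (fquarter u)))) phi.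

End defs.

(* Main.v *)
From mathcomp Require Import all_boot all_order all_algebra.
From mathcomp Require Import complex.
From mathcomp Require Import all_classical all_reals all_analysis.
From mathcomp Require Import measurable_realfun.
From mathcomp Require Import ring lra.
Require Import Defs.

Set Implicit Arguments.
Unset Strict Implicit.
Unset Printing Implicit Defensive.

Import Order.TTheory GRing.Theory Num.Theory.
Import numFieldNormedType.Exports.

Local Open Scope classical_set_scope.
Local Open Scope complex_scope.
Local Open Scope ring_scope.

(** Two of the three terms of S(u., u) cancel in the identity (the multiplier
    acts entrywise, so that it commutes with transposition), and what remains is
    that the distribution R(u . grad u) vanishes. Formally, u . grad u is half
    the gradient of |u|^2 = 1. But u is only in H^(1/2), and the product is
    defined on the Fourier side: the pairing of grad u_k with u_k psi, where psi
    is the Fourier transform of the Riesz symbol times the inverse Fourier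
    transform of a test function. The Leibniz rule is therefore applied to
    difference quotients.

    Let D_t f(x) = f(x + t) - f(x). If p and q are unit vectors, then
    (q - p) . p = - |q - p|^2 / 2 ([sphere_polarization]), so that
      sum_k int (D_t u_k) u_k psi = - 1/2 int |D_t u|^2 psi.
    The function psi is bounded, and by Plancherel's theorem int |D_t u|^2 is
    1/(2 pi) int |e^(i t xi) - 1|^2 |u^(xi)|^2. For t = 1/n and after
    multiplication by n this tends to 0, by dominated convergence, since
    n |e^(i xi/n) - 1|^2 is at most both 2 |xi| and xi^2 / n
    ([cvg_omega_quotient]). On the other hand, by Parseval's identity, n times
    the left-hand side is the pairing in which the symbol i xi of the gradient is
    replaced by n (e^(i xi/n) - 1). This converges to the pairing
    with the gradient ([cvg_difference_quotient]), hence the pairing is 0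
    ([sphere_cancel]).

    The dominated convergence on the Fourier side requires u_k psi to be in
    H^(1/2) ([rint_abs_fhat_mul]). Since D_t (u psi) is controlled by D_t u and
    D_t psi, this follows from a description of H^(1/2) by increments: the weight
    |xi| is comparable to sums over j of 2^j |e^(i xi / 2^j) - 1|^2
    ([rint_abs_of_omega]).

    The L^2 theory of the Fourier transform is developed with modulated
    Gaussians as test functions, a family which the Fourier transform preserves.
    Bessel's inequality for integrable L^2 functions ([bessel]) comes from Fubini's
    theorem; it yields one inequality of Plancherel's theorem ([fpair_le]), and
    the other one by duality ([plancherel]), as well as the existence of Fourier
    transforms in L^2 ([fourier_L2]) and their uniqueness
    ([is_fourier_unique]). *)

(** * Integrable real functions *)

Section RealIntegral.
Context {R : realType}.
Notation mu := (@lebesgue_measure R).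
Implicit Types f g h : R -> R.

Lemma aeS (P Q : R -> Prop) : (forall x, P x -> Q x) ->
  {ae mu, forall x, P x} -> {ae mu, forall x, Q x}.
Proof. move=> PQ; apply: (@filterS _ _ (ae_filter_ringOfSetsType mu)) => x; exact: PQ. Qed.

Lemma aeI (P Q : R -> Prop) :
  {ae mu, forall x, P x} -> {ae mu, forall x, Q x} -> {ae mu, forall x, P x /\ Q x}.
Proof. move=> p q. exact: (@filterI _ _ (ae_filter_ringOfSetsType mu)). Qed.

Lemma aeW (P : R -> Prop) : (forall x, P x) -> {ae mu, forall x, P x}.
Proof. move=> p. exact: (@filterE _ _ (ae_filter_ringOfSetsType mu)). Qed.

Definition rint f : Prop := mu.-integrable [set: R] (EFin \o f).

Notation "'RI' f" := (\int[mu]_x (f x)) (at level 10, f at level 9).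

Lemma rint_meas f : rint f -> measurable_fun [set: R] f.
Proof. by move=> /integrableP[/measurable_EFinP]. Qed.

Lemma rint_ge0P f : measurable_fun [set: R] f -> (forall x, 0 <= f x) ->
  (\int[mu]_x (f x)%:E < +oo)%E -> rint f.
Proof.
move=> mf f0 foo; apply/integrableP; split; first exact/measurable_EFinP.
by under eq_integral => x _ do rewrite /= ger0_norm//.
Qed.

Lemma RI_E f : rint f -> (RI f)%:E = (\int[mu]_x (f x)%:E)%E.
Proof. by move=> fi; rewrite fineK//; exact: integrable_fin_num. Qed.

Lemma rint_le f g : measurable_fun [set: R] f -> (forall x, `|f x| <= g x) ->
  rint g -> rint f.
Proof.
move=> mf fg; apply: le_integrable => //; first exact/measurable_EFinP.
by move=> x _ /=; rewrite lee_fin (le_trans (fg x))// ler_norm.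
Qed.

Lemma rint_eq f g : f =1 g -> rint f -> rint g.
Proof. by move=> /funext->. Qed.

Lemma RI_eq f g : f =1 g -> RI f = RI g.
Proof. by move=> /funext->. Qed.

Lemma rint0 : rint (fun=> 0).
Proof. exact: integrable0. Qed.

Lemma rintD f g : rint f -> rint g -> rint (fun x => f x + g x).
Proof. by move=> fi gi; exact: (integrableD _ fi gi). Qed.

Lemma rintB f g : rint f -> rint g -> rint (fun x => f x - g x).
Proof. by move=> fi gi; exact: (integrableB _ fi gi). Qed.

Lemma rintZ c f : rint f -> rint (fun x => c * f x).
Proof. by move=> fi; exact: (integrableZl _ c fi). Qed.

Lemma rintN f : rint f -> rint (fun x => - f x).
Proof. by move=> fi; apply: rint_eq (rintZ (-1) fi) => x; rewrite mulN1r. Qed.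

Lemma rint_abs f : rint f -> rint (fun x => `|f x|).
Proof. by move=> fi; exact: (integrable_norm fi). Qed.

Lemma rint_sum n (F : 'I_n -> R -> R) : (forall i, rint (F i)) ->
  rint (fun x => \sum_i F i x).
Proof.
move=> Fi; rewrite /rint; have -> : EFin \o (fun x => \sum_i F i x) =
   (fun x => \sum_i (F i x)%:E)%E by apply/funext => x /=; rewrite sumEFin.
by apply: integrable_sum => // i _; exact: Fi.
Qed.

Lemma RID f g : rint f -> rint g -> RI (fun x => f x + g x) = RI f + RI g.
Proof. by move=> fi gi; rewrite RintegralD. Qed.

Lemma RIB f g : rint f -> rint g -> RI (fun x => f x - g x) = RI f - RI g.
Proof. by move=> fi gi; rewrite RintegralB. Qed.

Lemma RIZ c f : rint f -> RI (fun x => c * f x) = c * RI f.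
Proof. by move=> fi; rewrite RintegralZl. Qed.

Lemma RIN f : rint f -> RI (fun x => - f x) = - RI f.
Proof.
move=> fi; rewrite -mulN1r -RIZ//.
by apply: eq_Rintegral => x _; rewrite mulN1r.
Qed.

Lemma RI0 : RI (fun=> 0) = 0.
Proof. by rewrite /Rintegral integral0. Qed.

Lemma RI_sum n (F : 'I_n -> R -> R) : (forall i, rint (F i)) ->
  RI (fun x => \sum_i F i x) = \sum_i RI (F i).
Proof.
elim: n F => [|n ih] F Fi.
  by rewrite big_ord0 -[RHS]RI0; apply: eq_Rintegral => x _; rewrite big_ord0.
rewrite big_ord_recl -ih// -RID//; last exact: rint_sum.
by apply: eq_Rintegral => x _; rewrite big_ord_recl.
Qed.

Lemma RI_le f g : rint f -> rint g -> (forall x, f x <= g x) -> RI f <= RI g.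
Proof. by move=> fi gi fg; apply: le_Rintegral. Qed.

Lemma RI_ge0 f : (forall x, 0 <= f x) -> 0 <= RI f.
Proof. by move=> f0; apply: Rintegral_ge0. Qed.

Lemma RI_abs f : rint f -> `|RI f| <= RI (fun x => `|f x|).
Proof. by move=> fi; apply: le_normr_Rintegral. Qed.

Lemma RI_abs_le f g : rint f -> rint g -> (forall x, `|f x| <= g x) ->
  `|RI f| <= RI g.
Proof.
by move=> fi gi fg; apply: (le_trans (RI_abs fi)); apply: RI_le => //; exact: rint_abs.
Qed.

Lemma rintM_bdd f h M : measurable_fun [set: R] h -> (forall x, `|h x| <= M) ->
  rint f -> rint (fun x => h x * f x).
Proof.
move=> mh hM fi; apply: (@rint_le _ (fun x => M * `|f x|)).
- by apply: measurable_funM => //; exact: rint_meas.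
- by move=> x; rewrite normrM ler_wpM2r.
- exact/rintZ/rint_abs.
Qed.

Lemma RI_ae_eq f g : measurable_fun [set: R] f -> measurable_fun [set: R] g ->
  {ae mu, forall x, f x = g x} -> RI f = RI g.
Proof.
move=> mf mg fg; congr fine; apply: ae_eq_integral => //; [exact/measurable_EFinP..|].
by apply: aeS fg => x /= -> _.
Qed.

Lemma rint_ae_eq f g : measurable_fun [set: R] f -> measurable_fun [set: R] g ->
  {ae mu, forall x, f x = g x} -> rint f -> rint g.
Proof.
move=> mf mg fg /integrableP[_ foo]; apply/integrableP; split; first exact/measurable_EFinP.
rewrite (_ : (\int[mu]_x _)%E = (\int[mu]_x `|(EFin \o f) x|)%E)//.
apply: ae_eq_integral => //.
- by apply: measurableT_comp => //; exact/measurable_EFinP.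
- by apply: measurableT_comp => //; exact/measurable_EFinP.
by apply: aeS fg => x /= -> _.
Qed.

Lemma RI_eq0_ae f : measurable_fun [set: R] f -> rint f -> (forall x, 0 <= f x) ->
  RI f <= 0 -> {ae mu, forall x, f x = 0}.
Proof.
move=> mf fi f0 If0.
have If : (\int[mu]_x `|(EFin \o f) x|)%E = 0%E.
  under eq_integral => x _ do rewrite /= ger0_norm//.
  by rewrite -RI_E//; congr EFin; apply/eqP; rewrite eq_le If0 RI_ge0.
have /(ae_eq_integral_abs mu measurableT)[+ _] := (measurable_EFinP _ _).2 mf.
by move=> /(_ If); apply: aeS => x /= /(_ I) [].
Qed.

(** The integrability of the limit is part of the conclusion: it is how L^2
    functions are obtained below. *)
Lemma RI_fatou (F : nat -> R -> R) f B : (forall n, measurable_fun [set: R] (F n)) ->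
  (forall n x, 0 <= F n x) -> (forall x, F n x @[n --> \oo] --> f x) ->
  (forall n, (\int[mu]_x (F n x)%:E <= B%:E)%E) ->
  rint f /\ RI f <= B.
Proof.
move=> mF F0 Ff FB.
have mf : measurable_fun [set: R] f.
  by apply: (measurable_fun_cvg (h := F)) => // x _; exact: Ff.
have f0 x : 0 <= f x.
  rewrite -(cvg_lim _ (Ff x))//; apply: limr_ge; first exact: (cvgP _ (Ff x)).
  exact: nearW.
have le : (\int[mu]_x (f x)%:E <= B%:E)%E.
  have := @fatou _ _ R mu setT measurableT (fun n x => (F n x)%:E).
  have E x : limn_einf (fun n => (F n x)%:E) = (f x)%:E.
    have c : (F n x)%:E @[n --> \oo] --> (f x)%:E by apply: cvg_EFin; [exact: nearW|exact: Ff].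
    rewrite is_cvg_limn_einfE; last by apply/cvg_ex; exists (f x)%:E.
    exact/cvg_lim.
  under eq_integral do rewrite E.
  move=> h.
  have {}h := h (fun n => (measurable_EFinP _ _).2 (mF n)) (fun n x _ => F0 n x).
  apply: (le_trans h).
  rewrite limn_einf_lim; apply: lime_le; first exact: is_cvg_einfs.
  apply: nearW => n; apply: le_trans (FB n); apply: ereal_inf_lbound.
  by exists n => //=.
have fi : rint f by apply: rint_ge0P => //; apply: (le_lt_trans le); rewrite ltry.
by split => //; rewrite -lee_fin RI_E.
Qed.

End RealIntegral.

(** * Dominated convergence, Fubini's theorem, affine changes of variable *)

Section RealLimits.
Context {R : realType}.
Notation mu := (@lebesgue_measure R).
Implicit Types f g h : R -> R.

Lemma RI_dct (F : nat -> R -> R) f g : (forall n, measurable_fun [set: R] (F n)) ->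
  (forall x, F n x @[n --> \oo] --> f x) -> rint g ->
  (forall n x, `|F n x| <= g x) ->
  rint f /\ (\int[mu]_x F n x @[n --> \oo] --> \int[mu]_x f x).
Proof.
move=> mF Ff gi Fg.
have mf : measurable_fun [set: R] f.
  by apply: (measurable_fun_cvg (h := F)) => // x _; exact: Ff.
have := @dominated_convergence _ _ R mu setT measurableT
  (fun n x => (F n x)%:E) (EFin \o f) (EFin \o g)
  (fun n => (measurable_EFinP _ _).2 (mF n)) ((measurable_EFinP _ _).2 mf).
case.
- by apply: aeW => x _; apply: cvg_EFin; [exact: nearW|exact: Ff].
- exact: gi.
- by apply: aeW => x n _; rewrite /= lee_fin.
move=> fi _ c; split => //.
by apply: fine_cvg; rewrite fineK//; exact: integrable_fin_num.
Qed.

(** Tonelli's theorem turns the bound B on the inner absolute integrals into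
    integrability on the plane. *)
Lemma RI_fubini (F : R -> R -> R) (B : R -> R) :
  measurable_fun [set: R * R] (fun z => F z.1 z.2) ->
  (forall x, rint (F x)) -> (forall y, rint (F^~ y)) ->
  (forall x, \int[mu]_y `|F x y| <= B x) -> rint B ->
  [/\ rint (fun x => \int[mu]_y F x y), rint (fun y => \int[mu]_x F x y) &
   \int[mu]_x \int[mu]_y F x y = \int[mu]_y \int[mu]_x F x y].
Proof.
move=> mF Fx Fy FB Bi.
pose H := fun z : R * R => (F z.1 z.2)%:E.
have mH : measurable_fun [set: R * R] H by exact/measurable_EFinP.
have mH1 : measurable_fun [set: R] (fun x => \int[mu]_y `|H (x, y)|)%E.
  apply: (measurable_fun_fubini_tonelli_F (m2 := mu) (abse \o H)) => //=.
  exact: measurableT_comp.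
have E1 x : (\int[mu]_y `|H (x, y)|)%E = (\int[mu]_y `|F x y|)%:E.
  by rewrite RI_E//; exact: rint_abs.
have lty : (\int[mu]_x \int[mu]_y `|H (x, y)| < +oo)%E.
  apply: (@le_lt_trans _ _ (\int[mu]_x (B x)%:E)%E).
    apply: ge0_le_integral => //.
    - by move=> x _; exact: integral_ge0.
    - by apply/measurable_EFinP; exact: (rint_meas Bi).
    - by move=> x _; rewrite E1 lee_fin.
  exact: integrable_lty.
have iH := (@integrable12ltyP _ _ _ _ R mu mu H mH).2 lty.
have EF x : (\int[mu]_y H (x, y))%E = (\int[mu]_y F x y)%:E by rewrite RI_E.
have EG y : (\int[mu]_x H (x, y))%E = (\int[mu]_x F x y)%:E by rewrite RI_E//; exact: Fy.
split.
- rewrite /rint; have -> : EFin \o (fun x => \int[mu]_y F x y) = fubini_F mu H.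
    by apply/funext => x; rewrite /fubini_F EF.
  exact: integrable_fubini_F.
- have mG := measurable_fubini_G iH.
  have EGf : EFin \o (fun y => \int[mu]_x F x y) = fubini_G mu H.
    by apply/funext => x; rewrite /fubini_G EG.
  apply/integrableP; split; first by rewrite EGf.
  apply: le_lt_trans ((@integrable21ltyP _ _ _ _ R mu mu H mH).1 iH).
  have mG2 : measurable_fun [set: R] (fun y => \int[mu]_x `|H (x, y)|)%E.
    apply: (measurable_fun_fubini_tonelli_G (m1 := mu) (abse \o H)) => //=.
    exact: measurableT_comp.
  apply: ge0_le_integral => //.
    by apply: measurableT_comp => //; rewrite EGf.
  move=> y _; rewrite EGf; apply: le_abse_integral => //.
  by apply: measurableT_comp => //; exact: pair2_measurable.
- have := Fubini iH.
  under eq_integral do rewrite EF.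
  under [X in _ = X -> _]eq_integral do rewrite EG.
  by rewrite /Rintegral => ->.
Qed.

End RealLimits.

Section AffineChange.
Context {R : realType}.
Notation mu := (@lebesgue_measure R).
Implicit Types f g h : R -> R.

Lemma measurable_affine (a b : R) : measurable_fun [set: R] (fun x => a * x + b).
Proof. by apply: measurable_funD => //; exact: measurable_funM. Qed.

Let affine (a b : R) (x : measurableTypeR R) : measurableTypeR R := a * x + b.

Let measurable_affineT (a b : R) : measurable_fun [set: measurableTypeR R] (affine a b).
Proof. exact: measurable_affine. Qed.

(** This measure agrees with the Lebesgue measure on half-open intervals, hence
    everywhere; integration against it is the change of variable. *)
Let affine_measure (a b : R) (a0 : 0 < a) : {measure set (measurableTypeR R) -> \bar R} :=
  mscale (NngNum (ltW a0)) (measure_function_pushforward__canonical__measure_function_Measure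
   mu (measurable_affineT a b)).

Let affine_measureE (a b : R) (a0 : 0 < a) A : measurable A ->
  mu A = affine_measure b a0 A.
Proof.
move=> mA.
apply: lebesgue_measure_unique => // _ [[c d]] _ <-.
rewrite /affine_measure/= /mscale/= /pushforward.
rewrite (_ : _ @^-1` _ = `]((c - b) / a), ((d - b) / a)]%classic); last first.
  apply/seteqP; split => x; rewrite /= /affine !in_itv/= => /andP[h1 h2]; apply/andP.
    by rewrite ltr_pdivrMr// ler_pdivlMr// ltrBlDr lerBrDr mulrC.
  by move: h1 h2; rewrite ltr_pdivrMr// ler_pdivlMr// ltrBlDr lerBrDr mulrC.
rewrite !lebesgue_measure_itv/= !lte_fin.
rewrite ltr_pM2r ?invr_gt0// ltrD2r.
case: ifPn => // cd; last by rewrite mule0.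
by rewrite -EFinM; congr EFin; field; rewrite gt_eqF.
Qed.

Lemma ge0_integral_affine (a b : R) (f : R -> \bar R) : 0 < a ->
  measurable_fun [set: R] f -> (forall x, (0 <= f x)%E) ->
  (\int[mu]_x f x = a%:E * \int[mu]_x f (a * x + b)%R)%E.
Proof.
move=> a0 mf f0.
rewrite (eq_measure_integral (affine_measure b a0)); last first.
  by move=> A mA _; exact: affine_measureE.
rewrite ge0_integral_mscale//; congr (_ * _)%E.
by rewrite ge0_integral_pushforward.
Qed.

Let RI_affine_ge0 (a b : R) f : 0 < a -> rint f -> (forall x, 0 <= f x) ->
  rint (fun x => f (a * x + b)) /\
  \int[mu]_x f x = a * \int[mu]_x f (a * x + b).
Proof.
move=> a0 fi f0; have mf := rint_meas fi.
have E : (\int[mu]_x (f x)%:E = a%:E * \int[mu]_x (f (a * x + b)%R)%:E)%E.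
  by apply: ge0_integral_affine => //; exact/measurable_EFinP.
have i1 : rint (fun x => f (a * x + b)).
  apply: rint_ge0P => //.
    by apply: measurableT_comp => //; exact: measurable_affine.
  move: E; rewrite -[(\int[mu]_x _)%E](RI_E fi).
  set I := (X in (_ * X)%E) => E; suff : (I < +oo)%E by [].
  have : (0 <= I)%E by apply: integral_ge0 => x _; rewrite lee_fin.
  case: I E => [r _ _|+ _|//]; first by rewrite ltry.
  by rewrite gt0_muley// lte_fin.
by split => //; apply: EFin_inj; rewrite EFinM !RI_E.
Qed.

Lemma RI_affine (a b : R) f : 0 < a -> rint f ->
  rint (fun x => f (a * x + b)) /\
  \int[mu]_x f x = a * \int[mu]_x f (a * x + b).
Proof.
move=> a0 fi.
(* write f = (|f| + f) - |f| to reduce to nonnegative functions *)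
have [i1 e1] := RI_affine_ge0 b a0 (rint_abs fi) (fun _ => normr_ge0 _).
have p0 x : 0 <= `|f x| + f x by have := ler_norm (- f x); rewrite normrN; lra.
have [i2 e2] := RI_affine_ge0 b a0 (rintD (rint_abs fi) fi) p0.
have i3 : rint (fun x => f (a * x + b)).
  by apply: rint_eq (rintB i2 i1) => x; rewrite addrC addKr.
split => //.
move: e2; rewrite RID//; last exact: rint_abs.
by rewrite RID// mulrDr -e1 => /addrI.
Qed.

Lemma RI_shift (b : R) f : rint f ->
  rint (fun x => f (x + b)) /\ \int[mu]_x f (x + b) = \int[mu]_x f x.
Proof.
move=> fi; have [h1 h2] := RI_affine b ltr01 fi.
rewrite h2 mul1r; split; first by apply: rint_eq h1 => x; rewrite mul1r.
by apply: eq_Rintegral => x _; rewrite mul1r.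
Qed.

Lemma RI_opp f : rint f ->
  rint (fun x => f (- x)) /\ \int[mu]_x f (- x) = \int[mu]_x f x.
Proof.
move=> fi.
have mf := rint_meas fi.
have mo : measurable_fun [set: measurableTypeR R] (-%R : _ -> measurableTypeR R).
  exact: oppr_measurable.
have i1 : rint (fun x => f (- x)).
  apply/integrableP; split.
    by apply/measurable_EFinP; apply: measurableT_comp.
  have [_] := integrableP _ _ _ fi.
  rewrite (eq_measure_integral (pushforward mu (-%R : _ -> measurableTypeR R))); last first.
    by move=> A mA _; apply/esym; exact: lebesgue_measureN.
  rewrite ge0_integral_pushforward//.
  by apply: measurableT_comp => //; exact/measurable_EFinP.
split => //; rewrite /Rintegral; congr fine.
rewrite [RHS](eq_measure_integral (pushforward mu (-%R : _ -> measurableTypeR R))); last first.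
  by move=> A mA _; apply/esym; exact: lebesgue_measureN.
by rewrite integral_pushforward//; exact/measurable_EFinP.
Qed.

End AffineChange.

(** * Complex-valued functions *)

Notation normc := Normc.normc.

Section Modulus.
Context {R : realType}.
Notation C := R[i].
Notation ReC := (@complex.Re R).
Notation ImC := (@complex.Im R).
Implicit Types z w : C.

Lemma ReM z w : ReC (z * w) = ReC z * ReC w - ImC z * ImC w.
Proof. by case: z w => [a b] [c d]. Qed.

Lemma ImM z w : ImC (z * w) = ReC z * ImC w + ImC z * ReC w.
Proof. by case: z w => [a b] [c d]. Qed.

Lemma ReD z w : ReC (z + w) = ReC z + ReC w.
Proof. by case: z w => [a b] [c d]. Qed.

Lemma ImD z w : ImC (z + w) = ImC z + ImC w.
Proof. by case: z w => [a b] [c d]. Qed.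

Lemma ReN z : ReC (- z) = - ReC z.
Proof. by case: z. Qed.

Lemma ImN z : ImC (- z) = - ImC z.
Proof. by case: z. Qed.

Lemma ReJ z : ReC (conjc z) = ReC z.
Proof. by case: z. Qed.

Lemma ImJ z : ImC (conjc z) = - ImC z.
Proof. by case: z. Qed.

Lemma complexP z w : ReC z = ReC w -> ImC z = ImC w -> z = w.
Proof. by case: z w => [a b] [c d] /= -> ->. Qed.

Lemma sqr_normcE z : normc z ^+ 2 = ReC z ^+ 2 + ImC z ^+ 2.
Proof. by case: z => a b; rewrite sqr_sqrtr// addr_ge0// sqr_ge0. Qed.

Lemma normc_ge0 z : 0 <= normc z.
Proof. by case: z => a b; exact: sqrtr_ge0. Qed.

Lemma normc_conjc z : normc (conjc z) = normc z.
Proof. by case: z => a b; rewrite /= sqrrN. Qed.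

Lemma normcR (a : R) : normc a%:C = `|a|.
Proof. by rewrite /= expr0n/= addr0 sqrtr_sqr. Qed.

Lemma normc_Re z : `|ReC z| <= normc z.
Proof.
by case: z => a b /=; rewrite -sqrtr_sqr ler_wsqrtr// lerDl sqr_ge0.
Qed.

Lemma normc_Im z : `|ImC z| <= normc z.
Proof.
by case: z => a b /=; rewrite -sqrtr_sqr ler_wsqrtr// lerDr sqr_ge0.
Qed.

Lemma normc_le_ReIm z : normc z <= `|ReC z| + `|ImC z|.
Proof.
rewrite -(@ler_pXn2r _ 2)// ?nnegrE ?normc_ge0 ?addr_ge0// sqr_normcE.
have := normr_ge0 (ReC z); have := normr_ge0 (ImC z).
rewrite -(real_normK (num_real (ReC z))) -(real_normK (num_real (ImC z))); nra.
Qed.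

Lemma normcBD z w : normc (z - w) <= normc z + normc w.
Proof. by rewrite -(normcN w) le_normcD. Qed.

Lemma sqr_normcD z w :
  normc (z + w) ^+ 2 = normc z ^+ 2 + normc w ^+ 2 + 2 * ReC (z * conjc w).
Proof. by rewrite !sqr_normcE ReM ReD ImD ReJ ImJ; ring. Qed.

Lemma mul_conj_normc z : z * conjc z = (normc z ^+ 2)%:C.
Proof. by rewrite sqr_normcE; apply: complexP; rewrite ?ReM ?ImM ReJ ImJ /=; ring. Qed.

Lemma normcM_le z w : normc z * normc w <= normc z ^+ 2 + normc w ^+ 2.
Proof. by have := sqr_ge0 (normc z - normc w); have := sqr_ge0 (normc z);
 have := sqr_ge0 (normc w); nra. Qed.

Lemma sqr_normcD_le z w : normc (z + w) ^+ 2 <= 2 * normc z ^+ 2 + 2 * normc w ^+ 2.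
Proof.
have := le_normcD z w; have := normc_ge0 (z + w); have := normc_ge0 z; have := normc_ge0 w.
have := sqr_ge0 (normc z - normc w); nra.
Qed.

Lemma conjcM z w : conjc (z * w) = conjc z * conjc w.
Proof. by apply: complexP; rewrite ?(ReJ, ImJ, ReM, ImM); ring. Qed.

Lemma normc_cis (t : R) : normc (cis t) = 1.
Proof. by rewrite /= cos2Dsin2 sqrtr1. Qed.

Lemma cisD (s t : R) : cis (s + t) = cis s * cis t.
Proof. by apply: complexP; rewrite ?(ReM, ImM)/= ?cosD ?sinD; ring. Qed.

Lemma cisN (t : R) : cis (- t) = conjc (cis t).
Proof. by rewrite /cis /= cosN sinN. Qed.

Lemma cis0 : cis 0 = 1 :> C.
Proof. by rewrite /cis cos0 sin0. Qed.

End Modulus.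

Section ComplexMeasurable.
Context {R : realType} d {T : measurableType d}.
Notation C := R[i].
Notation ReC := (@complex.Re R).
Notation ImC := (@complex.Im R).
Implicit Types f g : T -> C.

Definition cmeas f : Prop :=
  measurable_fun [set: T] (fun x => ReC (f x)) /\
  measurable_fun [set: T] (fun x => ImC (f x)).

Lemma cmeasD f g : cmeas f -> cmeas g -> cmeas (fun x => f x + g x).
Proof.
move=> [f1 f2] [g1 g2]; split; under eq_fun do rewrite ?ReD ?ImD; exact: measurable_funD.
Qed.

Lemma cmeasN f : cmeas f -> cmeas (fun x => - f x).
Proof.
move=> [f1 f2]; split; under eq_fun do rewrite ?ReN ?ImN.
  exact: measurableT_comp.
exact: measurableT_comp.
Qed.

Lemma cmeasB f g : cmeas f -> cmeas g -> cmeas (fun x => f x - g x).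
Proof. by move=> mf mg; apply: cmeasD => //; exact: cmeasN. Qed.

Lemma cmeasM f g : cmeas f -> cmeas g -> cmeas (fun x => f x * g x).
Proof.
move=> [f1 f2] [g1 g2]; split; under eq_fun do rewrite ?ReM ?ImM.
  by apply: measurable_funB; exact: measurable_funM.
by apply: measurable_funD; exact: measurable_funM.
Qed.

Lemma cmeasJ f : cmeas f -> cmeas (fun x => conjc (f x)).
Proof.
move=> [f1 f2]; split; first by under eq_fun do rewrite ReJ.
by under eq_fun do rewrite ImJ; exact: measurableT_comp.
Qed.

Lemma cmeas_cst z : cmeas (fun=> z).
Proof. by split; exact: measurable_cst. Qed.

Lemma cmeas_real (h : T -> R) : measurable_fun [set: T] h -> cmeas (fun x => (h x)%:C).
Proof. by move=> mh; split => //=; exact: measurable_cst. Qed.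

Lemma cmeas_cis (h : T -> R) : measurable_fun [set: T] h -> cmeas (fun x => cis (h x)).
Proof.
move=> mh; split => /=; apply: measurableT_comp => //.
  by apply: continuous_measurable_fun; exact: continuous_cos.
by apply: continuous_measurable_fun; exact: continuous_sin.
Qed.

Lemma measurable_normc f : cmeas f -> measurable_fun [set: T] (fun x => normc (f x)).
Proof.
move=> [f1 f2].
rewrite (_ : (fun x => _) = (fun x => Num.sqrt (ReC (f x) ^+ 2 + ImC (f x) ^+ 2))).
  apply: measurableT_comp => //.
    by apply: continuous_measurable_fun; exact: sqrt_continuous.
  by apply: measurable_funD; exact: measurable_funX.
by apply/funext => x; case: (f x).
Qed.

Lemma measurable_normc2 f : cmeas f -> measurable_fun [set: T] (fun x => normc (f x) ^+ 2).
Proof. by move=> mf; apply: measurable_funX; exact: measurable_normc. Qed.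

End ComplexMeasurable.

Lemma cmeas_comp {R : realType} d1 d2 (T1 : measurableType d1) (T2 : measurableType d2)
  (f : T2 -> R[i]) (h : T1 -> T2) :
  cmeas f -> measurable_fun [set: T1] h -> cmeas (fun x => f (h x)).
Proof.
move=> [f1 f2] mh; split.
  exact: (measurableT_comp f1 mh).
exact: (measurableT_comp f2 mh).
Qed.

Section ComplexIntegral.
Context {R : realType}.
Notation C := R[i].
Notation ReC := (@complex.Re R).
Notation ImC := (@complex.Im R).
Notation mu := (@lebesgue_measure R).
Implicit Types f g : R -> C.

Lemma cint_cmeas f : cintegrable f -> cmeas f.
Proof. by move=> [f1 f2]; split; exact: rint_meas. Qed.

Lemma cint_le f (g : R -> R) : cmeas f -> (forall x, normc (f x) <= g x) -> rint g ->
  cintegrable f.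
Proof.
move=> [m1 m2] fg gi; split; apply: (rint_le _ _ gi) => // x.
  exact: (le_trans (normc_Re _)).
exact: (le_trans (normc_Im _)).
Qed.

Lemma cint_normc f : cintegrable f -> rint (fun x => normc (f x)).
Proof.
move=> fi; have mf := cint_cmeas fi; case: fi => f1 f2.
apply: (@rint_le _ _ (fun x => `|ReC (f x)| + `|ImC (f x)|)).
- exact: measurable_normc.
- by move=> x; rewrite ger0_norm ?normc_ge0// normc_le_ReIm.
- by apply: rintD; exact: rint_abs.
Qed.

Lemma cint_eq f g : f =1 g -> cintegrable f -> cintegrable g.
Proof. by move=> /funext ->. Qed.

Lemma CI_eq f g : f =1 g -> cintegral f = cintegral g.
Proof. by move=> /funext ->. Qed.

Lemma cintD f g : cintegrable f -> cintegrable g -> cintegrable (fun x => f x + g x).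
Proof.
by move=> [f1 f2] [g1 g2]; split; [apply: rint_eq (rintD f1 g1)|apply: rint_eq (rintD f2 g2)]
  => x; rewrite ?ReD ?ImD.
Qed.

Lemma CID f g : cintegrable f -> cintegrable g ->
  cintegral (fun x => f x + g x) = cintegral f + cintegral g.
Proof.
move=> [f1 f2] [g1 g2]; apply: complexP; rewrite ?ReD ?ImD /= -RID//.
  by apply: eq_Rintegral => x _; rewrite ReD.
by apply: eq_Rintegral => x _; rewrite ImD.
Qed.

Lemma cintZ z f : cintegrable f -> cintegrable (fun x => z * f x).
Proof.
move=> [f1 f2]; split.
  by apply: rint_eq (rintB (rintZ (ReC z) f1) (rintZ (ImC z) f2)) => x; rewrite ReM.
by apply: rint_eq (rintD (rintZ (ReC z) f2) (rintZ (ImC z) f1)) => x; rewrite ImM.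
Qed.

Lemma CIZ z f : cintegrable f -> cintegral (fun x => z * f x) = z * cintegral f.
Proof.
move=> [f1 f2]; apply: complexP; rewrite ?ReM ?ImM /=.
  rewrite -!RIZ// -RIB; [|exact: rintZ..].
  by apply: eq_Rintegral => x _; rewrite ReM.
rewrite -!RIZ// -RID; [|exact: rintZ..].
by apply: eq_Rintegral => x _; rewrite ImM.
Qed.

Lemma cintN f : cintegrable f -> cintegrable (fun x => - f x).
Proof. by move=> fi; apply: cint_eq (cintZ (-1) fi) => x; rewrite mulN1r. Qed.

Lemma CIN f : cintegrable f -> cintegral (fun x => - f x) = - cintegral f.
Proof. by move=> fi; rewrite -mulN1r -CIZ//; apply: CI_eq => x; rewrite mulN1r. Qed.

Lemma cintB f g : cintegrable f -> cintegrable g -> cintegrable (fun x => f x - g x).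
Proof. by move=> fi gi; apply: cintD => //; exact: cintN. Qed.

Lemma CIB f g : cintegrable f -> cintegrable g ->
  cintegral (fun x => f x - g x) = cintegral f - cintegral g.
Proof. by move=> fi gi; rewrite CID ?CIN//; exact: cintN. Qed.

Lemma cintJ f : cintegrable f -> cintegrable (fun x => conjc (f x)).
Proof.
move=> [f1 f2]; split; first by apply: rint_eq f1 => x; rewrite ReJ.
by apply: rint_eq (rintN f2) => x; rewrite ImJ.
Qed.

Lemma CIJ f : cintegrable f -> cintegral (fun x => conjc (f x)) = conjc (cintegral f).
Proof.
move=> [f1 f2]; apply: complexP => /=.
  by apply: eq_Rintegral => x _; rewrite ReJ.
by rewrite -RIN//; apply: eq_Rintegral => x _; rewrite ImJ.
Qed.

Lemma cintM_bdd f g (M : R) : cmeas g -> (forall x, normc (g x) <= M) ->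
  cintegrable f -> cintegrable (fun x => g x * f x).
Proof.
move=> mg gM fi; apply: (@cint_le _ (fun x => M * normc (f x))).
- by apply: cmeasM => //; exact: cint_cmeas.
- by move=> x; rewrite Normc.normcM ler_wpM2r// normc_ge0.
- exact/rintZ/cint_normc.
Qed.

(** Multiplication by the conjugate of the integral I makes it equal to |I|^2, so
    that only the real part of the integrand matters. *)
Lemma CI_normc f : cintegrable f -> normc (cintegral f) <= \int[mu]_x normc (f x).
Proof.
move=> fi; set I := cintegral f.
have [->|I0] := eqVneq (normc I) 0; first by apply: RI_ge0 => x; exact: normc_ge0.
have Ipos : 0 < normc I by rewrite lt_neqAle eq_sym I0 normc_ge0.
rewrite -(ler_pM2l Ipos) -expr2.
have -> : normc I ^+ 2 = ReC (cintegral (fun x => conjc I * f x)).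
  by rewrite CIZ// mulrC mul_conj_normc.
rewrite -RIZ; last exact: cint_normc.
apply: (@RI_le _ (fun x => ReC (conjc I * f x))).
- by have [] := cintZ (conjc I) fi.
- exact/rintZ/cint_normc.
move=> x; apply: (le_trans (ler_norm _)); apply: (le_trans (normc_Re _)).
by rewrite Normc.normcM normc_conjc.
Qed.

Lemma CI_normc_le f (g : R -> R) : cmeas f -> rint g ->
  (forall x, normc (f x) <= g x) -> normc (cintegral f) <= \int[mu]_x g x.
Proof.
move=> mf gi fg; have fi := cint_le mf fg gi.
by apply: (le_trans (CI_normc fi)); apply: RI_le => //; exact: cint_normc.
Qed.

Lemma CI_shift (b : R) f : cintegrable f ->
  cintegrable (fun x => f (x + b)) /\ cintegral (fun x => f (x + b)) = cintegral f.
Proof.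
move=> [f1 f2]; have [i1 e1] := RI_shift b f1; have [i2 e2] := RI_shift b f2.
by split => //; rewrite /cintegral e1 e2.
Qed.

Lemma CI_opp f : cintegrable f ->
  cintegrable (fun x => f (- x)) /\ cintegral (fun x => f (- x)) = cintegral f.
Proof.
move=> [f1 f2]; have [i1 e1] := RI_opp f1; have [i2 e2] := RI_opp f2.
by split => //; rewrite /cintegral e1 e2.
Qed.

Lemma CI_ae_eq f g : cmeas f -> cmeas g -> {ae mu, forall x, f x = g x} ->
  cintegral f = cintegral g.
Proof.
move=> [f1 f2] [g1 g2] fg; rewrite /cintegral.
by congr Complex; apply: RI_ae_eq => //; apply: aeS fg => x ->.
Qed.

Lemma CI_dct (F : nat -> R -> C) f (g : R -> R) : (forall n, cmeas (F n)) ->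
  (forall x, ReC (F n x) @[n --> \oo] --> ReC (f x)) ->
  (forall x, ImC (F n x) @[n --> \oo] --> ImC (f x)) -> rint g ->
  (forall n x, normc (F n x) <= g x) ->
  [/\ cintegrable f,
    ReC (cintegral (F n)) @[n --> \oo] --> ReC (cintegral f) &
    ImC (cintegral (F n)) @[n --> \oo] --> ImC (cintegral f)].
Proof.
move=> mF c1 c2 gi Fg.
have [i1 l1] := RI_dct (fun n => (mF n).1) c1 gi (fun n x => le_trans (normc_Re _) (Fg n x)).
have [i2 l2] := RI_dct (fun n => (mF n).2) c2 gi (fun n x => le_trans (normc_Im _) (Fg n x)).
by split.
Qed.

Lemma CI_fubini (F : R -> R -> C) (B : R -> R) :
  cmeas (fun z : R * R => F z.1 z.2) ->
  (forall x, cintegrable (F x)) -> (forall y, cintegrable (F^~ y)) ->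
  (forall x, \int[mu]_y normc (F x y) <= B x) -> rint B ->
  [/\ cintegrable (fun x => cintegral (F x)), cintegrable (fun y => cintegral (F^~ y)) &
   cintegral (fun x => cintegral (F x)) = cintegral (fun y => cintegral (F^~ y))].
Proof.
move=> [m1 m2] ix iy FB Bi.
have [a1 a2 a3] : [/\ rint (fun x => \int[mu]_y ReC (F x y)),
    rint (fun y => \int[mu]_x ReC (F x y)) &
   \int[mu]_x \int[mu]_y ReC (F x y) = \int[mu]_y \int[mu]_x ReC (F x y)].
  apply: RI_fubini m1 _ _ _ Bi; [by move=> x; case: (ix x)|by move=> y; case: (iy y)|].
  move=> x; apply: le_trans (FB x); apply: RI_le.
  - by apply: rint_abs; case: (ix x).
  - exact: cint_normc.
  - by move=> y; exact: normc_Re.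
have [b1 b2 b3] : [/\ rint (fun x => \int[mu]_y ImC (F x y)),
    rint (fun y => \int[mu]_x ImC (F x y)) &
   \int[mu]_x \int[mu]_y ImC (F x y) = \int[mu]_y \int[mu]_x ImC (F x y)].
  apply: RI_fubini m2 _ _ _ Bi; [by move=> x; case: (ix x)|by move=> y; case: (iy y)|].
  move=> x; apply: le_trans (FB x); apply: RI_le.
  - by apply: rint_abs; case: (ix x).
  - exact: cint_normc.
  - by move=> y; exact: normc_Im.
split; [by split|by split|].
by apply: complexP; [exact: a3|exact: b3].
Qed.

End ComplexIntegral.

(** * Integration of derivatives *)

Section FTC.
Context {R : realType}.
Notation mu := (@lebesgue_measure R).
Implicit Types f F : R -> R.

Lemma is_derive_continuous F f : (forall x : R, is_derive x 1 F (f x)) -> continuous F.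
Proof.
move=> dF x; apply: differentiable_continuous; apply/derivable1_diffP.
by case: (dF x).
Qed.

Lemma measurable_restrict_itv f (a b : R) : measurable_fun [set: R] f ->
  measurable_fun [set: R] (f \_ `[a, b]).
Proof.
by move=> mf; apply: (measurable_restrictT f _).1 => //; exact: measurable_funTS.
Qed.

Lemma rint_invD1sqr : rint (fun x : R => (1 + x ^+ 2)^-1).
Proof.
apply: rint_ge0P.
- apply: continuous_measurable_fun => x.
  exact: (@continuous_oneDsqrV R x).
- by move=> x; rewrite invr_ge0 addr_ge0// sqr_ge0.
rewrite ge0_symfun_integralT.
- rewrite -set_itvcy.
  have := @integral0y_oneDsqr R; rewrite /oneDsqr => ->.
  by rewrite -EFinM ltry.
- by move=> x; rewrite invr_ge0 addr_ge0// sqr_ge0.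
- exact: (@continuous_oneDsqrV R).
- by move=> x /=; rewrite sqrrN.
Qed.

Lemma cvg0_le (u v : nat -> R) : (forall n, `|u n| <= v n) ->
  v n @[n --> \oo] --> 0 -> u n @[n --> \oo] --> 0.
Proof.
move=> uv v0; apply/cvgr0Pnorm_le => e e0.
move/cvgr0_norm_le : v0 => /(_ _ e0); apply: filterS => n; apply: le_trans.
exact: (le_trans (uv n) (ler_norm _)).
Qed.

Lemma cvg_invn_bound (u : nat -> R) (M : R) : (forall n, `|u n| <= M / n.+1%:R) ->
  u n @[n --> \oo] --> 0.
Proof.
move=> uM; apply: (cvg0_le uM); rewrite -(mulr0 M).
by apply: cvgMl_tmp; exact: cvg_harmonic.
Qed.

(** The integral of f over [-n, n] is F(n) - F(-n), which tends to 0. *)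
Lemma RI_deriv0 F f (M : R) : (forall x : R, is_derive x 1 F (f x)) -> continuous f -> rint f ->
  (forall x, `|F x| <= M / (1 + x ^+ 2)) -> \int[mu]_x f x = 0.
Proof.
move=> dF cf fi FM.
have E n : \int[mu]_x (f \_ `[- n.+1%:R, n.+1%:R]) x = F n.+1%:R - F (- n.+1%:R).
  rewrite -Rintegral_mkcond /Rintegral.
  rewrite (@continuous_FTC2 _ f F)//.
  - by rewrite gtrN.
  - exact: continuous_subspaceT.
  - have cF := is_derive_continuous dF.
    split; last 2 first.
    + by apply: cvg_at_right_filter; exact: cF.
    + by apply: cvg_at_left_filter; exact: cF.
    by move=> x _; case: (dF x).
  - by move=> x _; rewrite derive1E; case: (dF x).
have [_ c1] : rint f /\ (\int[mu]_x (f \_ `[- n.+1%:R, n.+1%:R]) x @[n --> \oo] --> \int[mu]_x f x).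
  apply: (@RI_dct _ (fun n => f \_ `[- n.+1%:R, n.+1%:R]) f (fun x => `|f x|)).
  - by move=> n; apply: measurable_restrict_itv; exact: rint_meas.
  - move=> x; apply: cvg_near_cst.
    near=> n; rewrite patchE; case: ifPn => //; rewrite notin_setE/= in_itv/= => /negP.
    rewrite -ler_norml -ltNge => h.
    have : `|x| < n.+1%:R.
      near: n; exists (Num.bound `|x|) => // n /= bn.
      by apply: (lt_le_trans (archi_boundP (normr_ge0 _))); rewrite ler_nat leqW.
    by move=> /(lt_trans h); rewrite ltxx.
  - exact: rint_abs.
  - by move=> n x; rewrite patchE; case: ifP => //; rewrite normr0.
apply: (cvg_unique _ c1) => //.
rewrite (funext E).
apply: (@cvg_invn_bound (fun n => F n.+1%:R - F (- n.+1%:R)) (2 * M)) => n.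
have M0 : 0 <= M by have := FM 0; rewrite expr0n/= addr0 divr1; exact: le_trans.
apply: (le_trans (ler_normB _ _)); have := FM n.+1%:R; have := FM (- n.+1%:R).
rewrite sqrrN => h1 h2; apply: (le_trans (lerD h2 h1)).
rewrite -mulrDl -mulr2n -(mulr_natl M).
rewrite ler_wpM2l ?mulr_ge0// lef_pV2 ?posrE ?ltr0n//.
by rewrite ler_wpDl// expr2 ler_peMl// ler1n.
Unshelve. all: by end_near. Qed.

End FTC.

(** * Schwartz functions and the decay of their Fourier integrals *)

Section Schwartz.
Context {R : realType}.
Notation mu := (@lebesgue_measure R).
Implicit Types f g : R -> R.

Lemma derive1Sn f n : derive1n n.+1 f = derive1n n (derive1 f).
Proof. by rewrite /derive1n iterSr. Qed.

Lemma rschwartz_deriv f : rschwartz f -> rschwartz (derive1 f).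
Proof.
move=> [d b]; split; first by move=> n x; rewrite -derive1Sn; exact: d.
by move=> k n; have [M hM] := b k n.+1; exists M => x; rewrite -derive1Sn; exact: hM.
Qed.

Lemma rschwartz_is_derive f : rschwartz f -> forall x : R, is_derive x 1 f (derive1 f x).
Proof. by move=> [/(_ 0) d _] x; rewrite derive1E; apply: derivableP; exact: d. Qed.

Lemma rschwartz_continuous f : rschwartz f -> continuous f.
Proof. by move=> /rschwartz_is_derive; exact: is_derive_continuous. Qed.

Lemma rschwartz_bound f : rschwartz f -> exists M, forall x, `|f x| <= M / (1 + x ^+ 2).
Proof.
move=> [_ b]; have [M0 h0] := b 0 0; have [M2 h2] := b 2 0; exists (M0 + M2) => x.
have p : 0 < 1 + x ^+ 2 by rewrite ltr_wpDr// sqr_ge0.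
rewrite ler_pdivlMr// mulrDr mulr1 lerD//.
  by have := h0 x; rewrite expr0 mul1r.
by have := h2 x; rewrite real_normK ?num_real// mulrC.
Qed.

Lemma rschwartz_rint f : rschwartz f -> rint f.
Proof.
move=> sf; have [M hM] := rschwartz_bound sf.
apply: (rint_le _ hM); last exact: rintZ rint_invD1sqr.
by apply: continuous_measurable_fun; exact: rschwartz_continuous.
Qed.

Lemma rschwartzB f g : rschwartz f -> rschwartz g -> rschwartz (fun x => f x - g x).
Proof.
move=> [df bf] [dg bg].
have E n : derive1n n (fun x => f x - g x) = (fun x => derive1n n f x - derive1n n g x).
  elim: n => // n; rewrite derive1nS => ->; apply/funext => x.
  by rewrite derive1E deriveB ?derive1nS ?derive1E.
split; first by move=> n x; rewrite E; apply: derivableB.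
move=> k n; have [M hM] := bf k n; have [N hN] := bg k n; exists (M + N) => x.
rewrite E; apply: le_trans (lerD (hM x) (hN x)).
by rewrite -mulrDr ler_wpM2l ?exprn_ge0// ler_normB.
Qed.

Lemma le_normM_cos (a b : R) : `|a * cos b| <= `|a|.
Proof. by rewrite normrM ler_piMr// ler_norml cos_geN1 cos_le1. Qed.

Lemma le_normM_sin (a b : R) : `|a * sin b| <= `|a|.
Proof. by rewrite normrM ler_piMr// ler_norml sin_geN1 sin_le1. Qed.

Lemma measurable_cosM (b : R) : measurable_fun [set: R] (fun x => cos (b * x)).
Proof.
apply: measurableT_comp; last exact: measurable_funM.
by apply: continuous_measurable_fun; exact: continuous_cos.
Qed.

Lemma measurable_sinM (b : R) : measurable_fun [set: R] (fun x => sin (b * x)).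
Proof.
apply: measurableT_comp; last exact: measurable_funM.
by apply: continuous_measurable_fun; exact: continuous_sin.
Qed.

Lemma rint_cos f (b : R) : rint f -> rint (fun x => f x * cos (b * x)).
Proof.
move=> fi; apply: (rint_le _ _ (rint_abs fi)); last by move=> x; exact: le_normM_cos.
by apply: measurable_funM; [exact: rint_meas|exact: measurable_cosM].
Qed.

Lemma rint_sin f (b : R) : rint f -> rint (fun x => f x * sin (b * x)).
Proof.
move=> fi; apply: (rint_le _ _ (rint_abs fi)); last by move=> x; exact: le_normM_sin.
by apply: measurable_funM; [exact: rint_meas|exact: measurable_sinM].
Qed.

Lemma is_derive_mulr (b x : R) : is_derive x 1 (fun x => b * x) b.
Proof.
have h : is_derive x 1 (b \*: (@id R)) (b *: (1 : R)) by exact: is_deriveZ.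
by apply: (is_derive_eq h); rewrite /GRing.scale/= mulr1.
Qed.

Lemma is_derive_cosM (b x : R) : is_derive x 1 (fun x => cos (b * x)) (- b * sin (b * x)).
Proof.
have h := is_derive_mulr b x.
have := @is_derive1_comp _ cos (fun x => b * x) x _ _ (is_derive_cos (b * x)) h.
by move=> h2; apply: (is_derive_eq h2); ring.
Qed.

Lemma is_derive_sinM (b x : R) : is_derive x 1 (fun x => sin (b * x)) (b * cos (b * x)).
Proof.
have h := is_derive_mulr b x.
have := @is_derive1_comp _ sin (fun x => b * x) x _ _ (is_derive_sin (b * x)) h.
by move=> h2; apply: (is_derive_eq h2); ring.
Qed.

Lemma continuous_cosM (b : R) : continuous (fun x => cos (b * x)).
Proof. exact: is_derive_continuous (is_derive_cosM b). Qed.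

Lemma continuous_sinM (b : R) : continuous (fun x => sin (b * x)).
Proof. exact: is_derive_continuous (is_derive_sinM b). Qed.

Lemma RI_parts_cos f (b : R) : rschwartz f ->
  \int[mu]_x (derive1 f x * cos (b * x)) = b * \int[mu]_x (f x * sin (b * x)).
Proof.
move=> sf; have sd := rschwartz_deriv sf.
have i1 := rint_cos b (rschwartz_rint sd).
have i2 := rintZ b (rint_sin b (rschwartz_rint sf)).
rewrite -RIZ; last exact: rint_sin (rschwartz_rint sf).
apply/eqP; rewrite -subr_eq0 -RIB//; apply/eqP.
have [M hM] := rschwartz_bound sf.
apply: (@RI_deriv0 _ (fun x => f x * cos (b * x)) _ M).
- move=> x; have := is_deriveM (rschwartz_is_derive sf x) (is_derive_cosM b x).
  by move=> h; apply: (is_derive_eq h); rewrite /GRing.scale/=; ring.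
- move=> x; apply: cvgB.
    by apply: cvgM; [exact: rschwartz_continuous|exact: continuous_cosM].
  apply: cvgM; first exact: cvg_cst.
  by apply: cvgM; [exact: rschwartz_continuous|exact: continuous_sinM].
- exact: rintB.
- by move=> x; apply: le_trans (hM x); exact: le_normM_cos.
Qed.

Lemma RI_parts_sin f (b : R) : rschwartz f ->
  \int[mu]_x (derive1 f x * sin (b * x)) = - (b * \int[mu]_x (f x * cos (b * x))).
Proof.
move=> sf; have sd := rschwartz_deriv sf.
have i1 := rint_sin b (rschwartz_rint sd).
have i2 := rintZ b (rint_cos b (rschwartz_rint sf)).
rewrite -RIZ; last exact: rint_cos (rschwartz_rint sf).
apply/eqP; rewrite -subr_eq0 opprK -RID//; apply/eqP.
have [M hM] := rschwartz_bound sf.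
apply: (@RI_deriv0 _ (fun x => f x * sin (b * x)) _ M).
- move=> x; have := is_deriveM (rschwartz_is_derive sf x) (is_derive_sinM b x).
  by move=> h; apply: (is_derive_eq h); rewrite /GRing.scale/=; ring.
- move=> x; apply: cvgD.
    by apply: cvgM; [exact: rschwartz_continuous|exact: continuous_sinM].
  apply: cvgM; first exact: cvg_cst.
  by apply: cvgM; [exact: rschwartz_continuous|exact: continuous_cosM].
- exact: rintD.
- by move=> x; apply: le_trans (hM x); exact: le_normM_sin.
Qed.

(** Two integrations by parts gain the factor b^-2. *)
Lemma trig_decay f : rschwartz f -> exists M, forall b : R,
  `|\int[mu]_x (f x * cos (b * x))| <= M / (1 + b ^+ 2) /\
  `|\int[mu]_x (f x * sin (b * x))| <= M / (1 + b ^+ 2).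
Proof.
move=> sf; have sd := rschwartz_deriv sf; have sdd := rschwartz_deriv sd.
have fi := rschwartz_rint sf; have fddi := rschwartz_rint sdd.
exists (\int[mu]_x `|f x| + \int[mu]_x `|derive1 (derive1 f) x|) => b.
have p : 0 < 1 + b ^+ 2 by rewrite ltr_wpDr// sqr_ge0.
have nb : `|b ^+ 2| = b ^+ 2 by rewrite ger0_norm// sqr_ge0.
split; rewrite ler_pdivlMr// mulrDr mulr1 lerD//.
- apply: RI_abs_le; [exact: rint_cos|exact: rint_abs|by move=> x; exact: le_normM_cos].
- have -> : `|\int[mu]_x (f x * cos (b * x))| * b ^+ 2 =
    `|\int[mu]_x (derive1 (derive1 f) x * cos (b * x))|.
    by rewrite RI_parts_cos// RI_parts_sin// mulrN (mulrA b b) -(expr2 b) normrN normrM nb mulrC.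
  apply: RI_abs_le; [exact: rint_cos|exact: rint_abs|by move=> x; exact: le_normM_cos].
- apply: RI_abs_le; [exact: rint_sin|exact: rint_abs|by move=> x; exact: le_normM_sin].
- have -> : `|\int[mu]_x (f x * sin (b * x))| * b ^+ 2 =
    `|\int[mu]_x (derive1 (derive1 f) x * sin (b * x))|.
    by rewrite RI_parts_sin// RI_parts_cos// (mulrA b b) -(expr2 b) normrN normrM nb mulrC.
  apply: RI_abs_le; [exact: rint_sin|exact: rint_abs|by move=> x; exact: le_normM_sin].
Qed.

End Schwartz.

(** * Polynomials times Gaussians *)

Section PolynomialGaussian.
Context {R : realType}.
Implicit Types (p q : {poly R}) (s a b x : R).

Definition gexp s a x : R := expR (- ((s * (x - a)) ^+ 2 / 2)).

Lemma gexp_gt0 s a x : 0 < gexp s a x.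
Proof. exact: expR_gt0. Qed.

Lemma gexp_le1 s a x : gexp s a x <= 1.
Proof. by rewrite /gexp -expR0 ler_expR oppr_le0 divr_ge0// sqr_ge0. Qed.

Lemma is_derive_gexp s a x :
  is_derive x 1 (gexp s a) (- (s ^+ 2 * (x - a)) * gexp s a x).
Proof.
have h0 : is_derive x 1 (fun y : R => y - a) 1.
  have h : is_derive x 1 (@id R - cst a) (1 - 0 : R) by exact: is_deriveB.
  by apply: (is_derive_eq h); rewrite subr0.
have h1 : is_derive x 1 (fun y => - (s ^+ 2 / 2) * (y - a) ^+ 2) (- (s ^+ 2 * (x - a))).
  have h := is_deriveZ (- (s ^+ 2 / 2)) (is_deriveX 2 h0).
  by apply: (is_derive_eq h); rewrite /GRing.scale/= expr1; field.
have := @is_derive1_comp _ expR (fun y => - (s ^+ 2 / 2) * (y - a) ^+ 2) x _ _ (is_derive_expR _) h1.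
have -> : expR \o (fun y => - (s ^+ 2 / 2) * (y - a) ^+ 2) = gexp s a.
  by apply/funext => y; rewrite /gexp/=; congr expR; field.
move=> h; apply: (is_derive_eq h); rewrite mulrC; congr (_ * _).
by rewrite /gexp; congr expR; field.
Qed.

Lemma continuous_gexp s a : continuous (gexp s a).
Proof. exact: is_derive_continuous (is_derive_gexp s a). Qed.

Lemma measurable_gexp s a : measurable_fun [set: R] (gexp s a).
Proof. by apply: continuous_measurable_fun; exact: continuous_gexp. Qed.

Lemma exp_gexp_bound s n : 0 < s -> exists M, forall y : R, `|y| ^+ n * gexp s 0 y <= M.
Proof.
move=> s0.
suff [M hM] : exists M, forall y : R, (y ^+ 2) ^+ n * gexp s 0 y <= M.
  exists (1 + M) => y.
  have g0 := gexp_gt0 s 0 y; have g1 := gexp_le1 s 0 y; have := hM y.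
  have h : `|y| ^+ n <= 1 + (y ^+ 2) ^+ n.
    rewrite -(real_normK (num_real y)) -exprM mulnC exprM.
    have : 0 <= `|y| ^+ n by rewrite exprn_ge0.
    by move: (`|y| ^+ n) => z z0; nra.
  move=> h2; apply: (@le_trans _ _ ((1 + (y ^+ 2) ^+ n) * gexp s 0 y)).
    by rewrite ler_wpM2r// ltW.
  by rewrite mulrDl mul1r lerD.
case: n => [|n]; first by exists 1 => y; rewrite expr0 mul1r gexp_le1.
(* (t / N)^N <= e^t for t = (s y)^2 / 2 and N = n + 1, and y^2 = (2 N / s^2) (t / N) *)
exists ((2 * n.+1%:R / s ^+ 2) ^+ n.+1) => y.
pose t := (s * y) ^+ 2 / 2.
have t0 : 0 <= t by rewrite divr_ge0// sqr_ge0.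
have e : (t / n.+1%:R) ^+ n.+1 <= expR t.
  rewrite [X in expR X](_ : t = n.+1%:R * (t / n.+1%:R)); last by rewrite mulrCA divff ?mulr1// pnatr_eq0.
  rewrite expRM_natl.
  have tn : 0 <= t / n.+1%:R by apply: divr_ge0.
  rewrite lerXn2r// ?nnegrE ?expR_ge0//.
  by apply: le_trans (expR_ge1Dx _); rewrite lerDr.
have -> : gexp s 0 y = (expR t)^-1 by rewrite /gexp subr0 expRN.
rewrite ler_pdivrMr ?expR_gt0//.
apply: le_trans (ler_wpM2l _ e); last first.
  by apply: exprn_ge0; apply: divr_ge0; [exact: mulr_ge0|exact: sqr_ge0].
rewrite -exprMn.
have -> : 2 * n.+1%:R / s ^+ 2 * (t / n.+1%:R) = y ^+ 2; last by [].
have n0 : n.+1%:R != 0 :> R by rewrite pnatr_eq0.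
move: n0; move: (n.+1%:R) => N n0; rewrite /t.
by field; rewrite n0 gt_eqF.
Qed.

Lemma poly_gexp_bound s a p : 0 < s -> exists M, forall x, `|p.[x]| * gexp s a x <= M.
Proof.
move=> s0.
suff [M hM] : exists M, forall y : R, `|(p \Po ('X + a%:P)).[y]| * gexp s 0 y <= M.
  exists M => x; have := hM (x - a).
  by rewrite horner_comp !hornerE subrK /gexp subr0.
move: (p \Po _) => {}p.
elim/poly_ind: p => [|p c _].
  by exists 0 => y; rewrite horner0 normr0 mul0r.
move: (p * 'X + c%:P) => {c}p.
have [M hM] : exists M : nat -> R, forall n (y : R), `|y| ^+ n * gexp s 0 y <= M n.
  have [M hM] := @choice _ _ (fun n M => forall y : R, `|y| ^+ n * gexp s 0 y <= M) (fun n => exp_gexp_bound n s0).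
  by exists M.
exists (\sum_(i < size p) `|p`_i| * M i) => y.
rewrite horner_coef; apply: (@le_trans _ _ ((\sum_(i < size p) `|p`_i * y ^+ i|) * gexp s 0 y)).
  by rewrite ler_wpM2r ?ler_norm_sum// ltW// gexp_gt0.
rewrite mulr_suml; apply: ler_sum => i _.
by rewrite normrM normrX -mulrA ler_wpM2l.
Qed.

(** The class of these functions is stable under derivation and under products
    with polynomials, and its members are bounded: so they are Schwartz functions. *)
Definition gtrig s a b p q x := (p.[x] * cos (b * x) + q.[x] * sin (b * x)) * gexp s a x.

Lemma gtrig_bound s a b p q : 0 < s -> exists M, forall x, `|gtrig s a b p q x| <= M.
Proof.
move=> s0; have [M hM] := poly_gexp_bound a p s0; have [N hN] := poly_gexp_bound a q s0.
exists (M + N) => x; rewrite /gtrig normrM (gtr0_norm (gexp_gt0 _ _ _)).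
apply: le_trans (lerD (hM x) (hN x)); rewrite -mulrDl ler_wpM2r ?(ltW (gexp_gt0 _ _ _))//.
apply: (le_trans (ler_normD _ _)); rewrite lerD//; [exact: le_normM_cos|exact: le_normM_sin].
Qed.

Lemma is_derive_gtrig s a b p q x : is_derive x 1 (gtrig s a b p q)
  (gtrig s a b (p^`() + b *: q - s ^+ 2 *: (('X - a%:P) * p))
               (q^`() - b *: p - s ^+ 2 *: (('X - a%:P) * q)) x).
Proof.
have h1 := is_deriveM (is_derive_poly p x) (is_derive_cosM b x).
have h2 := is_deriveM (is_derive_poly q x) (is_derive_sinM b x).
have h3 := is_deriveM (is_deriveD h1 h2) (is_derive_gexp s a x).
apply: (is_derive_eq h3).
rewrite -[X in X *: _ + _ = _]/(p.[x] * cos (b * x) + q.[x] * sin (b * x)).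
by rewrite /gtrig !hornerE /GRing.scale/=; ring.
Qed.

Lemma rschwartz_gtrig s a b p q : 0 < s -> rschwartz (gtrig s a b p q).
Proof.
move=> s0.
have D r t : exists r' t', derive1 (gtrig s a b r t) = gtrig s a b r' t'.
  do 2 eexists; apply/funext => x; rewrite derive1E.
  by case: (is_derive_gtrig s a b r t x) => _ ->.
have Dn n : exists r' t', derive1n n (gtrig s a b p q) = gtrig s a b r' t'.
  elim: n => [|n [r [t E]]]; first by exists p, q.
  by rewrite derive1nS E; exact: D.
split.
  move=> n x; have [r [t ->]] := Dn n.
  by case: (is_derive_gtrig s a b r t x).
move=> k n; have [r [t ->]] := Dn n.
have [M hM] := gtrig_bound a b ('X^k * r) ('X^k * t) s0.
exists M => x; apply: le_trans (hM x).
rewrite -normrX -normrM le_eqVlt; apply/orP; left; apply/eqP; congr (`|_|).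
by rewrite /gtrig !hornerM hornerXn; move: (x ^+ k) => z; ring.
Qed.

(** Modulated Gaussians are the test functions of the L^2 theory: up to constants,
    the Fourier transform, translations and modulations permute them. *)
Definition cgauss s a b x : R[i] := (gexp s a x)%:C * cis (b * x).

Lemma schwartz_cgauss s a b : 0 < s -> schwartz (cgauss s a b).
Proof.
move=> s0; split.
  have -> : (fun x => complex.Re (cgauss s a b x)) = gtrig s a b 1 0.
    by apply/funext => x; rewrite /cgauss ReM /gtrig !hornerE /=; ring.
  exact: rschwartz_gtrig.
have -> : (fun x => complex.Im (cgauss s a b x)) = gtrig s a b 0 1.
  by apply/funext => x; rewrite /cgauss ImM /gtrig !hornerE /=; ring.
exact: rschwartz_gtrig.
Qed.

(** The factor x gives test functions that vanish at the origin. *)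
Lemma schwartz_xcgauss s a b : 0 < s -> schwartz (fun x => x%:C * cgauss s a b x).
Proof.
move=> s0; split.
  have -> : (fun x : R => complex.Re (x%:C * cgauss s a b x)) = gtrig s a b 'X 0.
    by apply/funext => x; rewrite /cgauss !(ReM, ImM) /gtrig !hornerE /=; ring.
  exact: rschwartz_gtrig.
have -> : (fun x : R => complex.Im (x%:C * cgauss s a b x)) = gtrig s a b 0 'X.
  by apply/funext => x; rewrite /cgauss !(ReM, ImM) /gtrig !hornerE /=; ring.
exact: rschwartz_gtrig.
Qed.

Lemma schwartzB (phi psi : R -> R[i]) : schwartz phi -> schwartz psi ->
  schwartz (fun x => phi x - psi x).
Proof.
move=> [a1 a2] [b1 b2]; split.
  under eq_fun do rewrite ReD ReN; exact: rschwartzB.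
under eq_fun do rewrite ImD ImN; exact: rschwartzB.
Qed.

End PolynomialGaussian.

(** * The Fourier transform of Gaussians *)

Section GaussianTransform.
Context {R : realType}.
Notation mu := (@lebesgue_measure R).
Notation C := R[i].
Implicit Types (s a b x : R).

Lemma rschwartz_gexp s a : 0 < s -> rschwartz (gexp s a).
Proof.
move=> s0; have -> : gexp s a = gtrig s a 0 1 0.
  by apply/funext => x; rewrite /gtrig !hornerE ?mul0r ?cos0 ?mul1r.
exact: rschwartz_gtrig.
Qed.

Lemma rint_gexp s a : 0 < s -> rint (gexp s a).
Proof. by move=> s0; exact/rschwartz_rint/rschwartz_gexp. Qed.

Lemma RI_gexp1 : \int[mu]_x gexp 1 0 x = Num.sqrt (2 * pi).
Proof.
have i1 : rint (gexp (1 : R) 0) by exact: rint_gexp.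
have s2 : (0 : R) < Num.sqrt 2 by rewrite sqrtr_gt0.
have [_ ->] := RI_affine 0 s2 i1.
rewrite (_ : \int[mu]_x _ = Num.sqrt pi); first by rewrite sqrtrM.
rewrite /Rintegral -[RHS]/(fine (Num.sqrt pi)%:E) -integralT_gauss.
congr fine; apply: eq_integral => x _; congr EFin; rewrite /gauss_fun /gexp; congr expR.
by rewrite addr0 subr0 mul1r exprMn sqr_sqrtr//; field.
Qed.

Let gcos b := \int[mu]_x (gexp 1 0 x * cos (b * x)).

(** Differentiation under the integral produces - x exp(-x^2/2), the derivative of
    the Gaussian; an integration by parts gives the equation y' = - b y. *)
Let is_derive_gcos b : is_derive b 1 gcos (- b * gcos b).
Proof.
have sg : rschwartz (gexp (1 : R) 0) by exact: rschwartz_gexp.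
pose f (c x : R) := gexp 1 0 x * cos (c * x).
have dE (c x : R) : is_derive c 1 (f ^~ x) (derive1 (gexp 1 0) x * sin (c * x)).
  have -> : derive1 (gexp 1 0) x = - x * gexp 1 0 x.
    rewrite derive1E; case: (is_derive_gexp 1 0 x) => _ ->.
    by rewrite expr1n mul1r subr0.
  have h := is_deriveZ (gexp 1 0 x) (is_derive_cosM x c).
  have -> : f^~ x = (gexp 1 0 x \*: (fun c => cos (x * c))).
    by apply/funext => d; rewrite /f/= [d * x]mulrC.
  by apply: (is_derive_eq h); rewrite /GRing.scale/= [c * x]mulrC; ring.
have d1 (c x : R) : partial1of2 f c x = derive1 (gexp 1 0) x * sin (c * x).
  by rewrite partial1of2E; case: (dE c x) => _ ->.
have intf c : `]b - 1, b + 1[%classic c -> mu.-integrable [set: R] (EFin \o f c).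
  by move=> _; apply: rint_cos; exact: rschwartz_rint.
have derf c x : `]b - 1, b + 1[%classic c -> [set: R] x -> derivable (f^~ x) c 1.
  by move=> _ _; case: (dE c x).
have ib : `]b - 1, b + 1[%classic b by rewrite /= in_itv/=; apply/andP; split; lra.
have G0 (x : R) : 0 <= `|derive1 (gexp 1 0) x| by [].
have iG : mu.-integrable [set: R] (EFin \o (fun x => `|derive1 (gexp 1 0) x|)).
  by apply: rint_abs; apply: rschwartz_rint; exact: rschwartz_deriv.
have Gub c x : `]b - 1, b + 1[%classic c -> [set: R] x ->
    `|partial1of2 f c x| <= `|derive1 (gexp 1 0) x|.
  by move=> _ _; rewrite d1; exact: le_normM_sin.
have D := @derivable_under_integral R _ _ mu f setT measurableT _ _ _ ib intf derf _ G0 iG Gub.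
have E := @differentiation_under_integral R _ _ mu f setT measurableT _ _ _ ib intf derf _ G0 iG Gub.
apply: DeriveDef => //.
by rewrite -derive1E E (RI_eq (d1 b)) RI_parts_sin// mulNr.
Qed.

Lemma RI_gexp_cos b :
  \int[mu]_x (gexp 1 0 x * cos (b * x)) = Num.sqrt (2 * pi) * expR (- (b ^+ 2 / 2)).
Proof.
pose H (c : R) := gcos c * expR (c ^+ 2 / 2).
have de (c : R) : is_derive c 1 (fun c : R => expR (c ^+ 2 / 2)) (c * expR (c ^+ 2 / 2)).
  have h : is_derive c 1 (fun y : R => 2^-1 * y ^+ 2) c.
    have h := is_deriveZ (2^-1 : R) (is_deriveX 2 (is_derive_id c 1)).
    by apply: (is_derive_eq h); rewrite /GRing.scale/= expr1; field.
  have := @is_derive1_comp _ expR (fun y => 2^-1 * y ^+ 2) c _ _ (is_derive_expR _) h.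
  have -> : expR \o (fun y : R => 2^-1 * y ^+ 2) = (fun c => expR (c ^+ 2 / 2)).
    by apply/funext => y /=; rewrite mulrC.
  by move=> h2; apply: (is_derive_eq h2); rewrite mulrC [_^-1 * _]mulrC.
have dH (c : R) : is_derive c 1 H 0.
  have h := is_deriveM (is_derive_gcos c) (de c).
  by apply: (is_derive_eq h); rewrite /GRing.scale/=; ring.
have E : H b = H 0 by apply: is_derive_0_is_cst.
have E0 : H 0 = Num.sqrt (2 * pi).
  rewrite /H expr0n/= mul0r expR0 mulr1 -RI_gexp1; apply: eq_Rintegral => x _.
  by rewrite mul0r cos0 mulr1.
by rewrite -E0 -E /H -mulrA -expRD subrr expR0 mulr1.
Qed.

Lemma RI_gexp_sin b : \int[mu]_x (gexp 1 0 x * sin (b * x)) = 0.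
Proof.
have i1 : rint (fun x => gexp 1 0 x * sin (b * x)) by apply: rint_sin; exact: rint_gexp.
have [_ e] := RI_opp i1.
have : \int[mu]_x (gexp 1 0 x * sin (b * x)) = - \int[mu]_x (gexp 1 0 x * sin (b * x)).
  rewrite -{1}e -RIN//; apply: eq_Rintegral => x _.
  by rewrite /gexp !subr0 !mul1r sqrrN mulrN sinN mulrN.
lra.
Qed.

Lemma CI_affine a b (f : R -> C) : 0 < a -> cintegrable f ->
  cintegrable (fun x => f (a * x + b)) /\
  cintegral f = a%:C * cintegral (fun x => f (a * x + b)).
Proof.
move=> a0 [f1 f2]; have [i1 e1] := RI_affine b a0 f1; have [i2 e2] := RI_affine b a0 f2.
by split => //; apply: complexP; rewrite ?ReM ?ImM /= ?mul0r ?subr0 ?addr0.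
Qed.

(** The Fourier transform of the Gaussian gexp s 0. *)
Definition gker s x : R := Num.sqrt (2 * pi) / s * gexp s^-1 0 x.

Lemma gker_ge0 s x : 0 < s -> 0 <= gker s x.
Proof.
by move=> s0; rewrite mulr_ge0 ?(ltW (gexp_gt0 _ _ _))// divr_ge0 ?sqrtr_ge0// ltW.
Qed.

Lemma gkerN s x : gker s (- x) = gker s x.
Proof. by rewrite /gker /gexp !subr0 mulrN sqrrN. Qed.

Lemma gker_sym s x y : gker s (x - y) = gker s (y - x).
Proof. by rewrite -gkerN opprB. Qed.

Lemma gker_le s x : 0 < s -> gker s x <= Num.sqrt (2 * pi) / s.
Proof.
by move=> s0; rewrite ler_piMr ?gexp_le1// divr_ge0 ?sqrtr_ge0// ltW.
Qed.

Lemma measurable_gker s : measurable_fun [set: R] (gker s).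
Proof. by apply: measurable_funM => //; exact: measurable_gexp. Qed.

Lemma rint_gker s : 0 < s -> rint (gker s).
Proof. by move=> s0; apply: rintZ; apply: rint_gexp; rewrite invr_gt0. Qed.

Lemma RI_gker s : 0 < s -> \int[mu]_x gker s x = 2 * pi.
Proof.
move=> s0; have [_ ->] := RI_affine 0 s0 (rint_gker s0).
have -> : \int[mu]_x gker s (s * x + 0) = Num.sqrt (2 * pi) / s * \int[mu]_x gexp 1 0 x.
  rewrite -RIZ; last exact: rint_gexp.
  apply: eq_Rintegral => x _; rewrite /gker /gexp addr0 !subr0 mul1r mulKf//.
  by rewrite gt_eqF.
rewrite RI_gexp1 mulrA mulrCA divff ?gt_eqF// mulr1 -expr2 sqr_sqrtr//.
by rewrite mulr_ge0// pi_ge0.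
Qed.

Lemma cint_cgauss s a b : 0 < s -> cintegrable (cgauss s a b).
Proof.
move=> s0; apply: (@cint_le _ _ (gexp s a)); last exact: rint_gexp.
  apply: cmeasM; first by apply: cmeas_real; exact: measurable_gexp.
  by apply: cmeas_cis; exact: measurable_funM.
by move=> x; rewrite Normc.normcM normc_cis mulr1 normcR gtr0_norm// gexp_gt0.
Qed.

Lemma CI_cgauss s a b : 0 < s -> cintegral (cgauss s a b) = (gker s b)%:C * cis (a * b).
Proof.
move=> s0; have si : 0 < s^-1 by rewrite invr_gt0.
have [_ ->] := CI_affine a si (cint_cgauss a b s0).
have E x : cgauss s a b (s^-1 * x + a) = cis (a * b) * cgauss 1 0 (b / s) x.
  rewrite /cgauss [RHS]mulrCA -cisD; congr (_%:C * cis _); last by ring.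
  rewrite /gexp addrK subr0 mul1r mulrA divff ?mul1r// gt_eqF//.
rewrite (CI_eq E) CIZ; last exact: cint_cgauss.
have -> : cintegral (cgauss 1 0 (b / s)) = (Num.sqrt (2 * pi) * gexp s^-1 0 b)%:C.
  apply: complexP => /=.
    rewrite (RI_eq (g := fun x => gexp 1 0 x * cos ((b / s) * x))); last first.
      by move=> x; rewrite mul0r subr0.
    rewrite RI_gexp_cos /gexp subr0; congr (_ * expR (- (_ ^+ 2 / 2))).
    by rewrite mulrC.
  rewrite (RI_eq (g := fun x => gexp 1 0 x * sin ((b / s) * x))) ?RI_gexp_sin//.
  by move=> x; rewrite mul0r addr0.
by rewrite /gker; apply: complexP; rewrite !(ReM, ImM)/=; ring.
Qed.

Lemma fourier_cgauss s a b x : 0 < s ->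
  fourier (cgauss s a b) x = (gker s (x - b))%:C * cis (a * (b - x)).
Proof.
move=> s0; rewrite gker_sym -CI_cgauss//; apply: CI_eq => y.
by rewrite /cgauss -mulrA -cisD; congr (_ * cis _); ring.
Qed.

End GaussianTransform.

(** * The Fourier transform of integrable functions *)

Section FourierL1.
Context {R : realType}.
Notation mu := (@lebesgue_measure R).
Notation C := R[i].
Notation ReC := (@complex.Re R).
Implicit Types f phi : R -> C.

Lemma cint_cis f (h : R -> R) : measurable_fun [set: R] h -> cintegrable f ->
  cintegrable (fun x => f x * cis (h x)).
Proof.
move=> mh fi; apply: (@cint_le _ _ (fun x => normc (f x))); last exact: cint_normc.
  by apply: cmeasM; [exact: cint_cmeas|exact: cmeas_cis].
by move=> x; rewrite Normc.normcM normc_cis mulr1.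
Qed.

Lemma cint_fourier f (xi : R) : cintegrable f ->
  cintegrable (fun x => f x * cis (- (x * xi))).
Proof.
by move=> fi; apply: cint_cis => //; apply: measurableT_comp => //; exact: measurable_funM.
Qed.

Lemma fourier_le f (xi : R) : cintegrable f ->
  normc (fourier f xi) <= \int[mu]_x normc (f x).
Proof.
move=> fi; apply: (le_trans (CI_normc (cint_fourier xi fi))); apply: RI_le.
- exact: cint_normc (cint_fourier xi fi).
- exact: cint_normc.
- by move=> x; rewrite Normc.normcM normc_cis mulr1.
Qed.

(** Both sides integrate f(x) phi(xi) e^(- i x xi) over the plane. *)
Lemma fourier_mult f phi : cintegrable f -> cintegrable phi ->
  [/\ cintegrable (fun x => f x * fourier phi x),
      cintegrable (fun xi => fourier f xi * phi xi) &
   cintegral (fun x => f x * fourier phi x) = cintegral (fun xi => fourier f xi * phi xi)].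
Proof.
move=> fi pi; have mf := cint_cmeas fi; have mp := cint_cmeas pi.
pose F (x xi : R) : C := f x * (phi xi * cis (- (xi * x))).
have E1 x : cintegral (F x) = f x * fourier phi x.
  by rewrite CIZ; last exact: cint_fourier.
have EF xi : F^~ xi =1 (fun x => phi xi * (f x * cis (- (x * xi)))).
  by move=> x; rewrite /F mulrCA [xi * x]mulrC.
have E2 xi : cintegral (F^~ xi) = fourier f xi * phi xi.
  rewrite (CI_eq (EF xi)) CIZ; last exact: cint_fourier.
  by rewrite mulrC.
have [] := @CI_fubini _ F (fun x => normc (f x) * \int[mu]_y normc (phi y)).
- apply: cmeasM; first exact: (cmeas_comp mf measurable_fst).
  apply: cmeasM; first exact: (cmeas_comp mp measurable_snd).
  apply: cmeas_cis; apply: measurableT_comp => //.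
  by apply: measurable_funM; [exact: measurable_snd|exact: measurable_fst].
- by move=> x; apply: cintZ; exact: cint_fourier.
- move=> xi; apply: cint_eq (cintZ (phi xi) (cint_fourier xi fi)) => x.
  by rewrite EF.
- move=> x; rewrite -RIZ; last exact: cint_normc.
  apply: RI_le.
  + by apply: cint_normc; apply: cintZ; exact: cint_fourier.
  + by apply: rintZ; exact: cint_normc.
  + by move=> y; rewrite !Normc.normcM normc_cis mulr1.
- have := rintZ (\int[mu]_y normc (phi y)) (cint_normc fi).
  by apply: rint_eq => x; rewrite mulrC.
by rewrite (funext E1) (funext E2).
Qed.

(** The multiplication formula with a Gaussian contains the measurability of the
    product of the transform with this Gaussian, which is then divided out. *)
Lemma fourier_cmeas f : cintegrable f -> cmeas (fourier f).
Proof.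
move=> fi.
have [_ i _] := fourier_mult fi (cint_cgauss 0 0 (@ltr01 R)).
have E xi : fourier f xi =
    (expR ((1 * (xi - 0)) ^+ 2 / 2))%:C * (fourier f xi * cgauss 1 0 0 xi).
  rewrite /cgauss mul0r cis0 mulr1 mulrCA -rmorphM/= /gexp -expRD subrr expR0.
  by rewrite mulr1.
rewrite (funext E); apply: cmeasM; last exact: cint_cmeas.
apply: cmeas_real; apply: measurableT_comp => //.
apply: measurable_funM => //; apply: measurable_funX; apply: measurable_funM => //.
exact: measurable_funB.
Qed.

Lemma gexp_cvg1 (u : nat -> R) (x : R) : u n @[n --> \oo] --> 0 ->
  gexp (u n) 0 x @[n --> \oo] --> (1 : R).
Proof.
move=> u0.
have E y : gexp y 0 x = gexp x 0 y by rewrite /gexp !subr0 (mulrC y).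
have -> : (1 : R) = gexp x 0 0 by rewrite /gexp subrr mulr0 expr0n/= mul0r oppr0 expR0.
rewrite (_ : (fun n => _) = (gexp x 0) \o u); last by apply/funext => n; rewrite /= -E.
exact: (cvg_comp u (gexp x 0) u0 (@continuous_gexp _ x 0 0)).
Qed.

Lemma fourier_cgauss_centered (s x y : R) : 0 < s -> 
  fourier (cgauss s 0 y) x = (gker s (x - y))%:C.
Proof. by move=> s0; rewrite fourier_cgauss// mul0r cis0 mulr1. Qed.

Lemma amgmM (a b k : R) : 0 <= k -> a * b * k <= 2^-1 * (a ^+ 2 * k) + 2^-1 * (b ^+ 2 * k).
Proof. by move=> k0; have := mulr_ge0 (sqr_ge0 (a - b)) k0; nra. Qed.

(** Damp |F f|^2 by the Gaussian exp(- (s xi)^2/2). By the multiplication formula its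
    integral is the double integral of f(x) times the conjugate of f(y) times
    K(y - x), where K >= 0 has integral 2 pi. The inequality 2 |f(x) f(y)| <=
    |f(x)|^2 + |f(y)|^2 bounds it by 2 pi |f|^2, and Fatou's lemma removes the
    damping. *)
Lemma bessel f : cintegrable f -> rint (fun x => normc (f x) ^+ 2) ->
  rint (fun xi => normc (fourier f xi) ^+ 2) /\
  \int[mu]_xi (normc (fourier f xi) ^+ 2) <= 2 * pi * \int[mu]_x (normc (f x) ^+ 2).
Proof.
move=> fi f2; have mf := cint_cmeas fi.
pose N x := normc (f x) ^+ 2; pose A := \int[mu]_x (normc (f x) ^+ 2).
have mF := fourier_cmeas fi.
pose M := \int[mu]_x normc (f x).
have FM xi : normc (fourier f xi) <= M by exact: fourier_le.
have key s : 0 < s ->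
  rint (fun xi => normc (fourier f xi) ^+ 2 * gexp s 0 xi) /\
  \int[mu]_xi (normc (fourier f xi) ^+ 2 * gexp s 0 xi) <= 2 * pi * A.
  move=> s0.
  pose K := gker s; have iK : rint K := rint_gker s0.
  have iKx x : rint (fun y => K (y - x)) by case: (RI_shift (- x) iK).
  have eKx x : \int[mu]_y K (y - x) = 2 * pi.
    by rewrite (RI_shift (- x) iK).2 RI_gker.
  have K0 x : 0 <= K x by exact: gker_ge0.
  pose Phi xi : C := conjc (fourier f xi) * (gexp s 0 xi)%:C.
  have iPhi : cintegrable Phi.
    apply: (@cintM_bdd _ _ _ M).
    - exact: cmeasJ.
    - by move=> xi; rewrite normc_conjc.
    - by split; [exact: rint_gexp|exact: rint0].
  have [i1 _ E1] := fourier_mult fi iPhi.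
  have EN xi : fourier f xi * Phi xi = (normc (fourier f xi) ^+ 2 * gexp s 0 xi)%:C.
    by rewrite /Phi mulrA mul_conj_normc -rmorphM.
  have iN : rint (fun xi => normc (fourier f xi) ^+ 2 * gexp s 0 xi).
    apply: (@rintM_bdd _ _ _ (M ^+ 2)); last exact: rint_gexp.
      exact: measurable_normc2.
    move=> xi; rewrite ger0_norm ?sqr_ge0// lerXn2r ?nnegrE ?normc_ge0//.
    exact: le_trans (normc_ge0 _) (FM xi).
  split => //.
  have -> : \int[mu]_xi (normc (fourier f xi) ^+ 2 * gexp s 0 xi) =
      ReC (cintegral (fun x => f x * fourier Phi x)).
    by rewrite E1 (CI_eq EN).
  pose W x := cintegral (fun y => f y * (K (y - x))%:C).
  have ifK x : cintegrable (fun y => f y * (K (y - x))%:C).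
    apply: (@cint_eq _ (fun y => (K (y - x))%:C * f y)); first by move=> y; rewrite mulrC.
    apply: (@cintM_bdd _ _ _ (Num.sqrt (2 * pi) / s)) => //.
      by apply: cmeas_real; exact: rint_meas.
    by move=> y; rewrite normcR ger0_norm// gker_le.
  have EW x : fourier Phi x = conjc (W x).
    have [_ i2 E2] := fourier_mult fi (cint_cgauss 0 x s0).
    have -> : W x = cintegral (fun y => f y * fourier (cgauss s 0 x) y).
      by apply: CI_eq => y; rewrite fourier_cgauss_centered.
    rewrite E2 -CIJ//; apply: CI_eq => xi.
    rewrite /Phi /cgauss !conjcM -cisN -mulrA [xi * x]mulrC; congr (_ * (_ * _)).
    by rewrite /= oppr0.
  (* the integral over y of (N x + N y) / 2 * K (y - x) *)
  pose H x := pi * N x + 2^-1 * \int[mu]_y (N y * K (y - x)).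
  have iNK x : rint (fun y => N y * K (y - x)).
    apply: (@rint_eq _ (fun y => K (y - x) * N y)); first by move=> y; rewrite mulrC.
    apply: (@rintM_bdd _ _ _ (Num.sqrt (2 * pi) / s)) => //.
      exact: rint_meas.
    by move=> y; rewrite ger0_norm// gker_le.
  have [j1 j2 j3] : [/\ rint (fun y => \int[mu]_x (N y * K (y - x))),
       rint (fun x => \int[mu]_y (N y * K (y - x))) &
       \int[mu]_y \int[mu]_x (N y * K (y - x)) = \int[mu]_x \int[mu]_y (N y * K (y - x))].
    have iKy y : rint (fun x => K (y - x)).
      by apply: rint_eq (iKx y) => x; rewrite /K gker_sym.
    apply: (@RI_fubini _ (fun y x => N y * K (y - x)) (fun y => 2 * pi * N y)).
    - apply: measurable_funM; first exact: (measurableT_comp (measurable_normc2 mf) measurable_fst).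
      apply: measurableT_comp; first exact: measurable_gker.
      by apply: measurable_funB; [exact: measurable_fst|exact: measurable_snd].
    - by move=> y; apply: rintZ; exact: iKy.
    - exact: iNK.
    - move=> y; rewrite [leRHS]mulrC -(eKx y) -RIZ; last exact: iKx.
      rewrite le_eqVlt; apply/orP; left; apply/eqP; apply: RI_eq => x.
      by rewrite ger0_norm; [rewrite /K gker_sym|exact: (mulr_ge0 (sqr_ge0 _))].
    - exact: rintZ.
  have E3 : \int[mu]_x \int[mu]_y (N y * K (y - x)) = 2 * pi * A.
    have E4 y : \int[mu]_x (N y * K (y - x)) = 2 * pi * N y.
      rewrite RIZ; last by apply: rint_eq (iKx y) => x; rewrite /K gker_sym.
      rewrite [RHS]mulrC; congr (_ * _); rewrite -[RHS](eKx y).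
      by apply: RI_eq => x; rewrite /K gker_sym.
    by rewrite -j3 (RI_eq E4) (RIZ _ f2).
  have iH : rint H by apply: rintD; exact: rintZ.
  have EH : \int[mu]_x H x = 2 * pi * A.
    rewrite /H RID; [|exact: rintZ|exact: rintZ].
    rewrite (RIZ _ f2) (RIZ _ j2) E3 -/A.
    have h (a : R) : pi * a + 2^-1 * (2 * pi * a) = 2 * pi * a by field.
    exact: h.
  rewrite -EH.
  apply: (RI_le i1.1 iH) => x; apply: (le_trans (ler_norm _)); apply: (le_trans (normc_Re _)).
  rewrite Normc.normcM EW normc_conjc.
  apply: (@le_trans _ _ (normc (f x) * \int[mu]_y (normc (f y) * K (y - x)))).
    apply: ler_wpM2l; first exact: normc_ge0.
    apply: (le_trans (CI_normc (ifK x))).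
    rewrite le_eqVlt; apply/orP; left; apply/eqP; apply: RI_eq => y.
    by rewrite Normc.normcM normcR ger0_norm.
  have i3 : rint (fun y => normc (f y) * K (y - x)).
    by apply: rint_eq (cint_normc (ifK x)) => y; rewrite Normc.normcM normcR ger0_norm.
  have i5 : rint (fun y => 2^-1 * (N x * K (y - x))) by do 2 apply: rintZ.
  have i6 : rint (fun y => 2^-1 * (N y * K (y - x))) by apply: rintZ.
  have -> : H x = \int[mu]_y (2^-1 * (N x * K (y - x)) + 2^-1 * (N y * K (y - x))).
    rewrite (RID i5 i6) (RIZ _ (iNK x)) (RIZ _ (rintZ (N x) (iKx x))) (RIZ _ (iKx x)) eKx /H.
    congr (_ + _); have h (a : R) : pi * a = 2^-1 * (a * (2 * pi)) by field.
    exact: h.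
  rewrite -(RIZ _ i3); apply: RI_le; [exact: rintZ|exact: rintD|].
  move=> y; rewrite mulrA.
  exact: amgmM.
apply: (@RI_fatou _ (fun n xi => normc (fourier f xi) ^+ 2 * gexp n.+1%:R^-1 0 xi)).
- by move=> n; apply: measurable_funM; [exact: measurable_normc2|exact: measurable_gexp].
- by move=> n xi; rewrite mulr_ge0 ?sqr_ge0 ?(ltW (gexp_gt0 _ _ _)).
- move=> xi; rewrite -[X in _ --> X]mulr1; apply: cvgMl_tmp.
  by apply: gexp_cvg1; exact: cvg_harmonic.
- move=> n; have n0 : 0 < n.+1%:R^-1 :> R by rewrite invr_gt0.
  by have [i le] := key _ n0; rewrite -RI_E// lee_fin.
Qed.

End FourierL1.

(** * Approximate identities *)

Section ApproxIdentity.
Context {R : realType}.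
Notation mu := (@lebesgue_measure R).
Implicit Types f g w q : R -> R.

Lemma rint_indic_itv (a b : R) : rint (\1_(`[a, b]) : R -> R).
Proof. exact: integrable_indic_itv. Qed.

Lemma indic_itvE (a b x : R) : (\1_(`[a, b]) : R -> R) x = if a <= x <= b then 1 else 0.
Proof.
rewrite indicE; case: ifP => h; first by rewrite mem_set//= in_itv.
by rewrite memNset//= in_itv/= h.
Qed.

Lemma rint_restrict (a b : R) f : mu.-integrable `[a, b] (EFin \o f) ->
  rint (f \_ `[a, b]).
Proof.
move=> fi; rewrite /rint -restrict_EFin.
by apply: (integrable_mkcond _ _).1.
Qed.

Lemma continuous_itv_bound g (a b : R) : continuous g ->
  exists M, 0 <= M /\ forall x, a <= x <= b -> `|g x| <= M.
Proof.
move=> cg.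
have cgs : {within `[a, b], continuous g} by exact: continuous_subspaceT.
have /compact_bounded[M [_ hM]] := continuous_compact cgs (@segment_compact _ a b).
exists (`|M| + 1); split; first by rewrite addr_ge0.
move=> x xab; apply: (hM (`|M| + 1)).
  by rewrite (le_lt_trans (ler_norm _))// ltrDl.
by exists x => //=; rewrite in_itv.
Qed.

(** Replace f by a continuous function g that is close to it in L^1: for g,
    dominated convergence applies. *)
Lemma cvg_translate f w (N n : R) (tau : nat -> R) :
  (forall a b : R, mu.-integrable `[a, b] (EFin \o f)) ->
  measurable_fun [set: R] f -> 
  measurable_fun [set: R] w -> (forall x, `|w x| <= N * \1_(`[- n, n]) x) ->
  (forall k, rint (fun y => f (y + tau k) * w y)) -> rint (fun y => f y * w y) ->
  tau k @[k --> \oo] --> 0 ->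
  \int[mu]_y (f (y + tau k) * w y) @[k --> \oo] --> \int[mu]_y (f y * w y).
Proof.
move=> fi mf mw wN ik i0 tau0.
have N0 y : 0 <= N * \1_(`[- n, n]) y by apply: le_trans (wN y).
(* the support of w, enlarged to contain its translates by at most 1 *)
pose J := `[- (n + 1), n + 1]%classic : set R.
have mJ : measurable J by exact: measurable_itv.
apply/cvgrPdist_le => e e0.
have [e1 [e10 e1e]] : exists e1, 0 < e1 /\ `|N| * e1 + `|N| * e1 + e1 <= e.
  exists (e / (2 * `|N| + 1)); have p : 0 < 2 * `|N| + 1 by rewrite ltr_wpDl// mulr_ge0.
  split; first by rewrite divr_gt0.
  by rewrite le_eqVlt; apply/orP; left; apply/eqP; field; rewrite gt_eqF.
have [g [cg [ig leg]]] : exists g, continuous g /\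
    (rint ((fun x => `|f x - g x|) \_ J) /\ \int[mu]_x ((fun x => `|f x - g x|) \_ J) x <= e1).
  have muJ : (mu J < +oo)%E by rewrite lebesgue_measure_itv/=; case: ifP => _; rewrite ?ltry.
  have [G [cG iG lG]] := approximation_continuous_integrable mJ muJ (fi _ _).
  have iD k : mu.-integrable J (EFin \o (fun x => `|f x - G k x|)).
    have h : mu.-integrable J ((EFin \o f) \- (EFin \o G k))%E.
      by apply: integrableB => //; exact: fi.
    exact: (integrable_abse h).
  have EI k : (\int[mu]_(z in J) `|(f z - G k z)%:E|)%E =
      (\int[mu]_x ((fun x => `|f x - G k x|) \_ J) x)%:E.
    rewrite -Rintegral_mkcond /Rintegral fineK//; exact: integrable_fin_num (iD k).
  move: lG; rewrite (funext EI) => /fine_cvg/= /cvgr0_norm_le /(_ _ e10) [k _ /(_ k (leqnn k)) h].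
  exists (G k); split; [exact: cG|split].
    exact: rint_restrict (iD k).
  exact: le_trans (ler_norm _) h.
have [Mg [Mg0 hMg]] := continuous_itv_bound (- (n + 1)) (n + 1) cg.
pose G k y := if `|tau k| <= 1 then (g (y + tau k) - g y) * w y else 0.
pose B y := 2 * Mg * (N * \1_(`[- n, n]) y).
have iB : rint B by do 2 apply: rintZ; exact: rint_indic_itv.
have mg : measurable_fun [set: R] g by exact: continuous_measurable_fun.
have mgt t : measurable_fun [set: R] (fun y => g (y + t)).
  by apply: measurableT_comp => //; exact: measurable_funD.
have mG k : measurable_fun [set: R] (G k).
  rewrite /G; case: (`|tau k| <= 1) => //.
  by apply: measurable_funM => //; exact: measurable_funB.
have inJ y t : - n <= y <= n -> `|t| <= 1 -> - (n + 1) <= y + t <= n + 1.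
  by move=> /andP[h1 h2]; rewrite ler_norml => /andP[h3 h4]; apply/andP; split; lra.
have w_out y : ~~ (- n <= y <= n) -> w y = 0.
  move=> /negbTE h; apply/normr0_eq0/eqP; rewrite eq_le normr_ge0 andbT.
  by have := wN y; rewrite indic_itvE h mulr0.
have GB k y : `|G k y| <= B y.
  have B0 : 0 <= B y by rewrite /B mulr_ge0// mulr_ge0.
  rewrite /G; case: ifP => [tk|_]; last by rewrite normr0.
  have [yn|yn] := boolP (- n <= y <= n); last by rewrite w_out// mulr0 normr0.
  rewrite normrM; apply: ler_pM => //.
  apply: (le_trans (ler_normB _ _)); rewrite mulr_natl mulr2n; apply: lerD.
    by apply: hMg; exact: inJ.
  by have := inJ y 0 yn; rewrite normr0 addr0 => /(_ ler01) /hMg.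
have [_ GI] : rint (fun=> 0 : R) /\ (\int[mu]_y G k y @[k --> \oo] --> \int[mu]_y (0 : R)).
  apply: (RI_dct mG _ iB GB) => y.
  have c : (g (y + tau k) - g y) * w y @[k --> \oo] --> (0 : R).
    rewrite -(mul0r (w y)); apply: cvgMr_tmp; rewrite -(subrr (g y)); apply: cvgB; last exact: cvg_cst.
    have cy : (fun k => y + tau k) @ \oo --> y + 0 by apply: cvgD; [exact: cvg_cst|exact: tau0].
    by rewrite addr0 in cy; exact: (cvg_comp _ g cy (cg y)).
  have c2 := cvg_norm c; rewrite normr0 in c2; apply: (@cvg0_le _ (fun k => G k y) _ _ (c2 _)) => k.
  by rewrite /G; case: ifP => _ //=; rewrite normr0.
move: GI; rewrite RI0 => /cvgr0_norm_le /(_ _ e10) near1.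
move/cvgr0_norm_le : (tau0) => /(_ _ ltr01) near2.
near=> k.
have tk : `|tau k| <= 1 by near: k.
have Gk : `|\int[mu]_y G k y| <= e1 by near: k.
set D := (fun x => `|f x - g x|) \_ J in ig leg.
have [iDs eDs] := RI_shift (tau k) ig.
have iG : rint (G k) by apply: rint_le (mG k) (GB k) iB.
(* the error made when f is replaced by g *)
pose r y := f y * w y - f (y + tau k) * w y + G k y.
have ir : rint r by apply: rintD => //; exact: rintB.
have rD y : `|r y| <= `|N| * D (y + tau k) + `|N| * D y.
  have D0 z : 0 <= D z by rewrite /D patchE; case: ifP.
  rewrite /r /G tk.
  have [yn|yn] := boolP (- n <= y <= n); last first.
    by rewrite w_out// !mulr0 subrr addr0 normr0 addr_ge0// mulr_ge0.
  have -> : f y * w y - f (y + tau k) * w y + (g (y + tau k) - g y) * w y =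
     w y * (- (f (y + tau k) - g (y + tau k)) + (f y - g y)) by ring.
  rewrite normrM -mulrDr; apply: ler_pM => //.
    apply: (le_trans (wN y)); rewrite indic_itvE yn mulr1; exact: ler_norm.
  apply: (le_trans (ler_normD _ _)); rewrite normrN; apply: lerD.
    by rewrite /D patchE mem_set// /J/= in_itv/=; exact: inJ.
  rewrite /D patchE mem_set// /J/= in_itv/=.
  by have := inJ y 0 yn; rewrite normr0 addr0 => /(_ ler01).
have -> : \int[mu]_y (f y * w y) - \int[mu]_y (f (y + tau k) * w y) =
    \int[mu]_y r y - \int[mu]_y G k y.
  by rewrite /r (RID (rintB i0 (ik k)) iG) (RIB i0 (ik k)) addrK.
apply: (le_trans (ler_normB _ _)); apply: le_trans e1e; apply: lerD => //.
apply: (le_trans (RI_abs_le ir _ rD)); first by apply: rintD; exact: rintZ.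
rewrite (RID (rintZ `|N| iDs) (rintZ `|N| ig)) (RIZ _ iDs) (RIZ _ ig) eDs.
by apply: lerD; apply: ler_wpM2l.
Unshelve. all: by end_near. Qed.

End ApproxIdentity.

Section ApproxIdentity2.
Context {R : realType}.
Notation mu := (@lebesgue_measure R).
Implicit Types f g w q : R -> R.

Lemma rint_indicM (a b c : R) q : rint q ->
  rint (fun x => (c + q x) * \1_(`[a, b]) x).
Proof.
move=> qi; have i1 := rintZ c (rint_indic_itv a b).
have i2 : rint (fun x => \1_(`[a, b]) x * q x).
  apply: (@rintM_bdd _ _ _ 1) => //.
  by move=> x; rewrite indic_itvE; case: ifP => _; rewrite ?normr1 ?normr0.
by apply: rint_eq (rintD i1 i2) => x; rewrite mulrDl [q x * _]mulrC.
Qed.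

Variables (f q : R -> R) (c : R).
Hypotheses (mf : measurable_fun [set: R] f) (qi : rint q).
Hypothesis fq : forall x, `|f x| <= c + q x.

Let integrable_f (a b : R) : mu.-integrable `[a, b] (EFin \o f).
Proof.
have h : rint (fun x => f x * \1_(`[a, b]) x).
  apply: (rint_le _ _ (rint_indicM a b c qi)).
    by apply: measurable_funM => //; exact: (rint_meas (rint_indic_itv a b)).
  move=> x; rewrite normrM indic_itvE; case: ifP => _; rewrite ?normr1 ?normr0 ?mulr1 ?mulr0//.
have h2 : mu.-integrable `[a, b] (EFin \o (fun x => f x * \1_(`[a, b]) x)).
  exact: integrableS h.
apply: eq_integrable h2 => // x; rewrite inE/= in_itv/= => xab.
by rewrite indic_itvE xab mulr1.
Qed.

Lemma rint_tame_gker (s y : R) : 0 < s -> rint (fun x => f x * gker s (x - y)).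
Proof.
move=> s0; have iK : rint (fun x => gker s (x - y)) by case: (RI_shift (- y) (rint_gker s0)).
have mK := rint_meas iK.
apply: (@rint_le _ _ (fun x => c * gker s (x - y) + gker s (x - y) * q x)).
- exact: measurable_funM.
- move=> x; rewrite normrM (ger0_norm (gker_ge0 _ s0)) [_ * q x]mulrC -mulrDl.
  by apply: ler_wpM2r; [exact: gker_ge0|].
- apply: rintD; first exact: rintZ.
  apply: (@rintM_bdd _ _ _ (Num.sqrt (2 * pi) / s)) => //.
  by move=> x; rewrite (ger0_norm (gker_ge0 _ s0)); exact: gker_le.
Qed.

Variables (w : R -> R) (N n : R).
Hypotheses (mw : measurable_fun [set: R] w).
Hypothesis wN : forall x, `|w x| <= N * \1_(`[- n, n]) x.

Let dom t y := `|N| * ((c + q (y + t)) * \1_(`[- n, n]) y).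

Let rint_dom t : rint (dom t).
Proof. by apply: rintZ; apply: (@rint_indicM _ _ c (fun y => q (y + t))); case: (RI_shift t qi). Qed.

Let dom_ub t y : `|f (y + t) * w y| <= dom t y.
Proof.
rewrite normrM mulrC /dom [X in _ <= _ * X]mulrC mulrA; apply: ler_pM => //.
apply: (le_trans (wN y)); apply: ler_wpM2r; last exact: ler_norm.
by rewrite indic_itvE; case: ifP.
Qed.

Let rint_fw t : rint (fun y => f (y + t) * w y).
Proof.
apply: (rint_le _ (dom_ub t)) => //; apply: measurable_funM => //.
by apply: measurableT_comp => //; exact: measurable_funD.
Qed.

Let RI_fw_ub t : \int[mu]_y `|f (y + t) * w y| <=
  `|N| * (c * \int[mu]_y (\1_(`[- n, n]) : R -> R) y + \int[mu]_y `|q y|).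
Proof.
have [iq eq] := RI_shift t (rint_abs qi).
have i1 := rintZ c (rint_indic_itv (- n) n).
have i2 : rint (fun y => c * \1_(`[- n, n]) y + `|q (y + t)|) by exact: rintD.
rewrite -eq -(RIZ _ (rint_indic_itv _ _)) -(RID i1 iq) -(RIZ _ i2).
apply: RI_le; [exact: rint_abs|exact: rintZ|].
move=> y; apply: (le_trans (dom_ub t y)); apply: ler_wpM2l => //.
rewrite indic_itvE; case: ifP => _; rewrite ?mulr1 ?mulr0 ?add0r//.
by rewrite lerD2l ler_norm.
Qed.

(** The substitution x = s t + y moves the width of the Gaussian into a
    translation of f. *)
Let conv_scale (s y : R) : 0 < s ->
  rint (fun t => f (s * t + y) * gker 1 t) /\
  \int[mu]_x (f x * gker s (x - y)) = \int[mu]_t (f (s * t + y) * gker 1 t).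
Proof.
move=> s0; have [i e] := RI_affine y s0 (rint_tame_gker y s0).
have E t : s * (f (s * t + y) * gker s (s * t + y - y)) = f (s * t + y) * gker 1 t.
  have sn : s != 0 by rewrite gt_eqF.
  rewrite mulrCA; congr (_ * _); rewrite addrK /gker /gexp !subr0 mulKf//.
  by rewrite invr1 mulr1 mul1r mulrA mulrCA divff// mulr1.
split; first exact: rint_eq E (rintZ s i).
by rewrite e -(RIZ _ i); exact: RI_eq.
Qed.

Let conv_fubini (s : R) : 0 < s ->
  rint (fun y => \int[mu]_x (f x * gker s (x - y)) * w y) /\
  [/\ rint (fun t => gker 1 t * \int[mu]_y (f (y + s * t) * w y)) &
  \int[mu]_y (\int[mu]_x (f x * gker s (x - y)) * w y) =
  \int[mu]_t (gker 1 t * \int[mu]_y (f (y + s * t) * w y))].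
Proof.
move=> s0.
pose F t y := gker 1 t * (f (y + s * t) * w y).
set B := `|N| * (c * \int[mu]_y (\1_(`[- n, n]) : R -> R) y + \int[mu]_y `|q y|).
have g1 t : 0 <= gker (1 : R) t by exact: gker_ge0.
have E1 t : \int[mu]_y F t y = gker 1 t * \int[mu]_y (f (y + s * t) * w y).
  exact: RIZ (rint_fw _).
have E2 y t : F t y = w y * (f (s * t + y) * gker 1 t).
  by rewrite /F [s * t + y]addrC; ring.
have E3 y : \int[mu]_t F t y = \int[mu]_x (f x * gker s (x - y)) * w y.
  by rewrite (RI_eq (E2 y)) (RIZ _ (conv_scale y s0).1) (conv_scale y s0).2 mulrC.
have [] := @RI_fubini _ F (fun t => gker 1 t * B).
- apply: measurable_funM; first exact: (measurableT_comp (measurable_gker 1) measurable_fst).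
  apply: measurable_funM; last exact: (measurableT_comp mw measurable_snd).
  apply: measurableT_comp => //; apply: measurable_funD; first exact: measurable_snd.
  by apply: measurable_funM => //; exact: measurable_fst.
- by move=> t; exact: rintZ.
- by move=> y; exact: rint_eq (fun t => esym (E2 y t)) (rintZ (w y) (conv_scale y s0).1).
- move=> t; have E4 y : `|F t y| = gker 1 t * `|f (y + s * t) * w y|.
    by rewrite normrM ger0_norm.
  rewrite (RI_eq E4) (RIZ _ (rint_abs (rint_fw _))); apply: ler_wpM2l => //.
- by apply: rint_eq (rintZ B (rint_gker ltr01)) => t; rewrite mulrC.
by rewrite (funext E1) (funext E3) => h1 h2 h3; split.
Qed.

Lemma rint_gker_conv (s : R) : 0 < s ->
  rint (fun y => \int[mu]_x (f x * gker s (x - y)) * w y).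
Proof. by move=> /conv_fubini[]. Qed.

(** After the substitution x = y + s t and Fubini's theorem, this is continuity of
    translations, integrated against a fixed Gaussian of integral 2 pi. *)
Lemma gker_approx :
  \int[mu]_y (\int[mu]_x (f x * gker k.+1%:R^-1 (x - y)) * w y) @[k --> \oo] -->
  2 * pi * \int[mu]_y (f y * w y).
Proof.
have s0 k : (0 : R) < k.+1%:R^-1 by rewrite invr_gt0.
have E k : \int[mu]_y (\int[mu]_x (f x * gker k.+1%:R^-1 (x - y)) * w y) =
    \int[mu]_t (gker 1 t * \int[mu]_y (f (y + k.+1%:R^-1 * t) * w y)).
  by have [_ [_ ->]] := conv_fubini (s0 k).
rewrite (funext E).
set B := `|N| * (c * \int[mu]_y (\1_(`[- n, n]) : R -> R) y + \int[mu]_y `|q y|).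
have i0 : rint (fun y => f y * w y) by apply: rint_eq (rint_fw 0) => y; rewrite addr0.
have -> : 2 * pi * \int[mu]_y (f y * w y) = \int[mu]_t (gker 1 t * \int[mu]_y (f y * w y)).
  rewrite -(RI_gker (@ltr01 R)) mulrC -(RIZ _ (rint_gker ltr01)).
  by apply: RI_eq => t; rewrite mulrC.
have [] := @RI_dct _ (fun k t => gker 1 t * \int[mu]_y (f (y + k.+1%:R^-1 * t) * w y))
  (fun t => gker 1 t * \int[mu]_y (f y * w y)) (fun t => gker 1 t * B).
- by move=> k; have [_ [h _]] := conv_fubini (s0 k); exact: rint_meas.
- move=> t; apply: cvgMl_tmp.
  apply: (cvg_translate integrable_f mf mw wN) => //.
  rewrite -(mul0r t); apply: cvgMr_tmp; exact: cvg_harmonic.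
- by apply: rint_eq (rintZ B (rint_gker ltr01)) => t; rewrite mulrC.
- move=> k t; rewrite normrM (ger0_norm (gker_ge0 _ ltr01)); apply: ler_wpM2l.
    exact: gker_ge0.
  by apply: (le_trans (RI_abs (rint_fw _))); exact: RI_fw_ub.
by [].
Qed.

End ApproxIdentity2.

(** * Plancherel's theorem *)

Section Plancherel.
Context {R : realType}.
Notation mu := (@lebesgue_measure R).
Notation C := R[i].
Notation ReC := (@complex.Re R).
Notation ImC := (@complex.Im R).
Implicit Types f g w G W : R -> C.

Lemma L2P f : L2 f <-> cmeas f /\ rint (fun x => normc (f x) ^+ 2).
Proof.
split=> -[mf i]; split => //.
  by apply: rint_ge0P => [|x|//]; [exact: measurable_normc2|exact: sqr_ge0].
exact: integrable_lty i.
Qed.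

Lemma L2_cmeas f : L2 f -> cmeas f.
Proof. by case. Qed.

Lemma L2_rint f : L2 f -> rint (fun x => normc (f x) ^+ 2).
Proof. by move=> /L2P[]. Qed.

Lemma L2_le f (g : R -> R) : cmeas f -> (forall x, normc (f x) ^+ 2 <= g x) -> rint g -> L2 f.
Proof.
move=> mf fg gi; apply/L2P; split => //; apply: (rint_le _ _ gi).
  exact: measurable_normc2.
by move=> x; rewrite ger0_norm ?sqr_ge0.
Qed.

Lemma L2D f g : L2 f -> L2 g -> L2 (fun x => f x + g x).
Proof.
move=> lf lg; apply: (@L2_le _ (fun x => 2 * normc (f x) ^+ 2 + 2 * normc (g x) ^+ 2)).
- exact: cmeasD (L2_cmeas lf) (L2_cmeas lg).
- by move=> x; exact: sqr_normcD_le.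
- by apply: rintD; apply: rintZ; exact: L2_rint.
Qed.

Lemma L2M_bdd (f g : R -> C) (M : R) : cmeas g -> (forall x, normc (g x) <= M) -> L2 f ->
  L2 (fun x => g x * f x).
Proof.
move=> mg gM lf; apply: (@L2_le _ (fun x => M ^+ 2 * normc (f x) ^+ 2)).
- exact: cmeasM mg (L2_cmeas lf).
- move=> x; rewrite Normc.normcM exprMn; apply: ler_wpM2r; first exact: sqr_ge0.
  rewrite lerXn2r// nnegrE; first exact: normc_ge0.
  exact: le_trans (normc_ge0 _) (gM x).
- exact: rintZ (L2_rint lf).
Qed.

Lemma L2Z z f : L2 f -> L2 (fun x => z * f x).
Proof. by apply: (@L2M_bdd _ (fun=> z) (normc z)) => //; exact: cmeas_cst. Qed.

Lemma L2J f : L2 f -> L2 (fun x => conjc (f x)).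
Proof.
move=> lf; apply: (L2_le _ _ (L2_rint lf)); first exact: cmeasJ (L2_cmeas lf).
by move=> x; rewrite normc_conjc.
Qed.

Lemma measurable_opp : measurable_fun [set: R] (-%R : R -> R).
Proof. exact: oppr_measurable. Qed.

Lemma measurable_addr (t : R) : measurable_fun [set: R] (fun x : R => x + t).
Proof. exact: measurable_funD. Qed.

Lemma L2_opp f : L2 f -> L2 (fun x => f (- x)).
Proof.
move=> lf; apply/L2P; split; first exact: (cmeas_comp (L2_cmeas lf) measurable_opp).
by case: (RI_opp (L2_rint lf)).
Qed.

Lemma L2_shift f (t : R) : L2 f -> L2 (fun x => f (x + t)).
Proof.
move=> lf; apply/L2P; split; first exact: (cmeas_comp (L2_cmeas lf) (measurable_addr t)).
by case: (RI_shift t (L2_rint lf)).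
Qed.

Lemma L2M_cint f g : L2 f -> L2 g -> cintegrable (fun x => f x * g x).
Proof.
move=> lf lg; apply: (@cint_le _ _ (fun x => normc (f x) ^+ 2 + normc (g x) ^+ 2)).
- exact: cmeasM (L2_cmeas lf) (L2_cmeas lg).
- by move=> x; rewrite Normc.normcM; exact: normcM_le.
- exact: rintD (L2_rint lf) (L2_rint lg).
Qed.

(** A class that contains the bounded, the integrable and the L^2 functions, and
    whose members can be integrated against Gaussians. *)
Definition tame f : Prop := cmeas f /\
  exists c q, [/\ 0 <= c, rint q & forall x, normc (f x) <= c + q x].

Lemma L2_tame f : L2 f -> tame f.
Proof.
move=> lf; split; first exact: L2_cmeas.
exists 1, (fun x => normc (f x) ^+ 2); split => //; first exact: L2_rint.
by move=> x; have := sqr_ge0 (normc (f x) - 1); have := normc_ge0 (f x); nra.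
Qed.

Lemma cint_tame f : cintegrable f -> tame f.
Proof.
move=> fi; split; first exact: cint_cmeas.
exists 0, (fun x => normc (f x)); split => //; first exact: cint_normc.
by move=> x; rewrite add0r.
Qed.

Lemma bounded_tame f (M : R) : cmeas f -> (forall x, normc (f x) <= M) -> tame f.
Proof.
move=> mf fM; split => //; exists M, (fun=> 0); split; last 2 first.
- exact: rint0.
- by move=> x; rewrite addr0.
- exact: le_trans (normc_ge0 _) (fM 0).
Qed.

Lemma tameB f g : tame f -> tame g -> tame (fun x => f x - g x).
Proof.
move=> [mf [c [q [c0 qi fq]]]] [mg [d [r [d0 ri gr]]]]; split; first exact: cmeasB.
exists (c + d), (fun x => q x + r x); split; first exact: addr_ge0.
  exact: rintD.
by move=> x; apply: (le_trans (normcBD _ _)); rewrite addrACA; exact: lerD.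
Qed.

Lemma tame_shift f (t : R) : tame f -> tame (fun x => f (x + t)).
Proof.
move=> [mf [c [q [c0 qi fq]]]]; split; first exact: (cmeas_comp mf (measurable_addr t)).
exists c, (fun x => q (x + t)); split => //; by case: (RI_shift t qi).
Qed.

Lemma tame_mul f g (M : R) : tame f -> cintegrable g -> (forall x, normc (g x) <= M) ->
  cintegrable (fun x => f x * g x).
Proof.
move=> [mf [c [q [c0 qi fq]]]] gi gM.
apply: (@cint_le _ _ (fun x => c * normc (g x) + normc (g x) * q x)).
- by apply: cmeasM => //; exact: cint_cmeas.
- move=> x; rewrite Normc.normcM [_ * q x]mulrC -mulrDl; apply: ler_wpM2r; first exact: normc_ge0.
  exact: fq.
- apply: rintD; first by apply: rintZ; exact: cint_normc.
  apply: (@rintM_bdd _ _ _ M) => //; first by apply: measurable_normc; exact: cint_cmeas.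
  by move=> x; rewrite ger0_norm ?normc_ge0.
Qed.

Lemma normc_cgauss_le (s a b x : R) : normc (cgauss s a b x) <= 1.
Proof.
rewrite Normc.normcM normc_cis mulr1 normcR gtr0_norm; first exact: gexp_le1.
exact: gexp_gt0.
Qed.

Lemma tame_cgauss f (s a b : R) : 0 < s -> tame f ->
  cintegrable (fun x => f x * cgauss s a b x).
Proof.
move=> s0 tf; apply: tame_mul tf (cint_cgauss a b s0) _ => x; exact: normc_cgauss_le.
Qed.

Lemma cint_fourier_cgauss (s a b : R) : 0 < s -> cintegrable (fourier (cgauss s a b)).
Proof.
move=> s0; apply: (@cint_le _ _ (fun x => gker s (x - b))).
- exact: fourier_cmeas (cint_cgauss a b s0).
- move=> x; rewrite fourier_cgauss// Normc.normcM normc_cis mulr1 normcR ger0_norm//.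
  exact: gker_ge0.
- by case: (RI_shift (- b) (rint_gker s0)).
Qed.

Lemma tame_fourier_cgauss f (s a b : R) : 0 < s -> tame f ->
  cintegrable (fun x => f x * fourier (cgauss s a b) x).
Proof.
move=> s0 tf; apply: tame_mul tf (cint_fourier_cgauss a b s0) _ => x.
exact: fourier_le (cint_cgauss a b s0).
Qed.

(** G is the Fourier transform of f in the sense of duality, tested on modulated
    Gaussians only. *)
Definition fpair f G : Prop := forall s a b : R, 0 < s ->
  cintegral (fun x => f x * fourier (cgauss s a b) x) =
  cintegral (fun xi => G xi * cgauss s a b xi).

Lemma amgm_weighted (P a b a' b' : R) : 0 < P ->
  a * a' + b * b' <= (4 * P)^-1 * (a ^+ 2 + b ^+ 2) + P * (a' ^+ 2 + b' ^+ 2).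
Proof.
move=> P0; have Pn : P != 0 by rewrite gt_eqF.
rewrite -subr_ge0.
have -> : (4 * P)^-1 * (a ^+ 2 + b ^+ 2) + P * (a' ^+ 2 + b' ^+ 2) - (a * a' + b * b') =
  (4 * P)^-1 * ((a - 2 * P * a') ^+ 2 + (b - 2 * P * b') ^+ 2) by field.
by rewrite mulr_ge0 ?addr_ge0 ?sqr_ge0// invr_ge0 mulr_ge0// ltW.
Qed.

Let quarter_half (P b : R) : 0 < P -> (4 * P)^-1 * (2 * P * b) = b / 2.
Proof. by move=> P0; field; rewrite gt_eqF. Qed.

Lemma cvg_le_cst (u : nat -> R) (l B : R) :
  u n @[n --> \oo] --> l -> (forall n, u n <= B) -> l <= B.
Proof.
move=> ul uB; rewrite -(cvg_lim _ ul)//; apply: limr_le; first exact: (cvgP _ ul).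
exact: nearW.
Qed.

Let trunc f (n : nat) x : R := if (`|x| <= n%:R) && (normc (f x) <= n%:R) then 1 else 0.

Let measurable_trunc f n : cmeas f -> measurable_fun [set: R] (trunc f n).
Proof.
move=> mf; apply: measurable_fun_ifT => //.
apply: measurable_and; apply: measurable_fun_ler => //.
exact: measurable_normc.
Qed.

Let trunc_cvg f x : trunc f n x @[n --> \oo] --> (1 : R).
Proof.
apply: cvg_near_cst.
exists (Num.bound `|x| + Num.bound (normc (f x)))%N => // n /= hn.
have h (y : R) : 0 <= y -> (Num.bound y <= n)%N -> y <= n%:R.
  by move=> y0 yn; apply/ltW/(lt_le_trans (archi_boundP y0)); rewrite ler_nat.
rewrite /trunc !h ?normc_ge0//.
  exact: leq_trans (leq_addl _ _) hn.
exact: leq_trans (leq_addr _ _) hn.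
Qed.

(** Tested on Gaussians, the hypothesis says that the convolution of f
    with gker s is the Fourier transform of G times a Gaussian (up to a
    reflection); Bessel's inequality bounds it in L^2. As s tends to 0, its scalar
    product with a truncation of f tends to 2 pi times the integral of |f|^2 over
    the truncation, which is thereby bounded. *)
Lemma fpair_le f G : tame f -> L2 G -> fpair f G ->
  L2 f /\ 2 * pi * \int[mu]_x (normc (f x) ^+ 2) <= \int[mu]_xi (normc (G xi) ^+ 2).
Proof.
move=> tf lG fG; have [mf [c [q [c0 qi fq]]]] := tf.
set B := \int[mu]_xi (normc (G xi) ^+ 2).
have p0 : (0 : R) < pi by exact: pi_gt0.
have pp : (0 : R) <= 2 * pi by rewrite mulr_ge0// ltW.
have s0 k : (0 : R) < k.+1%:R^-1 by rewrite invr_gt0.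
have [mRe mIm] := mf.
have ReQ x : `|ReC (f x)| <= c + q x := le_trans (normc_Re _) (fq x).
have ImQ x : `|ImC (f x)| <= c + q x := le_trans (normc_Im _) (fq x).
pose fk (k : nat) y := cintegral (fun x => f x * fourier (cgauss k.+1%:R^-1 0 y) x).
have Refk k y : ReC (fk k y) = \int[mu]_x (ReC (f x) * gker k.+1%:R^-1 (x - y)).
  apply: RI_eq => x; rewrite ReM fourier_cgauss_centered//=.
  by rewrite mulr0 subr0.
have Imfk k y : ImC (fk k y) = \int[mu]_x (ImC (f x) * gker k.+1%:R^-1 (x - y)).
  apply: RI_eq => x; rewrite ImM fourier_cgauss_centered//=.
  by rewrite mulr0 add0r.
have fkB k : rint (fun y => normc (fk k y) ^+ 2) /\
    \int[mu]_y (normc (fk k y) ^+ 2) <= 2 * pi * B.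
  pose Gk xi := G xi * (gexp k.+1%:R^-1 0 xi)%:C.
  have iGk : cintegrable Gk.
    have := tame_cgauss 0 0 (s0 k) (L2_tame lG); apply: cint_eq => x.
    by rewrite /Gk /cgauss mul0r cis0 mulr1.
  have N2le xi : normc (Gk xi) ^+ 2 <= normc (G xi) ^+ 2.
    rewrite lerXn2r ?nnegrE ?normc_ge0// Normc.normcM normcR (gtr0_norm (gexp_gt0 _ _ _)).
    by rewrite ler_piMr ?normc_ge0// gexp_le1.
  have lGk : L2 Gk := L2_le (cint_cmeas iGk) N2le (L2_rint lG).
  have [i1 e1] := bessel iGk (L2_rint lGk).
  have E y : fk k y = fourier Gk (- y).
    rewrite /fk fG//; apply: CI_eq => xi; rewrite /Gk /cgauss mulrA.
    by rewrite mulrN opprK [y * xi]mulrC.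
  have [i2 e2] := RI_opp i1.
  split; first by apply: rint_eq i2 => y; rewrite E.
  under RI_eq do rewrite E; rewrite e2; apply: (le_trans e1).
  exact: (ler_wpM2l pp (RI_le (L2_rint lGk) (L2_rint lG) N2le)).
pose p n x := normc (f x) ^+ 2 * trunc f n x.
have t01 n x : trunc f n x = 0 \/ trunc f n x = 1 by rewrite /trunc; case: ifP; [right|left].
have tr1 n (z : R) x : `|z| <= normc (f x) -> `|z * trunc f n x| <= n%:R * \1_(`[- n%:R, n%:R]) x.
  move=> zf; rewrite /trunc indic_itvE -ler_norml; case: ifP => [/andP[-> h]|_].
    by rewrite !mulr1; exact: le_trans h.
  by rewrite mulr0 normr0; case: ifP => _; rewrite ?mulr1 ?mulr0.
have pB n : rint (p n) /\ \int[mu]_x p n x <= B / (2 * pi).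
  pose w x := ReC (f x) * trunc f n x; pose v x := ImC (f x) * trunc f n x.
  have mt := measurable_trunc n mf.
  have mw : measurable_fun [set: R] w by exact: measurable_funM.
  have mv : measurable_fun [set: R] v by exact: measurable_funM.
  have wN x : `|w x| <= n%:R * \1_(`[- n%:R, n%:R]) x := tr1 n _ x (normc_Re (f x)).
  have vN x : `|v x| <= n%:R * \1_(`[- n%:R, n%:R]) x := tr1 n _ x (normc_Im (f x)).
  have cw := gker_approx mRe qi ReQ mw wN.
  have cv := gker_approx mIm qi ImQ mv vN.
  have iw k := rint_gker_conv mRe qi ReQ mw wN (s0 k).
  have iv k := rint_gker_conv mIm qi ImQ mv vN (s0 k).
  have prodE (z : R) : z * (z * 1) = z ^+ 2 by rewrite mulr1 expr2.
  have pE x : p n x = w x ^+ 2 + v x ^+ 2.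
    rewrite /p /w /v sqr_normcE; case: (t01 n x) => ->; ring.
  have pE2 x : p n x = ReC (f x) * w x + ImC (f x) * v x.
    rewrite /p /w /v sqr_normcE; ring.
  have i1 := rintZ n%:R (rint_indic_itv (- n%:R) n%:R : rint (\1_(`[- n%:R, n%:R]) : R -> R)).
  have ibd (h z : R -> R) : measurable_fun [set: R] h -> measurable_fun [set: R] z ->
      (forall x, `|h x| <= normc (f x)) -> (forall x, `|z x| <= normc (f x)) ->
      rint (fun x => h x * (z x * trunc f n x)).
    move=> mh mz hf zf; apply: (@rint_le _ _ (fun x => n%:R * (n%:R * \1_(`[- n%:R, n%:R]) x))).
    - by apply: measurable_funM => //; exact: measurable_funM.
    - move=> x; have -> : h x * (z x * trunc f n x) = (h x * trunc f n x) * (z x * trunc f n x).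
        by case: (t01 n x) => ->; ring.
      rewrite normrM; apply: ler_pM => //; last exact: tr1.
      apply: (le_trans (tr1 n _ x (hf x))); rewrite indic_itvE; case: ifP => _; rewrite ?mulr1// mulr0//.
    - exact: rintZ.
  have iRw : rint (fun x => ReC (f x) * w x).
    by apply: ibd => // x; exact: normc_Re.
  have iIv : rint (fun x => ImC (f x) * v x).
    by apply: ibd => // x; exact: normc_Im.
  have ip : rint (p n) by apply: rint_eq (fun x => esym (pE2 x)) (rintD iRw iIv).
  split => //.
  have lim_le k : \int[mu]_y (\int[mu]_x (ReC (f x) * gker k.+1%:R^-1 (x - y)) * w y) +
      \int[mu]_y (\int[mu]_x (ImC (f x) * gker k.+1%:R^-1 (x - y)) * v y) <=
      B / 2 + pi * \int[mu]_x p n x.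
    have [i2 e2] := fkB k.
    rewrite -(RID (iw k) (iv k)).
    apply: (@le_trans _ _ (\int[mu]_y ((4 * pi)^-1 * normc (fk k y) ^+ 2 + pi * p n y))).
      apply: RI_le; [exact: rintD|exact: rintD (rintZ _ i2) (rintZ _ ip)|].
      move=> y; rewrite -Refk -Imfk sqr_normcE pE.
      (* the weight pi leaves half of the limit 2 pi int p on the left *)
      exact: amgm_weighted.
    rewrite (RID (rintZ _ i2) (rintZ _ ip)) (RIZ _ i2) (RIZ _ ip) lerD2r.
    apply: (@le_trans _ _ ((4 * pi)^-1 * (2 * pi * B))).
      by apply: ler_wpM2l => //; rewrite invr_ge0 mulr_ge0// ltW.
    by rewrite le_eqVlt quarter_half// eqxx.
  have : 2 * pi * \int[mu]_y (ReC (f y) * w y) + 2 * pi * \int[mu]_y (ImC (f y) * v y) <=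
      B / 2 + pi * \int[mu]_x p n x.
    exact: cvg_le_cst (cvgD cw cv) lim_le.
  rewrite -mulrDr -(RID iRw iIv) -(RI_eq pE2) ler_pdivlMr ?mulr_gt0//.
  by move: (\int[mu]_x p n x) (B) => P b; nra.
have [i e] : rint (fun x => normc (f x) ^+ 2) /\
    \int[mu]_x (normc (f x) ^+ 2) <= B / (2 * pi).
  apply: (@RI_fatou _ p).
  - move=> n; apply: measurable_funM; [exact: measurable_normc2|exact: measurable_trunc].
  - move=> n x; rewrite /p; case: (t01 n x) => ->; rewrite ?mulr0// mulr1; exact: sqr_ge0.
  - move=> x; rewrite -[X in _ --> X]mulr1; apply: cvgMl_tmp; exact: trunc_cvg.
  - by move=> n; have [i e] := pB n; rewrite -RI_E// lee_fin.
split; first by apply/L2P.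
by move: e; rewrite ler_pdivlMr ?mulr_gt0// mulrC.
Qed.

End Plancherel.

(** * Parseval's identity and increments *)

Section Parseval.
Context {R : realType}.
Notation mu := (@lebesgue_measure R).
Notation C := R[i].
Notation ReC := (@complex.Re R).
Notation ImC := (@complex.Im R).
Implicit Types f g w G W : R -> C.

Let sqrt2pi : Num.sqrt (2 * pi) * Num.sqrt (2 * pi) = 2 * pi :> R.
Proof. by rewrite -expr2 sqr_sqrtr// mulr_ge0// pi_ge0. Qed.

(** A multiple of another modulated Gaussian: the Fourier transform stays in the family. *)
Let fourier_cgaussE (s a b x : R) : 0 < s ->
  fourier (cgauss s a b) x =
  (Num.sqrt (2 * pi) / s)%:C * cis (a * b) * cgauss s^-1 b (- a) x.
Proof.
move=> s0; rewrite fourier_cgauss// /gker /cgauss.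
have -> : a * (b - x) = a * b + - a * x by ring.
have -> : gexp s^-1 0 (x - b) = gexp s^-1 b x by rewrite /gexp subr0.
rewrite cisD rmorphM/=; move: (_%:C) (gexp _ _ _)%:C (cis _) (cis _) => p q r t.
by rewrite mulrACA.
Qed.

(** Fourier inversion: it holds on Gaussians, by the explicit formula, and is
    carried over to f and G by duality. *)
Lemma fpair_dual f G : tame f -> L2 G -> fpair f G ->
  fpair G (fun x => (2 * pi)%:C * f (- x)).
Proof.
move=> tf lG fG s a b s0; have si0 : 0 < s^-1 by rewrite invr_gt0.
set k := (Num.sqrt (2 * pi) / s)%:C * cis (a * b).
have E1 x : G x * fourier (cgauss s a b) x = k * (G x * cgauss s^-1 b (- a) x).
  by rewrite fourier_cgaussE// mulrCA.
rewrite (CI_eq E1) CIZ; last exact: tame_cgauss (L2_tame lG).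
rewrite -fG// -CIZ; last exact: tame_fourier_cgauss.
have i1 := cintZ k (tame_fourier_cgauss b (- a) si0 tf).
have [_ <-] := CI_opp i1; apply: CI_eq => x.
suff key : k * fourier (cgauss s^-1 b (- a)) (- x) = (2 * pi)%:C * cgauss s a b x.
  by rewrite mulrCA key mulrCA mulrA.
rewrite fourier_cgaussE// /k !invrK.
have -> : cgauss s (- a) (- b) (- x) = cgauss s a b x.
  rewrite /cgauss /gexp; congr ((expR (- (_ / 2)))%:C * cis _); last by ring.
  by rewrite -opprD mulrN sqrrN.
rewrite mulrA; congr (_ * _).
rewrite mulrN [b * a]mulrC mulrACA -cisD subrr cis0 mulr1 -rmorphM/=; congr (_%:C).
rewrite mulrACA mulVf ?mulr1 ?sqrt2pi//; by rewrite gt_eqF.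
Qed.

(** Apply the inequality [fpair_le] to f, and to G whose transform is
    2 pi f(- x). *)
Lemma plancherel f G : tame f -> L2 G -> fpair f G ->
  L2 f /\ \int[mu]_xi (normc (G xi) ^+ 2) = 2 * pi * \int[mu]_x (normc (f x) ^+ 2).
Proof.
move=> tf lG fG; have [lf le1] := fpair_le tf lG fG; split => //.
have pp : (0 : R) < 2 * pi by rewrite mulr_gt0// pi_gt0.
have lf' : L2 (fun x => (2 * pi)%:C * f (- x)) by apply: L2Z; exact: L2_opp.
have [_ le2] := fpair_le (L2_tame lG) lf' (fpair_dual tf lG fG).
apply/eqP; rewrite eq_le le1 andbT -(ler_pM2l pp); apply: (le_trans le2).
have E x : normc ((2 * pi)%:C * f (- x)) ^+ 2 = (2 * pi) ^+ 2 * normc (f (- x)) ^+ 2.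
  by rewrite Normc.normcM normcR exprMn (gtr0_norm pp).
have [i e] := RI_opp (L2_rint lf).
by rewrite (RI_eq E) (RIZ _ i) e expr2 -[leLHS]mulrA.
Qed.

Lemma fpairD f g G W : L2 f -> L2 g -> L2 G -> L2 W -> fpair f G -> fpair g W ->
  fpair (fun x => f x + g x) (fun x => G x + W x).
Proof.
move=> lf lg lG lW fG gW s a b s0.
under CI_eq do rewrite mulrDl.
under [RHS]CI_eq do rewrite mulrDl.
rewrite !CID ?fG ?gW//.
- exact: tame_cgauss (L2_tame lG).
- exact: tame_cgauss (L2_tame lW).
- exact: tame_fourier_cgauss (L2_tame lf).
- exact: tame_fourier_cgauss (L2_tame lg).
Qed.

Lemma fpairZ z f G : L2 f -> L2 G -> fpair f G ->
  fpair (fun x => z * f x) (fun x => z * G x).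
Proof.
move=> lf lG fG s a b s0.
under CI_eq do rewrite -mulrA.
under [RHS]CI_eq do rewrite -mulrA.
rewrite !CIZ ?fG//.
- exact: tame_cgauss (L2_tame lG).
- exact: tame_fourier_cgauss (L2_tame lf).
Qed.

Lemma conj_fourier_cgauss (s a b x : R) : 0 < s ->
  conjc (fourier (cgauss s a b) x) = fourier (cgauss s (- a) b) x.
Proof.
by move=> s0; rewrite !fourier_cgauss// conjcM -cisN mulNr /= oppr0.
Qed.

Lemma fpairJ f G : L2 f -> L2 G -> fpair f G ->
  fpair (fun x => conjc (f x)) (fun x => conjc (G (- x))).
Proof.
move=> lf lG fG s a b s0.
have E1 x : conjc (f x) * fourier (cgauss s a b) x =
    conjc (f x * fourier (cgauss s (- a) b) x).
  rewrite conjcM (conj_fourier_cgauss _ _ _ s0).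
  by rewrite (opprK a).
rewrite (CI_eq E1) CIJ; last exact: tame_fourier_cgauss (L2_tame lf).
have i1 := cintJ (tame_cgauss (- a) b s0 (L2_tame lG)).
rewrite fG// -CIJ; last exact: tame_cgauss (L2_tame lG).
have [_ <-] := CI_opp i1; apply: CI_eq => x; rewrite conjcM; congr (_ * _).
rewrite /cgauss conjcM -cisN mulrN opprK; congr (_ * _).
by rewrite /gexp /= oppr0 -opprD mulrN sqrrN.
Qed.

(** Polarization of Plancherel's theorem. *)
Let parseval_Re f g G W : L2 f -> L2 g -> L2 G -> L2 W -> fpair f G -> fpair g W ->
  2 * pi * \int[mu]_x ReC (f x * conjc (g x)) = \int[mu]_xi ReC (G xi * conjc (W xi)).
Proof.
move=> lf lg lG lW fG gW.
have aux h k : L2 h -> L2 k -> \int[mu]_x (normc (h x + k x) ^+ 2) =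
    \int[mu]_x (normc (h x) ^+ 2) + \int[mu]_x (normc (k x) ^+ 2) +
    2 * \int[mu]_x ReC (h x * conjc (k x)).
  move=> lh lk; have [i1 _] := L2M_cint lh (L2J lk).
  rewrite -(RIZ _ i1) -(RID (L2_rint lh) (L2_rint lk)).
  rewrite -(RID (rintD (L2_rint lh) (L2_rint lk)) (rintZ _ i1)).
  by apply: RI_eq => x; rewrite sqr_normcD.
have [_ p1] := plancherel (L2_tame lf) lG fG.
have [_ p2] := plancherel (L2_tame lg) lW gW.
have [_ p3] := plancherel (L2_tame (L2D lf lg)) (L2D lG lW) (fpairD lf lg lG lW fG gW).
move: p3; rewrite (aux _ _ lf lg) (aux _ _ lG lW) p1 p2 !mulrDr.
move=> /addrI /esym; rewrite mulrCA => h.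
by apply: (mulfI (_ : 2 != 0 :> R)) => //.
Qed.

(** The imaginary part is the real part for i f. *)
Lemma parseval f g G W : L2 f -> L2 g -> L2 G -> L2 W -> fpair f G -> fpair g W ->
  (2 * pi)%:C * cintegral (fun x => f x * conjc (g x)) =
  cintegral (fun xi => G xi * conjc (W xi)).
Proof.
move=> lf lg lG lW fG gW; apply: complexP.
  rewrite ReM/= mul0r subr0; exact: parseval_Re.
have := parseval_Re (L2Z (0 +i* 1) lf) lg (L2Z (0 +i* 1) lG) lW (fpairZ (0 +i* 1) lf lG fG) gW.
have E (z y : C) : ReC ((0 +i* 1) * z * conjc y) = - ImC (z * conjc y).
  by rewrite -mulrA ReM/=; ring.
under RI_eq do rewrite E; under [X in _ = X -> _]RI_eq do rewrite E.
have [_ i1] := L2M_cint lf (L2J lg); have [_ i2] := L2M_cint lG (L2J lW).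
rewrite (RIN i1) (RIN i2) mulrN => /oppr_inj h.
by rewrite ImM/= mul0r addr0.
Qed.

Lemma parseval_mul f v G h : L2 f -> L2 v -> L2 G -> L2 h -> fpair f G -> fpair v h ->
  (2 * pi)%:C * cintegral (fun x => f x * v x) = cintegral (fun xi => G xi * h (- xi)).
Proof.
move=> lf lv lG lh fG vh.
have := parseval lf (L2J lv) lG (L2J (L2_opp lh)) fG (fpairJ lv lh vh).
under CI_eq do rewrite conjcK.
by under [X in _ = X -> _]CI_eq do rewrite conjcK.
Qed.

Lemma fourier_cgauss_shift (s a b t x : R) : 0 < s ->
  fourier (cgauss s a (b + t)) x = fourier (cgauss s a b) (x - t).
Proof.
by move=> s0; rewrite !fourier_cgauss//; congr ((gker _ _)%:C * cis (_ * _)); ring.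
Qed.

Lemma cgauss_shift (s a b t x : R) : cgauss s a (b + t) x = cis (t * x) * cgauss s a b x.
Proof. by rewrite /cgauss mulrCA -cisD; congr (_ * cis _); ring. Qed.

Definition incr (t : R) f x : C := f (x + t) - f x.
(** The Fourier multiplier that corresponds to [incr t]. *)
Definition mincr (t : R) G xi : C := (cis (t * xi) - 1) * G xi.

Lemma tame_incr t f : tame f -> tame (incr t f).
Proof. by move=> tf; apply: tameB => //; exact: tame_shift. Qed.

Lemma CI_incr_gauss (s a b t : R) f : 0 < s -> tame f ->
  cintegral (fun x => incr t f x * fourier (cgauss s a b) x) =
  cintegral (fun x => f x * fourier (cgauss s a (b + t)) x) -
  cintegral (fun x => f x * fourier (cgauss s a b) x).
Proof.
move=> s0 tf.
have i2 := tame_fourier_cgauss a b s0 (tame_shift t tf).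
have i3 := tame_fourier_cgauss a b s0 tf.
have [_ e] := CI_shift (- t) i2.
have -> : cintegral (fun x => f x * fourier (cgauss s a (b + t)) x) =
    cintegral (fun x => f (x + t) * fourier (cgauss s a b) x).
  by rewrite -e; apply: CI_eq => x; rewrite (fourier_cgauss_shift _ _ _ _ s0) subrK.
rewrite -(CIB i2 i3).
by apply: CI_eq => x; rewrite /incr mulrBl.
Qed.

Lemma fpair_incr t f G : L2 f -> L2 G -> fpair f G -> fpair (incr t f) (mincr t G).
Proof.
move=> lf lG fG s a b s0.
have tG := L2_tame lG.
rewrite (CI_incr_gauss _ _ _ s0 (L2_tame lf)) !fG//.
rewrite -(CIB (tame_cgauss _ _ s0 tG) (tame_cgauss _ _ s0 tG)).
by apply: CI_eq => x; rewrite cgauss_shift /mincr; ring.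
Qed.

Lemma cmeas_incr t f : cmeas f -> cmeas (incr t f).
Proof. by move=> mf; apply: cmeasB => //; exact: (cmeas_comp mf (measurable_addr t)). Qed.

Lemma cmeas_cisM (t : R) : cmeas (fun x : R => cis (t * x)).
Proof. by apply: cmeas_cis; exact: measurable_funM. Qed.

Lemma cmeas_cisB1 (t : R) : cmeas (fun x : R => cis (t * x) - 1).
Proof. by apply: cmeasB; [exact: cmeas_cisM|exact: cmeas_cst]. Qed.

Lemma L2_incr t f : L2 f -> L2 (incr t f).
Proof.
move=> lf; have := L2D (L2_shift t lf) (L2Z (-1) lf).
by rewrite (_ : (fun x => _) = incr t f)//; apply/funext => x; rewrite mulN1r.
Qed.

Lemma normc_cisB1_le2 (x : R) : normc (cis x - 1) <= 2.
Proof. by apply: (le_trans (normcBD _ _)); rewrite normc_cis Normc.normc1. Qed.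

Lemma L2_mincr t G : L2 G -> L2 (mincr t G).
Proof.
move=> lG; apply: (@L2M_bdd _ _ (fun x => cis (t * x) - 1) 2) => //.
  exact: cmeas_cisB1.
by move=> x; exact: normc_cisB1_le2.
Qed.

End Parseval.

(** * Sequences with geometric rates *)

Section Series.
Context {R : realType}.
Notation mu := (@lebesgue_measure R).
Notation half := (2^-1 : R).

Lemma half_gt0 n : 0 < half ^+ n.
Proof. by rewrite exprn_gt0// invr_gt0. Qed.

Lemma sum_half n : \sum_(i < n) half ^+ i = 2 - 2 * half ^+ n.
Proof.
elim: n => [|n ih]; first by rewrite big_ord0 expr0; lra.
by rewrite big_ord_recr/= ih exprS; field.
Qed.

Lemma cvg_half (K : R) : K * half ^+ n @[n --> \oo] --> (0 : R).
Proof.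
rewrite -(mulr0 K); apply: cvgMl_tmp; apply: cvg_expr.
by rewrite ger0_norm ?invr_ge0// invf_lt1// ltr1n.
Qed.

(** Subtracting or adding the tail 2 S / 2^j of the steps makes the sequence
    increasing or decreasing; both sequences have the same limit. *)
Lemma fast_cvg (a : nat -> R) (S : R) : (forall j, `|a j.+1 - a j| <= S * half ^+ j) ->
  a j @[j --> \oo] --> limn a /\ forall j, `|limn a - a j| <= 2 * S * half ^+ j.
Proof.
move=> aS.
pose b j := a j - 2 * S * half ^+ j; pose c j := a j + 2 * S * half ^+ j.
have S0 : 0 <= S by have := aS 0; rewrite expr0 mulr1; apply: le_trans.
have bnd : nondecreasing_seq b.
  apply/nondecreasing_seqP => j; rewrite /b exprS; have := aS j; rewrite ler_norml => /andP[h _].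
  by move: h; move: (half ^+ j) => z h; lra.
have cni : nonincreasing_seq c.
  apply/nonincreasing_seqP => j; rewrite /c exprS; have := aS j; rewrite ler_norml => /andP[_ h].
  by move: h; move: (half ^+ j) => z h; lra.
have bc j : b j <= c 0%N.
  apply: (@le_trans _ _ (c j)); last exact: cni.
  rewrite /b /c; have := half_gt0 j; have := mulr_ge0 S0 (ltW (half_gt0 j)); lra.
have bcv : cvgn b by apply: nondecreasing_is_cvgn => //; exists (c 0%N) => _ [j _ <-].
have h0 := cvg_half (2 * S).
have al : a j @[j --> \oo] --> limn b.
  have := cvgD bcv h0; rewrite addr0.
  have -> : b + (fun n => 2 * S * half ^+ n) = a by apply/funext => j; rewrite /b /= subrK.
  by apply.
have E : limn a = limn b by exact/cvg_lim.
have cl : c j @[j --> \oo] --> limn b by rewrite -(addr0 (limn b)); apply: cvgD.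
rewrite E; split => // j; rewrite ler_norml; apply/andP; split.
  have := nondecreasing_cvgn_le bnd bcv j; rewrite /b; lra.
have := nonincreasing_cvgn_ge cni (cvgP _ cl) j; rewrite (cvg_lim _ cl)// /c; lra.
Qed.

(** Take for E the sum of the series of the D j: its integral is at most 2 K, so
    that it is finite almost everywhere. *)
Lemma common_majorant (D : nat -> R -> R) (K : R) :
  (forall j, rint (D j)) -> (forall j x, 0 <= D j x) ->
  (forall j, \int[mu]_x D j x <= K * half ^+ j) ->
  exists (E : R -> R) (A : set R), [/\ rint E, measurable A, {ae mu, forall x, A x} &
    forall x, A x -> forall j, D j x <= E x].
Proof.
move=> iD D0 DK.
have mD j := rint_meas (iD j).
pose e x := (\sum_(j <oo) (D j x)%:E)%E.
have e0 x : (0 <= e x)%E by apply: nneseries_ge0 => j _ _; rewrite lee_fin.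
have me : measurable_fun [set: R] e.
  by apply: ge0_emeasurable_sum => [j x _ _|j _]; [rewrite lee_fin|exact/measurable_EFinP].
have K0 : 0 <= K.
  have := DK 0%N; rewrite expr0 mulr1; apply: le_trans; exact: RI_ge0.
have ie : (\int[mu]_x e x <= (2 * K)%:E)%E.
  rewrite (@integral_nneseries _ _ R mu setT measurableT (fun j x => (D j x)%:E)
    (fun j => (measurable_EFinP _ _).2 (mD j)) (fun j x _ => D0 j x)).
  apply: lime_le; first by apply: is_cvg_nneseries => j _ _; apply: integral_ge0 => x _; rewrite lee_fin.
  apply: nearW => n; rewrite big_mkord.
  apply: (@le_trans _ _ (\sum_(j < n) (K * half ^+ j)%:E)%E).
    by apply: lee_sum => j _; rewrite -(RI_E (iD j)) lee_fin.
  rewrite sumEFin lee_fin -mulr_sumr sum_half mulrBr.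
  have := mulr_ge0 K0 (ltW (half_gt0 n)); lra.
have fe : mu.-integrable [set: R] e.
  apply/integrableP; split => //; under eq_integral do rewrite gee0_abs//.
  by apply: (le_lt_trans ie); rewrite ltry.
exists (fun x => fine (e x)), [set x | e x \is a fin_num].
have mf : measurable_fun [set: R] (fun x => fine (e x)).
  by apply: measurableT_comp => //; exact: fine_measurable.
split.
- apply: rint_ge0P => //; first by move=> x; exact: fine_ge0.
  apply: (@le_lt_trans _ _ (2 * K)%:E); last by rewrite ltry.
  apply: le_trans ie; apply: ge0_le_integral => //.
  + by move=> x _; rewrite lee_fin fine_ge0.
  + exact/measurable_EFinP.
  + move=> x _; have := e0 x; case: (e x) => [r|//|//] _ //=; exact: leey.
- by rewrite -[X in measurable X]setTI; exact: emeasurable_fin_num.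
- by have := integrable_ae measurableT fe; apply: aeS => x /(_ I).
- move=> x fx j; rewrite -lee_fin fineK//.
  apply: le_trans (nneseries_lim_ge (m := 0) (P := xpredT) j.+1 _); last first.
    by move=> k _; rewrite lee_fin.
  rewrite big_mkord big_ord_recr/= leeDr//; apply: sume_ge0 => k _; rewrite lee_fin//.
Qed.

End Series.

(** * The Fourier transform of square integrable functions *)

Section FourierL2.
Context {R : realType}.
Notation mu := (@lebesgue_measure R).
Notation C := R[i].
Notation ReC := (@complex.Re R).
Notation ImC := (@complex.Im R).
Notation half := (2^-1 : R).
Implicit Types f g v h phi : R -> C.

Lemma normcM_weighted (k : R) (z w : C) : 0 < k ->
  normc z * normc w <= k^-1 * normc z ^+ 2 + k * normc w ^+ 2.
Proof.
move=> k0; have kn : k != 0 by rewrite gt_eqF.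
have := normc_ge0 z; have := normc_ge0 w; move: (normc z) (normc w) => a b b0 a0.
rewrite -subr_ge0.
have -> : k^-1 * a ^+ 2 + k * b ^+ 2 - a * b =
  k^-1 * ((a - k * b / 2) ^+ 2 + 3 / 4 * (k * b) ^+ 2) by field.
by rewrite mulr_ge0 ?invr_ge0 ?(ltW k0)// addr_ge0 ?sqr_ge0// mulr_ge0 ?sqr_ge0.
Qed.

(** A form of the Cauchy-Schwarz inequality: with k = 2^-j, a bound A of order 4^-j
    gives an estimate of order 2^-j. *)
Lemma CI_normc_weighted f g (k A B : R) : 0 < k -> L2 f -> L2 g ->
  \int[mu]_x (normc (f x) ^+ 2) <= A -> \int[mu]_x (normc (g x) ^+ 2) <= B ->
  normc (cintegral (fun x => f x * g x)) <= k^-1 * A + k * B.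
Proof.
move=> k0 lf lg fA gB.
have i1 := rintZ k^-1 (L2_rint lf); have i2 := rintZ k (L2_rint lg).
apply: (le_trans (CI_normc_le (cmeasM (L2_cmeas lf) (L2_cmeas lg)) (rintD i1 i2) _)).
  by move=> x; rewrite Normc.normcM; exact: normcM_weighted.
rewrite (RID i1 i2) (RIZ _ (L2_rint lf)) (RIZ _ (L2_rint lg)); apply: lerD.
  by apply: ler_wpM2l => //; rewrite invr_ge0 ltW.
by apply: ler_wpM2l => //; rewrite ltW.
Qed.

Let cut v (n : nat) x : C := (\1_(`[- n%:R, n%:R]) x : R)%:C * v x.

Let cmeas_indic (a b : R) : cmeas (fun x : R => (\1_(`[a, b]) x : R)%:C).
Proof. by apply: cmeas_real; exact: (rint_meas (rint_indic_itv a b)). Qed.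

Let normc_indic (a b x : R) : normc (\1_(`[a, b]) x : R)%:C <= 1.
Proof. by rewrite normcR indic_itvE; case: ifP => _; rewrite ?normr1 ?normr0. Qed.

Let L2_cut v n : L2 v -> L2 (cut v n).
Proof. by apply: (@L2M_bdd _ _ _ 1). Qed.

Let cint_cut v n : L2 v -> cintegrable (cut v n).
Proof.
move=> lv; apply: L2M_cint lv; apply: (L2_le (cmeas_indic _ _) _ (rint_indic_itv (- n%:R) n%:R)) => x.
rewrite normcR indic_itvE; case: ifP => _; rewrite ?normr1 ?normr0 ?expr1n// expr0n//.
Qed.

Let L2B f g : L2 f -> L2 g -> L2 (fun x => f x - g x).
Proof.
move=> lf lg; have := L2D lf (L2Z (-1) lg).
by rewrite (_ : (fun x => _) = (fun x => f x - g x))//; apply/funext => x; rewrite mulN1r.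
Qed.

Let cut_cvg v : L2 v ->
  \int[mu]_x (normc (v x - cut v n x) ^+ 2) @[n --> \oo] --> (0 : R).
Proof.
move=> lv.
have [] := @RI_dct _ (fun n x => normc (v x - cut v n x) ^+ 2) (fun=> 0)
  (fun x => normc (v x) ^+ 2).
- move=> n; apply: measurable_normc2; exact: L2_cmeas (L2B lv (L2_cut n lv)).
- move=> x; apply: cvg_near_cst; exists (Num.bound `|x|) => // n /= hn.
  rewrite /cut indic_itvE -ler_norml.
  have -> : `|x| <= n%:R by apply/ltW/(lt_le_trans (archi_boundP (normr_ge0 _))); rewrite ler_nat.
  by rewrite mul1r subrr Normc.normc0 expr0n.
- exact: L2_rint.
- move=> n x; rewrite (ger0_norm (sqr_ge0 _)) /cut indic_itvE; case: ifP => _.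
    by rewrite mul1r subrr Normc.normc0 expr0n sqr_ge0.
  by rewrite mul0r subr0.
by rewrite RI0.
Qed.

Lemma normc_le2 z (a : R) : `|ReC z| <= a -> `|ImC z| <= a -> normc z ^+ 2 <= 2 * a ^+ 2.
Proof.
move=> h1 h2; rewrite sqr_normcE -(real_normK (num_real (ReC z))) -(real_normK (num_real (ImC z))).
have := normr_ge0 (ReC z); have := normr_ge0 (ImC z).
move: h1 h2; move: `|_| `|_| => b c; nra.
Qed.

Lemma fourier_B f g xi : cintegrable f -> cintegrable g ->
  fourier (fun x => f x - g x) xi = fourier f xi - fourier g xi.
Proof.
move=> fi gi; rewrite /fourier -CIB; [|exact: cint_fourier..].
by apply: CI_eq => x; rewrite mulrBl.
Qed.

(** Truncate v to bounded intervals, with errors 16^-j in squared norm, and let H j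
    be the Fourier transforms of the truncations. By Bessel's inequality,
    4^j |H (j+1) - H j|^2 has an integral of order 2^-j. Hence these functions have
    a common integrable majorant E, and outside a null set the steps of the
    sequence H j are at most 2^-j times the square root of E: the sequence converges
    pointwise, to a limit whose distance to H j in L^2 is of order 2^-j. *)
Lemma fourier_L2 v : L2 v -> exists h, L2 h /\ forall phi, cintegrable phi -> L2 phi ->
  cintegral (fun x => v x * fourier phi x) = cintegral (fun xi => h xi * phi xi).
Proof.
move=> lv.
have z0 j : 0 < (half ^+ 4) ^+ j by rewrite -exprM half_gt0.
have exN j : exists n, \int[mu]_x (normc (v x - cut v n x) ^+ 2) <= (half ^+ 4) ^+ j.
  have /cvgr0_norm_le /(_ _ (z0 j)) [n _ /(_ n (leqnn n)) h] := cut_cvg lv.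
  by exists n; exact: le_trans (ler_norm _) h.
have [N hN] := choice exN.
pose W j := cut v (N j).
have lW j : L2 (W j) by exact: L2_cut.
have iW j : cintegrable (W j) by exact: cint_cut.
pose H j := fourier (W j).
have lvW j : L2 (fun x => v x - W j x) := L2B lv (lW j).
have lH j : L2 (H j).
  apply/L2P; split; first exact: fourier_cmeas.
  by case: (bessel (iW j) (L2_rint (lW j))).
have pp : (0 : R) <= 2 * pi by rewrite mulr_ge0// pi_ge0.
have dW j : \int[mu]_x (normc (W j.+1 x - W j x) ^+ 2) <= 4 * (half ^+ 4) ^+ j.
  have i1 := rintZ 2 (L2_rint (lvW j)); have i2 := rintZ 2 (L2_rint (lvW j.+1)).
  apply: (@le_trans _ _ (\int[mu]_x (2 * normc (v x - W j x) ^+ 2 + 2 * normc (v x - W j.+1 x) ^+ 2))).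
    apply: RI_le; [exact: L2_rint (L2B (lW _) (lW _))|exact: rintD|].
    move=> x; have -> : W j.+1 x - W j x = (v x - W j x) + - (v x - W j.+1 x) by ring.
    by rewrite -[in X in _ <= _ + X]normcN; exact: sqr_normcD_le.
  rewrite (RID i1 i2) (RIZ _ (L2_rint (lvW j))) (RIZ _ (L2_rint (lvW j.+1))).
  have := hN j; have := hN j.+1; have := ltW (z0 j).
  rewrite -/(W j) -/(W j.+1) (exprS (half ^+ 4) j).
  move: (\int[mu]_x _) (\int[mu]_x _) ((half ^+ 4) ^+ j) => a b z z0' h1 h2.
  have : half ^+ 4 * z <= z by rewrite ler_piMl// exprn_ile1// ?invr_ge0// invf_le1// ler1n.
  lra.
have lD j : L2 (fun xi => H j.+1 xi - H j xi) := L2B (lH j.+1) (lH j).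
have dH j : \int[mu]_xi (normc (H j.+1 xi - H j xi) ^+ 2) <= 2 * pi * (4 * (half ^+ 4) ^+ j).
  have iB := cintB (iW j.+1) (iW j).
  have [_ e] := bessel iB (L2_rint (L2B (lW j.+1) (lW j))).
  apply: le_trans (ler_wpM2l pp (dW j)); apply: le_trans e.
  rewrite le_eqVlt; apply/orP; left; apply/eqP; apply: RI_eq => xi.
  by rewrite (fourier_B _ (iW j.+1) (iW j)).
pose D j xi := (4 : R) ^+ j * normc (H j.+1 xi - H j xi) ^+ 2.
have iD j : rint (D j) by apply: rintZ; exact: L2_rint (lD j).
have D0 j xi : 0 <= D j xi by apply: mulr_ge0; [exact: exprn_ge0|exact: sqr_ge0].
have DK j : \int[mu]_xi D j xi <= 8 * pi * half ^+ j.
  rewrite (RIZ _ (L2_rint (lD j))); apply: (@le_trans _ _ (4 ^+ j * (2 * pi * (4 * (half ^+ 4) ^+ j)))).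
    by apply: ler_wpM2l; [rewrite exprn_ge0|exact: dH].
  have -> : 4 ^+ j * (2 * pi * (4 * (half ^+ 4) ^+ j)) = 8 * pi * (4 * half ^+ 4) ^+ j.
    rewrite (exprMn j 4 (half ^+ 4)); move: (4 ^+ j) ((half ^+ 4) ^+ j) (pi : R) => a b p; ring.
  apply: ler_wpM2l; first by rewrite mulr_ge0// pi_ge0.
  have -> : 4 * half ^+ 4 = half ^+ 2 by field.
  by rewrite -exprM ler_wiXn2l// ?invr_ge0// ?invf_le1// ?ler1n// mulSn mul1n leq_addr.
have [E [A [iE mA aA DE]]] := common_majorant iD D0 DK.
(* the H j are set to 0 on the null set where the majorant is not available *)
pose iA xi : R := \1_A xi.
have iA01 xi : (A xi /\ iA xi = 1) \/ (~ A xi /\ iA xi = 0).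
  rewrite /iA indicE; have [Ax|Ax] := pselect (A xi); [left|right]; split => //.
    by rewrite mem_set.
  by rewrite memNset.
have miA : measurable_fun [set: R] iA by exact: measurable_indic.
pose S xi : R := iA xi * Num.sqrt (E xi).
have SE xi : S xi ^+ 2 <= `|E xi|.
  rewrite /S; case: (iA01 xi) => [[Ax ->]|[_ ->]]; last by rewrite mul0r expr2 mul0r normr_ge0.
  rewrite mul1r sqr_sqrtr ?ler_norm//; exact: le_trans (DE _ Ax 0%N).
pose H' j xi : C := (iA xi)%:C * H j xi.
have step j xi : normc (H' j.+1 xi - H' j xi) <= S xi * half ^+ j.
  rewrite /H' -mulrBr Normc.normcM normcR /S.
  case: (iA01 xi) => [[Ax ->]|[_ ->]]; last by rewrite normr0 !mul0r.
  rewrite normr1 !mul1r.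
  have S0 : 0 <= Num.sqrt (E xi) * half ^+ j by rewrite mulr_ge0 ?sqrtr_ge0// ltW// half_gt0.
  rewrite -(@ler_pXn2r _ 2)// ?nnegrE ?normc_ge0//.
  have E0 : 0 <= E xi := le_trans (D0 0%N xi) (DE _ Ax 0%N).
  rewrite (exprMn 2 (Num.sqrt (E xi))) (sqr_sqrtr E0).
  have := DE _ Ax j; rewrite /D => h4.
  have -> : (half ^+ j) ^+ 2 = (4 ^+ j)^-1.
    by rewrite -exprM mulnC exprM -exprVn; congr (_ ^+ _); field.
  by rewrite ler_pdivlMr ?exprn_gt0// mulrC.
have mH' j : cmeas (H' j) by apply: cmeasM (L2_cmeas (lH j)); exact: cmeas_real.
have cRe xi : ReC (H' j xi) @[j --> \oo] --> limn (fun j => ReC (H' j xi)) /\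
    forall j, `|limn (fun j => ReC (H' j xi)) - ReC (H' j xi)| <= 2 * S xi * half ^+ j.
  apply: fast_cvg => j; rewrite -ReN -ReD; exact: le_trans (normc_Re _) (step j xi).
have cIm xi : ImC (H' j xi) @[j --> \oo] --> limn (fun j => ImC (H' j xi)) /\
    forall j, `|limn (fun j => ImC (H' j xi)) - ImC (H' j xi)| <= 2 * S xi * half ^+ j.
  apply: fast_cvg => j; rewrite -ImN -ImD; exact: le_trans (normc_Im _) (step j xi).
pose h xi : C := limn (fun j => ReC (H' j xi)) +i* limn (fun j => ImC (H' j xi)).
have mh : cmeas h.
  split => /=.
    apply: (measurable_fun_cvg (h := fun j xi => ReC (H' j xi))) => [j|xi _].
      by case: (mH' j).
    by case: (cRe xi).
  apply: (measurable_fun_cvg (h := fun j xi => ImC (H' j xi))) => [j|xi _].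
    by case: (mH' j).
  by case: (cIm xi).
have hH j xi : normc (h xi - H' j xi) ^+ 2 <= 8 * (half ^+ j) ^+ 2 * `|E xi|.
  apply: (@le_trans _ _ (2 * (2 * S xi * half ^+ j) ^+ 2)).
    apply: normc_le2.
      by rewrite ReD ReN; case: (cRe xi).
    by rewrite ImD ImN; case: (cIm xi).
  have -> : 2 * (2 * S xi * half ^+ j) ^+ 2 = 8 * (half ^+ j) ^+ 2 * S xi ^+ 2.
    move: (half ^+ j) => z; ring.
  by apply: ler_wpM2l => //; rewrite mulr_ge0// sqr_ge0.
have iE8 j := rintZ (8 * (half ^+ j) ^+ 2) (rint_abs iE).
have lhH j : L2 (fun xi => h xi - H' j xi).
  by apply: L2_le (hH j) (iE8 j); exact: cmeasB.
have lH' j : L2 (H' j).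
  apply: (@L2M_bdd _ _ (fun xi => (iA xi)%:C) 1 _ _ (lH j)); first exact: cmeas_real.
  by move=> xi; rewrite normcR; case: (iA01 xi) => -[_ ->]; rewrite ?normr1 ?normr0.
have lh : L2 h.
  have := L2D (lhH 0%N) (lH' 0%N).
  by rewrite (_ : (fun x => _) = h)//; apply/funext => x; rewrite subrK.
exists h; split => // phi iphi lphi.
have [i1 _] := bessel iphi (L2_rint lphi).
have lF : L2 (fourier phi) by apply/L2P; split; [exact: fourier_cmeas|].
pose K := 1 + \int[mu]_x (normc (fourier phi x) ^+ 2) +
  (8 * \int[mu]_xi `|E xi| + \int[mu]_xi (normc (phi xi) ^+ 2)).
have key j : normc (cintegral (fun x => v x * fourier phi x) -
    cintegral (fun xi => h xi * phi xi)) <= K * half ^+ j.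
  have [_ _ e1] := fourier_mult (iW j) iphi.
  have e2 : cintegral (fun xi => H j xi * phi xi) = cintegral (fun xi => H' j xi * phi xi).
    apply: CI_ae_eq; [exact: cint_cmeas (L2M_cint (lH j) lphi)|
      exact: cint_cmeas (L2M_cint (lH' j) lphi)|].
    apply: aeS aA => xi Axi; rewrite /H'.
    by case: (iA01 xi) => -[]// _ ->; rewrite mul1r.
  have -> : cintegral (fun x => v x * fourier phi x) - cintegral (fun xi => h xi * phi xi) =
    cintegral (fun x => (v x - W j x) * fourier phi x) -
    cintegral (fun xi => (h xi - H' j xi) * phi xi).
    have -> : cintegral (fun x => (v x - W j x) * fourier phi x) =
       cintegral (fun x => v x * fourier phi x) - cintegral (fun x => W j x * fourier phi x).
      rewrite -(CIB (L2M_cint lv lF) (L2M_cint (lW j) lF)).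
      by apply: CI_eq => x; rewrite mulrBl.
    have -> : cintegral (fun xi => (h xi - H' j xi) * phi xi) =
       cintegral (fun xi => h xi * phi xi) - cintegral (fun xi => H' j xi * phi xi).
      rewrite -(CIB (L2M_cint lh lphi) (L2M_cint (lH' j) lphi)).
      by apply: CI_eq => x; rewrite mulrBl.
    by rewrite -e2 e1 -/(H j); move: (cintegral _) (cintegral _) (cintegral _) => p q r; ring.
  apply: (le_trans (normcBD _ _)); rewrite /K mulrDl; apply: lerD.
    apply: (le_trans (CI_normc_weighted (half_gt0 j) (lvW j) lF (hN j) (lexx _))).
    rewrite mulrDl mul1r; apply: lerD; last by rewrite mulrC.
    have z1 : half ^+ j <= 1 by rewrite exprn_ile1// ?invr_ge0// invf_le1// ler1n.
    have z0h : 0 < half ^+ j := half_gt0 j; move: z0h; rewrite exprAC; move: (half ^+ j) z1 => z z1 z0'.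
    have -> : z^-1 * z ^+ 4 = z * z ^+ 2 by field; rewrite gt_eqF.
    by apply: ler_piMr; [exact: ltW|apply: exprn_ile1 => //; exact: ltW].
  have hB : \int[mu]_xi (normc (h xi - H' j xi) ^+ 2) <= 8 * (half ^+ j) ^+ 2 * \int[mu]_xi `|E xi|.
    by rewrite -(RIZ _ (rint_abs iE)); apply: RI_le; [exact: L2_rint (lhH j)|exact: iE8|exact: hH].
  apply: (le_trans (CI_normc_weighted (half_gt0 j) (lhH j) lphi hB (lexx _))).
  rewrite [leRHS]mulrDl; apply: lerD; last by rewrite mulrC.
  have z0h : 0 < half ^+ j := half_gt0 j; move: z0h; move: (half ^+ j) (\int[mu]_xi `|E xi|) => z e z0'.
  by rewrite le_eqVlt; apply/orP; left; apply/eqP; field; rewrite gt_eqF.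
apply/eqP; rewrite -subr_eq0; apply/eqP/Normc.eq0_normc/eqP.
rewrite eq_le normc_ge0 andbT.
rewrite -lerN2; apply: (cvg_le_cst (cvgN (cvg_half K)) _) => j.
by rewrite lerN2; exact: key.
Qed.

End FourierL2.

(** * Fourier transforms away from the origin *)

Section IsFourier.
Context {R : realType}.
Notation mu := (@lebesgue_measure R).
Notation C := R[i].
Notation ReC := (@complex.Re R).
Notation ImC := (@complex.Im R).
Implicit Types f g v h phi : R -> C.

Lemma schwartz_cint phi : schwartz phi -> cintegrable phi.
Proof. by move=> [h1 h2]; split; exact: rschwartz_rint. Qed.

Lemma schwartz_L2 phi : schwartz phi -> L2 phi.
Proof.
move=> sp; have ip := schwartz_cint sp; have mp := cint_cmeas ip.
have [M hM] : exists M, forall x, normc (phi x) <= M.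
  case: sp => h1 h2; have [M1 hM1] := rschwartz_bound h1; have [M2 hM2] := rschwartz_bound h2.
  have b (N : R) (x : R) (y : R) : `|y| <= N / (1 + x ^+ 2) -> `|y| <= `|N|.
    move=> h; apply: (le_trans h); apply: (le_trans (ler_norm _)).
    have p : 1 <= 1 + x ^+ 2 by rewrite lerDl sqr_ge0.
    have p0 : 0 < 1 + x ^+ 2 by apply: lt_le_trans p.
    rewrite normrM normfV (gtr0_norm p0) ler_piMr//.
    by rewrite invf_le1.
  exists (`|M1| + `|M2|) => x; apply: (le_trans (normc_le_ReIm _)).
  by apply: lerD; [exact: b (hM1 x)|exact: b (hM2 x)].
apply: (@L2_le _ _ (fun x => M * normc (phi x))) => //.
  move=> x; rewrite expr2; apply: ler_wpM2r; [exact: normc_ge0|exact: hM].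
by apply: rintZ; exact: cint_normc.
Qed.

Lemma ae_neq0 : {ae mu, forall x : R, x != 0}.
Proof.
exists [set 0]; split; first exact: measurable_set1.
  exact: lebesgue_measure_set1.
by move=> x /= /negP; rewrite negbK => /eqP.
Qed.

(** The function (g - g') x exp(- x^2/2) is integrable, and testing on the
    modulations of x exp(- x^2/2) shows that its Fourier transform
    vanishes; so it is zero by [fpair_le]. *)
Lemma is_fourier_unique v g g' : is_fourier v g -> is_fourier v g' ->
  {ae mu, forall xi, g xi = g' xi}.
Proof.
move=> [_ mg hg] [_ mg' hg'].
pose q (y xi : R) : C := xi%:C * cgauss 1 0 y xi.
have sq y : schwartz (q y) by exact: schwartz_xcgauss.
have q0 y : q y 0 = 0 by rewrite /q mul0r.
pose E xi : C := (g xi - g' xi) * q 0 xi.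
have iE : cintegrable E.
  have [i1 _] := hg _ (sq 0) (q0 0); have [i2 _] := hg' _ (sq 0) (q0 0).
  by apply: cint_eq (cintB i1 i2) => x; rewrite /E mulrBl.
have FE y : fourier E y = 0.
  have [i1 e1] := hg _ (sq (- y)) (q0 (- y)); have [i2 e2] := hg' _ (sq (- y)) (q0 (- y)).
  have : cintegral (fun xi => g xi * q (- y) xi - g' xi * q (- y) xi) = 0.
    by rewrite (CIB i1 i2) -e1 -e2 subrr.
  apply: etrans; apply: CI_eq => xi; rewrite -mulrBl /E -mulrA; congr (_ * _).
  by rewrite /q /cgauss mul0r cis0 mulr1 -mulrA mulNr [y * xi]mulrC.
have fp : fpair E (fun=> 0).
  move=> s a b s0; have [_ _ ->] := fourier_mult iE (cint_cgauss a b s0).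
  by apply: CI_eq => x; rewrite FE.
have l0 : L2 (fun _ : R => 0 : C).
  apply/L2P; split; first exact: cmeas_cst.
  by apply: rint_eq rint0 => x; rewrite Normc.normc0 expr0n.
have [lE le] := fpair_le (cint_tame iE) l0 fp.
have EN : {ae mu, forall x, normc (E x) ^+ 2 = 0}.
  apply: RI_eq0_ae (L2_rint lE) _ _; first exact: measurable_normc2 (L2_cmeas lE).
    by move=> x; exact: sqr_ge0.
  have pp : (0 : R) < 2 * pi by rewrite mulr_gt0// pi_gt0.
  rewrite -(ler_pM2l pp) mulr0; apply: (le_trans le).
  rewrite (RI_eq (g := fun=> 0)) ?RI0// => x.
  by rewrite Normc.normc0 expr0n.
apply: aeS (aeI EN ae_neq0) => xi [/eqP]; rewrite sqrf_eq0 => /eqP/Normc.eq0_normc/eqP.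
rewrite /E mulf_eq0 subr_eq0 => /orP[/eqP//|].
rewrite /q /cgauss mul0r cis0 mulr1 -rmorphM/= => /eqP/(congr1 ReC)/= /eqP.
by rewrite mulf_eq0 (gt_eqF (gexp_gt0 _ _ _)) orbF => ->.
Qed.

Lemma L2_tempered v : L2 v -> tempered v.
Proof.
move=> lv; split; first exact: L2_cmeas.
exists 2%N; suff : rint (fun x => normc (v x) / (1 + `|x|) ^+ 2) by exact: integrable_lty.
have mv := L2_cmeas lv.
have p x : 0 < 1 + `|x : R| by rewrite ltr_wpDr.
have b x : (1 + `|x : R|) ^- 2 <= (1 + x ^+ 2)^-1.
  rewrite lef_pV2 ?posrE ?exprn_gt0//; last by rewrite ltr_wpDr// sqr_ge0.
  by rewrite -(real_normK (num_real x)); have := normr_ge0 x; move: `|x| => y; nra.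
apply: (@rint_le _ _ (fun x => normc (v x) ^+ 2 + (1 + x ^+ 2)^-1)).
- apply: measurable_funM; first exact: measurable_normc.
  apply: continuous_measurable_fun => x; apply: cvgV; first by rewrite gt_eqF// exprn_gt0.
  have c : (1 + `|y|) @[y --> x] --> 1 + `|x|.
    by apply: cvgD; [exact: cvg_cst|exact: cvg_norm].
  rewrite expr2; rewrite (_ : (fun y => _) = (fun y : R => (1 + `|y|) * (1 + `|y|))).
    exact: cvgM.
  by apply/funext => y; rewrite expr2.
- move=> x; rewrite ger0_norm; last by rewrite divr_ge0 ?normc_ge0// exprn_ge0// ltW.
  have i0 : 0 <= (1 + `|x|) ^- 2 by rewrite invr_ge0 exprn_ge0// ltW.
  have i1 : (1 + `|x|) ^- 2 <= 1 by rewrite invf_le1 ?exprn_gt0// exprn_ege1// lerDl.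
  have := b x; have := normc_ge0 (v x); move: i0 i1; move: (normc (v x)) ((1 + `|x|) ^- 2) ((1 + x ^+ 2)^-1) => n d e.
  move=> d0 d1 n0 de.
  have : n * d <= n ^+ 2 + d ^+ 2 by nra.
  have : d ^+ 2 <= d by nra.
  lra.
- by apply: rintD; [exact: L2_rint|exact: rint_invD1sqr].
Qed.

(** The function chosen by [fhat] agrees almost everywhere with the one constructed
    in [fourier_L2]. *)
Lemma fhat_L2 v : L2 v -> [/\ is_fourier v (fhat v), L2 (fhat v) & fpair v (fhat v)].
Proof.
move=> lv; have [h [lh hh]] := fourier_L2 lv.
have ish : is_fourier v h.
  split; [exact: L2_tempered|exact: L2_cmeas|].
  move=> phi sp _; split; first exact: L2M_cint lh (schwartz_L2 sp).
  exact: hh (schwartz_cint sp) (schwartz_L2 sp).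
have isf : is_fourier v (fhat v) by apply: (@xgetPex _ (fun=> 0) [set g | is_fourier v g]); exists h.
have fh := is_fourier_unique ish isf.
have mf : cmeas (fhat v) by case: isf.
have lf : L2 (fhat v).
  apply/L2P; split => //; apply: rint_ae_eq (L2_rint lh).
  - exact: measurable_normc2 (L2_cmeas lh).
  - exact: measurable_normc2.
  - by apply: aeS fh => x ->.
split => // s a b s0.
have sg := @schwartz_cgauss _ s a b s0.
rewrite (hh _ (schwartz_cint sg) (schwartz_L2 sg)).
apply: CI_ae_eq.
- exact: cint_cmeas (L2M_cint lh (schwartz_L2 sg)).
- exact: cint_cmeas (L2M_cint lf (schwartz_L2 sg)).
- by apply: aeS fh => x ->.
Qed.

(** A modulation by t preserves the value of a Gaussian at the origin, so that the
    difference of the two Gaussians is a test function that vanishes there: the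
    increment forgets a Dirac mass at the origin in the transform of v. *)
Lemma fpair_incr_is_fourier (t : R) v g : tame v -> is_fourier v g ->
  fpair (incr t v) (mincr t g).
Proof.
move=> tv [_ mg hg] s a b s0.
have s1 := @schwartz_cgauss _ s a (b + t) s0; have s2 := @schwartz_cgauss _ s a b s0.
have z : cgauss s a (b + t) 0 - cgauss s a b 0 = 0 by rewrite /cgauss !mulr0 subrr.
have [_ e] := hg _ (schwartzB s1 s2) z.
rewrite (CI_incr_gauss _ _ _ s0 tv) -(CIB (tame_fourier_cgauss _ _ s0 tv) (tame_fourier_cgauss _ _ s0 tv)).
transitivity (cintegral (fun x => v x * fourier (fun xi => cgauss s a (b + t) xi - cgauss s a b xi) x)).
  apply: CI_eq => x; rewrite (fourier_B _ (schwartz_cint s1) (schwartz_cint s2)).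
  by rewrite mulrBr.
rewrite e; apply: CI_eq => xi; rewrite cgauss_shift /mincr.
by rewrite mulrBl !mul1r mulrBl mulrBr mulrCA mulrA.
Qed.

Lemma normr_sin_le (x : R) : `|sin x| <= `|x|.
Proof.
wlog x0 : x / 0 <= x => [h|].
  have [/h //|/ltW x0] := leP 0 x.
  by have := h (- x); rewrite oppr_ge0 sinN !normrN; exact.
have cs : {within `[0, x], continuous (@sin R)}.
  by apply: continuous_subspaceT; exact: continuous_sin.
have [c _] := MVT_segment x0 (fun y _ => is_derive_sin y) cs.
rewrite sin0 !subr0 => ->; rewrite normrM ler_piMl// ler_norml cos_geN1 cos_le1//.
Qed.

(** The symbol, in the variable t xi, of the squared L^2 norm of increments by t. *)
Definition omega (s : R) : R := normc (cis s - 1) ^+ 2.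

Lemma omegaE s : omega s = 2 - 2 * cos s.
Proof.
by rewrite /omega sqr_normcE ReD ImD ReN ImN /= subr0; have := cos2Dsin2 s; lra.
Qed.

Lemma omega_ge0 s : 0 <= omega s.
Proof. exact: sqr_ge0. Qed.

Lemma omega_le4 s : omega s <= 4.
Proof. by rewrite omegaE; have := cos_geN1 s; lra. Qed.

Lemma omega_le_sqr s : omega s <= s ^+ 2.
Proof.
have -> : omega s = 4 * sin (s / 2) ^+ 2.
  have := cosD (s / 2) (s / 2); rewrite -splitr omegaE => ->.
  by have := cos2Dsin2 (s / 2); move: (cos _) (sin _) => c d h; nra.
rewrite (_ : s ^+ 2 = 4 * (s / 2) ^+ 2); last by field.
rewrite ler_pM2l// -(real_normK (num_real (sin _))) -(real_normK (num_real (s / 2))).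
by rewrite lerXn2r ?nnegrE// normr_sin_le.
Qed.

Lemma omega_le s : omega s <= 2 * `|s|.
Proof.
have := omega_le4 s; have := omega_le_sqr s; rewrite -(real_normK (num_real s)).
by have := normr_ge0 s; move: `|s| (omega s) => a o; nra.
Qed.

End IsFourier.

(** * Comparison of the weight |xi| with increments *)

Section Dyadic.
Context {R : realType}.
Notation mu := (@lebesgue_measure R).
Notation half := (2^-1 : R).
Implicit Types p q : R -> R.

(** A discrete version of the integral of omega(t s) dt / t^2 over 0 < t <= 1, which is
    comparable to |s| for |s| >= 1. *)
Definition dyadic_sum (n : nat) (s : R) : R := \sum_(j < n) 2 ^+ j * omega (half ^+ j * s).

Lemma dyadic_sumS n s : dyadic_sum n.+1 s = omega s + 2 * dyadic_sum n (half * s).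
Proof.
rewrite /dyadic_sum big_ord_recl expr0 expr0 !mul1r; congr (_ + _).
rewrite mulr_sumr; apply: eq_bigr => j _; rewrite /= /bump/= add1n !exprS -!mulrA.
by congr (_ * (_ * omega _)); rewrite mulrCA.
Qed.

(** The right-hand side has the size of min(s^2, 1), and its form makes the
    induction of [dyadic_sum_le] exact. *)
Lemma omega_le_frac (s : R) : omega s <= 12 * `|s| ^+ 2 / ((1 + `|s|) * (2 + `|s|)).
Proof.
have := omega_le4 s; have := omega_le_sqr s; rewrite -(real_normK (num_real s)).
have := normr_ge0 s; move: `|s| (omega s) => a o a0 h1 h2.
have p : 0 < (1 + a) * (2 + a) by rewrite mulr_gt0// ltr_pwDl.
rewrite ler_pdivlMr//.
have [a2|a2] := leP a 2.
  apply: (@le_trans _ _ (a ^+ 2 * ((1 + a) * (2 + a)))); first by rewrite ler_wpM2r// ltW.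
  rewrite mulrC ler_wpM2r ?sqr_ge0//; nra.
apply: (@le_trans _ _ (4 * ((1 + a) * (2 + a)))); first by rewrite ler_wpM2r// ltW.
nra.
Qed.

Lemma dyadic_sum_le n s : dyadic_sum n s <= 12 * `|s|.
Proof.
(* B(s) = 12 s^2 / (1 + s) solves B(s) = 12 s^2 / ((1 + s) (2 + s)) + 2 B(s / 2) *)
suff h : dyadic_sum n s <= 12 * `|s| ^+ 2 / (1 + `|s|).
  apply: (le_trans h); rewrite ler_pdivrMr ?ltr_pwDl//.
  by have := normr_ge0 s; move: `|s| => a; nra.
elim: n s => [|n ih] s.
  by rewrite /dyadic_sum big_ord0 divr_ge0 ?mulr_ge0 ?sqr_ge0// addr_ge0.
rewrite dyadic_sumS.
have := ih (half * s); have := omega_le_frac s.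
rewrite normrM (ger0_norm (_ : 0 <= half)) ?invr_ge0//.
have := normr_ge0 s; move: `|s| (omega s) (dyadic_sum _ _) => a o d a0 h1 h2.
apply: (le_trans (lerD h1 (ler_wpM2l (_ : 0 <= 2) h2))) => //.
rewrite le_eqVlt; apply/orP; left; apply/eqP.
have n1 : 1 + a != 0 by rewrite gt_eqF// ltr_pwDl.
have n2 : 2 + a != 0 by rewrite gt_eqF// ltr_pwDl.
by field; rewrite n1 n2.
Qed.

Lemma omega_ge (s : R) : 1 <= `|s| <= 2 -> 2^-1 <= omega s.
Proof.
move=> /andP[s1 s2].
have c : cos s <= cos 1.
  have -> : cos s = cos `|s|.
    by have [h|h] := leP 0 s; [rewrite ger0_norm|rewrite ltr0_norm// cosN].
  have pi2 := @pi_ge2 R; have [->//|ne] := eqVneq `|s| 1.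
  rewrite ltW// ltr_cos ?in_itv/=; first by rewrite lt_neqAle eq_sym ne.
    by apply/andP; split; lra.
  by apply/andP; split; lra.
have := @cos2_lt0 R; have := cosD (1 : R) 1; have := cos2Dsin2 (1 : R).
rewrite omegaE; have -> : (1 + 1 = 2 :> R) by lra.
move: c; move: (cos s) (cos 1) (sin 1) (cos 2) => a b d e h1 h2 h3 h4.
have : b ^+ 2 < 2^-1 by nra.
nra.
Qed.

Lemma dyadic_exists n (a : R) : 1 <= a < 2 ^+ n -> exists2 j : nat, (j < n)%N & 2 ^+ j <= a < 2 ^+ j.+1.
Proof.
elim: n => [|n ih] /andP[a1 an]; first by move: an; rewrite expr0 ltNge a1.
have [h|h] := leP (2 ^+ n) a; first by exists n; rewrite ?h ?an.
by have [|j jn hj] := ih _; [rewrite a1|exists j => //; exact: ltnW].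
Qed.

(** One term is enough, the one for which |s| / 2^j is between 1 and 2. *)
Lemma dyadic_sum_ge n (s : R) : 1 <= `|s| < 2 ^+ n -> `|s| <= 4 * dyadic_sum n s.
Proof.
move=> /dyadic_exists[j jn /andP[j1 j2]].
have o : 2^-1 <= omega (half ^+ j * s).
  apply: omega_ge; rewrite normrM ger0_norm ?exprn_ge0 ?invr_ge0//.
  rewrite exprVn ler_pdivlMl ?exprn_gt0// mulr1 j1/= ler_pdivrMl ?exprn_gt0//.
  by rewrite -exprSr ltW.
have : 2 ^+ j * omega (half ^+ j * s) <= dyadic_sum n s.
  rewrite /dyadic_sum (bigD1 (Ordinal jn))//= lerDl; apply: sumr_ge0 => i _.
  by apply: mulr_ge0; [exact: exprn_ge0|exact: omega_ge0].
have e0 : 0 <= (2 : R) ^+ j by rewrite exprn_ge0.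
move: j2 (ler_wpM2l e0 o); rewrite exprS; move: `|s| (2 ^+ j) (omega _) (dyadic_sum _ _) => x y z w; lra.
Qed.

Lemma measurable_omegaM (t : R) : measurable_fun [set: R] (fun s => omega (t * s)).
Proof. by apply: measurable_normc2; exact: cmeas_cisB1. Qed.

Lemma rint_omega q (t : R) : measurable_fun [set: R] q -> (forall x, 0 <= q x) ->
  rint (fun x => `|x| * q x) -> rint (fun x => omega (t * x) * q x).
Proof.
move=> mq q0 qi; apply: (@rint_le _ _ (fun x => 2 * `|t| * (`|x| * q x))).
- by apply: measurable_funM => //; exact: measurable_omegaM.
- move=> x; rewrite ger0_norm; last by rewrite mulr_ge0 ?omega_ge0.
  by rewrite mulrA ler_wpM2r// -mulrA -normrM omega_le.
- exact: rintZ.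
Qed.

(** Sum the hypothesis over t = 2^-j with weights 2^j: this compares |x| p with
    |x| q for 1 <= |x| < 2^n, and p itself dominates |x| p for |x| <= 1. *)
Lemma rint_abs_of_omega p q : rint p -> (forall x, 0 <= p x) ->
  measurable_fun [set: R] q -> (forall x, 0 <= q x) -> rint (fun x => `|x| * q x) ->
  (forall t, \int[mu]_x (omega (t * x) * p x) <= \int[mu]_x (omega (t * x) * q x)) ->
  rint (fun x => `|x| * p x).
Proof.
move=> pi p0 mq q0 qi le.
have mp := rint_meas pi.
have ip t : rint (fun x => omega (t * x) * p x).
  apply: (@rintM_bdd _ _ _ 4) => //; first exact: measurable_omegaM.
  by move=> x; rewrite ger0_norm ?omega_ge0// omega_le4.
have iq t := rint_omega t mq q0 qi.
have D (r : R -> R) n : (forall t, rint (fun x => omega (t * x) * r x)) ->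
    rint (fun x => dyadic_sum n x * r x) /\ \int[mu]_x (dyadic_sum n x * r x) =
    \sum_(j < n) 2 ^+ j * \int[mu]_x (omega (half ^+ j * x) * r x).
  move=> ir.
  have E x : dyadic_sum n x * r x = \sum_(j < n) 2 ^+ j * (omega (half ^+ j * x) * r x).
    by rewrite /dyadic_sum mulr_suml; apply: eq_bigr => j _; rewrite mulrA.
  have i1 (j : 'I_n) := rintZ (2 ^+ j) (ir (half ^+ j)).
  split; first by apply: rint_eq (rint_sum i1) => x; rewrite E.
  by rewrite (RI_eq E) (RI_sum i1); apply: eq_bigr => j _; rewrite (RIZ _ (ir _)).
pose F n x := if `|x| < 2 ^+ n then `|x| * p x else 0.
pose B := \int[mu]_x p x + 4 * (12 * \int[mu]_x (`|x| * q x)).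
have mabs : measurable_fun [set: R] (fun x : R => `|x|) by exact: measurableT_comp.
have mF n : measurable_fun [set: R] (F n).
  apply: measurable_fun_ifT => //; first exact: measurable_fun_ltr.
  exact: measurable_funM.
have [] // := @RI_fatou _ F (fun x => `|x| * p x) B mF.
- by move=> n x; rewrite /F; case: ifP => _ //; rewrite mulr_ge0.
- move=> x; apply: cvg_near_cst; exists (Num.bound `|x|) => // n /= hn.
  rewrite /F (_ : `|x| < 2 ^+ n)//; apply: (lt_le_trans (archi_boundP (normr_ge0 _))).
  apply: (@le_trans _ _ n%:R); first by rewrite ler_nat.
  by rewrite -natrX ler_nat ltnW// ltn_expl.
move=> n; have [dp ep] := D p n ip; have [dq eq] := D q n iq.
have b x : F n x <= p x + 4 * (dyadic_sum n x * p x).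
  have d0 : 0 <= dyadic_sum n x.
    by apply: sumr_ge0 => j _; apply: mulr_ge0; [exact: exprn_ge0|exact: omega_ge0].
  have pd : 0 <= 4 * (dyadic_sum n x * p x) by apply: mulr_ge0 => //; exact: mulr_ge0.
  rewrite /F; case: ifP => [xn|_]; last exact: addr_ge0.
  have [x1|x1] := leP 1 `|x|.
    have := @dyadic_sum_ge n x; rewrite x1 xn => /(_ isT) h.
    by rewrite mulrA; apply: (le_trans (ler_wpM2r (p0 x) h)); rewrite lerDr.
  apply: (@le_trans _ _ (p x)); first by apply: ler_piMl => //; exact: ltW.
  by rewrite lerDl.
have iF : rint (F n).
  apply: (rint_le (mF n) _ (rintD pi (rintZ 4 dp))) => x.
  rewrite ger0_norm; first exact: b.
  by rewrite /F; case: ifP => _ //; rewrite mulr_ge0.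
rewrite -RI_E// lee_fin.
apply: (le_trans (RI_le iF (rintD pi (rintZ 4 dp)) b)).
rewrite (RID pi (rintZ 4 dp)) (RIZ _ dp) lerD2l; apply: ler_wpM2l => //.
rewrite ep; apply: (@le_trans _ _ (\int[mu]_x (dyadic_sum n x * q x))).
  by rewrite eq; apply: ler_sum => j _; apply: ler_wpM2l; [rewrite exprn_ge0|exact: le].
rewrite -(RIZ _ qi); apply: RI_le => //; first exact: rintZ.
by move=> x; rewrite mulrA; apply: ler_wpM2r => //; exact: dyadic_sum_le.
Qed.

End Dyadic.

(** * Multiplication in the space H^(1/2) *)

Section Product.
Context {R : realType}.
Notation mu := (@lebesgue_measure R).
Notation C := R[i].
Notation ReC := (@complex.Re R).
Notation ImC := (@complex.Im R).
Implicit Types f g h u v phi a : R -> C.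

Lemma inv_fourierE phi x : inv_fourier phi x = ((2 * pi)^-1)%:C * fourier phi (- x).
Proof.
by congr (_ * _); apply: CI_eq => y; rewrite mulrN opprK [x * y]mulrC.
Qed.

(** Apply [trig_decay] to the real and imaginary parts of phi. *)
Lemma inv_fourier_decay phi : schwartz phi -> exists M, forall xi,
  normc (inv_fourier phi xi) <= M / (1 + xi ^+ 2).
Proof.
move=> [h1 h2]; have [M1 d1] := trig_decay h1; have [M2 d2] := trig_decay h2.
have i1 := rschwartz_rint h1; have i2 := rschwartz_rint h2.
exists ((2 * pi)^-1 * ((M1 + M2) + (M1 + M2))) => xi.
have pp : (0 : R) <= (2 * pi)^-1 by rewrite invr_ge0 mulr_ge0// pi_ge0.
rewrite /inv_fourier Normc.normcM normcR (ger0_norm pp) -mulrA; apply: ler_wpM2l => //.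
have [c1 s1] := d1 xi; have [c2 s2] := d2 xi.
apply: (le_trans (normc_le_ReIm _)); rewrite mulrDl; apply: lerD.
  have -> : ReC (cintegral (fun x => phi x * cis (xi * x))) =
     \int[mu]_x (ReC (phi x) * cos (xi * x)) - \int[mu]_x (ImC (phi x) * sin (xi * x)).
    rewrite -RIB; [|exact: rint_cos|exact: rint_sin].
    by apply: RI_eq => x; rewrite ReM.
  by rewrite mulrDl; apply: (le_trans (ler_normB _ _)); exact: lerD.
have -> : ImC (cintegral (fun x => phi x * cis (xi * x))) =
   \int[mu]_x (ReC (phi x) * sin (xi * x)) + \int[mu]_x (ImC (phi x) * cos (xi * x)).
  rewrite -RID; [|exact: rint_sin|exact: rint_cos].
  by apply: RI_eq => x; rewrite ImM.
by rewrite mulrDl; apply: (le_trans (ler_normD _ _)); exact: lerD.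
Qed.

Lemma cmeas_riesz : cmeas (riesz_symbol : R -> C).
Proof.
split => /=; first exact: measurable_cst.
rewrite (_ : (fun x => _) = (fun x : R => if 0 < x then 1 else if x < 0 then - 1 else 0)).
  apply: measurable_fun_ifT => //; first exact: measurable_fun_ltr.
  by apply: measurable_fun_ifT => //; exact: measurable_fun_ltr.
apply/funext => x; case: ifP => [x0|x0].
  by rewrite gtr0_norm// divff// gt_eqF.
case: ifP => [x1|x1]; first by rewrite ltr0_norm// invrN mulrN divff// lt_eqF.
have -> : x = 0 by apply/eqP; rewrite eq_le !leNgt x0 x1.
by rewrite mul0r.
Qed.

Lemma normc_riesz (x : R) : normc (riesz_symbol x) <= 1.
Proof.
apply: (le_trans (normc_le_ReIm _)); rewrite /= normr0 add0r normrM normfV normr_id.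
have [->|x0] := eqVneq x 0; first by rewrite normr0 mul0r.
by rewrite divff// normr_eq0.
Qed.

(** The Riesz symbol is discontinuous, so that a is not a Schwartz function; it still
    has the decay of the transform of phi. *)
Lemma riesz_inv_fourier phi : schwartz phi ->
  let a xi := riesz_symbol xi * inv_fourier phi xi in
  [/\ cintegrable a, L2 a & rint (fun xi => `|xi| * normc (a xi) ^+ 2)].
Proof.
move=> sp a; have [M hM] := inv_fourier_decay sp.
have ip := schwartz_cint sp.
have mi : cmeas (inv_fourier phi).
  rewrite (funext (inv_fourierE phi)); apply: cmeasM; first exact: cmeas_cst.
  exact: (cmeas_comp (fourier_cmeas ip) measurable_opp).
have ma : cmeas a by apply: cmeasM => //; exact: cmeas_riesz.
have p1 (x : R) : 1 <= 1 + x ^+ 2 by rewrite lerDl sqr_ge0.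
have p0 (x : R) : 0 < 1 + x ^+ 2 by apply: lt_le_trans (p1 x).
have aM x : normc (a x) <= M / (1 + x ^+ 2).
  rewrite /a Normc.normcM; apply: le_trans (hM x).
  by apply: ler_piMl; [exact: normc_ge0|exact: normc_riesz].
have M0 : 0 <= M by have := le_trans (normc_ge0 _) (aM 0); rewrite expr0n/= addr0 divr1.
have key (x : R) : `|x| * normc (a x) ^+ 2 <= M ^+ 2 / (1 + x ^+ 2) /\
    normc (a x) ^+ 2 <= M ^+ 2 / (1 + x ^+ 2).
  have h : normc (a x) ^+ 2 <= M ^+ 2 * ((1 + x ^+ 2)^-1 ^+ 2).
    rewrite -exprMn lerXn2r ?nnegrE ?normc_ge0//.
    by rewrite divr_ge0// ltW.
  have i0 : 0 <= (1 + x ^+ 2)^-1 by rewrite invr_ge0 ltW.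
  have i1 : (1 + x ^+ 2)^-1 <= 1 by rewrite invf_le1.
  have M2 := sqr_ge0 M.
  split.
    apply: (le_trans (ler_wpM2l (normr_ge0 x) h)); rewrite mulrCA; apply: ler_wpM2l => //.
    rewrite expr2 mulrA ler_piMl//.
    rewrite ler_pdivrMr// mul1r -(real_normK (num_real x)).
    by have := normr_ge0 x; move: `|x| => y; nra.
  apply: (le_trans h); apply: ler_wpM2l => //.
  by rewrite expr2 ler_piMl.
have iM := rintZ (M ^+ 2) (@rint_invD1sqr R).
split.
- by apply: (cint_le ma aM); apply: rintZ; exact: rint_invD1sqr.
- by apply: (L2_le ma _ iM) => x; case: (key x).
- apply: (rint_le _ _ iM).
    apply: measurable_funM; last exact: measurable_normc2.
    exact: (@measurableT_comp _ _ _ _ _ _ (@Num.norm R R) _ id).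
  move=> x; rewrite ger0_norm; first by case: (key x).
  by rewrite mulr_ge0// sqr_ge0.
Qed.

Lemma normc_mincr (t : R) g xi : normc (mincr t g xi) ^+ 2 = omega (t * xi) * normc (g xi) ^+ 2.
Proof. by rewrite /mincr Normc.normcM exprMn. Qed.

Lemma L2_mincr_homogeneous (t : R) g : cmeas g -> rint (fun xi => `|xi| * normc (g xi) ^+ 2) ->
  L2 (mincr t g).
Proof.
move=> mg ig; apply/L2P; split; first by apply: cmeasM => //; exact: cmeas_cisB1.
have := @rint_omega _ (fun xi => normc (g xi) ^+ 2) t (measurable_normc2 mg) (fun _ => sqr_ge0 _) ig.
by apply: rint_eq => x; rewrite normc_mincr.
Qed.

Lemma omegaN (s : R) : omega (- s) = omega s.
Proof. by rewrite !omegaE cosN. Qed.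

(** The function u itself need not be in L^2, only its increments are. *)
Lemma plancherel_incr (t : R) u g : tame u -> is_fourier u g ->
  rint (fun xi => `|xi| * normc (g xi) ^+ 2) ->
  L2 (incr t u) /\
  \int[mu]_xi (omega (t * xi) * normc (g xi) ^+ 2) =
    2 * pi * \int[mu]_x (normc (incr t u x) ^+ 2).
Proof.
move=> tu fu ig; have mg : cmeas g by case: fu.
have [l e] := plancherel (tame_incr t tu) (L2_mincr_homogeneous t mg ig)
  (fpair_incr_is_fourier t tu fu).
by split => //; rewrite -e; apply: RI_eq => x; rewrite normc_mincr.
Qed.

(** The increment of the transform of a is the transform of a multiple of a. *)
Lemma bessel_incr (t : R) a : cintegrable a -> L2 a ->
  L2 (incr t (fourier a)) /\
  \int[mu]_x (normc (incr t (fourier a) x) ^+ 2) <=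
    2 * pi * \int[mu]_xi (omega (t * xi) * normc (a xi) ^+ 2).
Proof.
move=> ia la.
have ib : cintegrable (mincr (- t) a).
  apply: (@cintM_bdd _ _ _ 2) => //; first exact: cmeas_cisB1.
  by move=> x; exact: normc_cisB1_le2.
have E x : incr t (fourier a) x = fourier (mincr (- t) a) x.
  rewrite /incr /fourier -CIB; [|exact: cint_fourier..].
  apply: CI_eq => y; cbv beta; rewrite /mincr.
  have -> : cis (- (y * (x + t))) = cis (- t * y) * cis (- (y * x)).
    by rewrite -cisD; congr cis; ring.
  move: (a y) (cis (- t * y)) (cis (- (y * x))) => p q r.
  by rewrite mulrBl mul1r mulrBl mulrA [p * q]mulrC.
have [i e] := bessel ib (L2_rint (L2_mincr (- t) la)).
split.
  apply/L2P; split; first exact: cmeas_incr (fourier_cmeas ia).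
  by apply: rint_eq i => x; rewrite E.
under RI_eq do rewrite E.
apply: (le_trans e); rewrite le_eqVlt; apply/orP; left; apply/eqP; congr (_ * _).
by apply: RI_eq => x; rewrite normc_mincr mulNr omegaN.
Qed.

(** Write F for the transform of a. The increment of u F at x is
    (D_t u)(x) F(x + t) + u(x) (D_t F)(x), with u and F bounded. In squared L^2 norm,
    these increments are integrals against the weights omega(t xi), and
    [rint_abs_of_omega] passes to the weight |xi|. *)
Lemma rint_abs_fhat_mul u g a : cmeas u -> (forall x, normc (u x) <= 1) -> is_fourier u g ->
  rint (fun xi => `|xi| * normc (g xi) ^+ 2) ->
  cintegrable a -> L2 a -> rint (fun xi => `|xi| * normc (a xi) ^+ 2) ->
  L2 (fun x => u x * fourier a x) /\
  rint (fun xi => `|xi| * normc (fhat (fun x => u x * fourier a x) xi) ^+ 2).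
Proof.
move=> mu1 u1 fu ig ia la ia2.
have tu : tame u := bounded_tame mu1 u1.
have mg : cmeas g by case: fu.
have [iF _] := bessel ia (L2_rint la).
have mF := fourier_cmeas ia.
have lF : L2 (fourier a) by apply/L2P.
pose v x := u x * fourier a x.
have lv : L2 v by apply: (L2M_bdd mu1 u1).
have [fv lh vh] := fhat_L2 lv.
split => //.
set M := \int[mu]_x normc (a x).
have M0 : 0 <= M by apply: RI_ge0 => x; exact: normc_ge0.
pose q xi := 2 * M ^+ 2 * normc (g xi) ^+ 2 + 8 * pi ^+ 2 * normc (a xi) ^+ 2.
have pi0 : (0 : R) <= pi by exact: pi_ge0.
have c1 : 0 <= 2 * M ^+ 2 by rewrite mulr_ge0// sqr_ge0.
have c2 : 0 <= 8 * pi ^+ 2 :> R by rewrite mulr_ge0// sqr_ge0.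
have ma := cint_cmeas ia.
apply: (@rint_abs_of_omega _ (fun xi => normc (fhat v xi) ^+ 2) q).
- exact: L2_rint lh.
- by move=> x; exact: sqr_ge0.
- by apply: measurable_funD; apply: measurable_funM => //; exact: measurable_normc2.
- by move=> x; rewrite /q; apply: addr_ge0; apply: mulr_ge0 => //; exact: sqr_ge0.
- apply: rint_eq (rintD (rintZ (2 * M ^+ 2) ig) (rintZ (8 * pi ^+ 2) ia2)) => x.
  by rewrite /q mulrDr; congr (_ + _); rewrite mulrCA.
move=> t.
have [_ e1] := plancherel (tame_incr t (L2_tame lv)) (L2_mincr t lh) (fpair_incr t lv lh vh).
have [lu e2] := plancherel_incr t tu fu ig.
have [lp e3] := bessel_incr t ia la.
have iog := @rint_omega _ (fun xi => normc (g xi) ^+ 2) t (measurable_normc2 mg) (fun _ => sqr_ge0 _) ig.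
have ioa := @rint_omega _ (fun xi => normc (a xi) ^+ 2) t (measurable_normc2 ma) (fun _ => sqr_ge0 _) ia2.
rewrite -(RI_eq (normc_mincr t (fhat v))) e1.
have -> : \int[mu]_x (omega (t * x) * q x) =
    2 * M ^+ 2 * \int[mu]_x (omega (t * x) * normc (g x) ^+ 2) +
    8 * pi ^+ 2 * \int[mu]_x (omega (t * x) * normc (a x) ^+ 2).
  rewrite -(RIZ _ iog) -(RIZ _ ioa) -(RID (rintZ _ iog) (rintZ _ ioa)).
  by apply: RI_eq => x; rewrite /q mulrDr; congr (_ + _); rewrite mulrCA.
have i1 := rintZ (2 * M ^+ 2) (L2_rint lu); have i2 := rintZ 2 (L2_rint lp).
have b : \int[mu]_x (normc (incr t v x) ^+ 2) <=
    2 * M ^+ 2 * \int[mu]_x (normc (incr t u x) ^+ 2) +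
    2 * \int[mu]_x (normc (incr t (fourier a) x) ^+ 2).
  rewrite -(RIZ _ (L2_rint lu)) -(RIZ _ (L2_rint lp)) -(RID i1 i2).
  apply: RI_le; [exact: L2_rint (L2_incr t lv)|exact: rintD|].
  move=> x.
  have -> : incr t v x = incr t u x * fourier a (x + t) + u x * incr t (fourier a) x.
    by rewrite /incr /v; ring.
  apply: (le_trans (sqr_normcD_le _ _)); rewrite !Normc.normcM !exprMn; apply: lerD.
    rewrite -[leRHS]mulrA; apply: ler_wpM2l => //; rewrite mulrC; apply: ler_wpM2r; first exact: sqr_ge0.
    by rewrite lerXn2r ?nnegrE ?normc_ge0//; exact: fourier_le.
  apply: ler_wpM2l => //; apply: ler_piMl; first exact: sqr_ge0.
  by rewrite exprn_ile1 ?normc_ge0.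
rewrite e2.
have pp : (0 : R) <= 2 * pi by rewrite mulr_ge0.
apply: (le_trans (ler_wpM2l pp b)); rewrite mulrDr; apply: lerD.
  by rewrite mulrCA.
apply: (le_trans (ler_wpM2l pp (ler_wpM2l (_ : 0 <= 2) e3))) => //.
rewrite le_eqVlt; apply/orP; left; apply/eqP.
by rewrite !mulrA; congr (_ * _); ring.
Qed.

End Product.

(** * Difference quotients on the Fourier side *)

Section Limit.
Context {R : realType}.
Notation mu := (@lebesgue_measure R).
Notation C := R[i].
Notation ReC := (@complex.Re R).
Notation ImC := (@complex.Im R).
Implicit Types f g h u v phi a : R -> C.

Lemma normr_cosB1_le (s : R) : `|cos s - 1| <= `|s|.
Proof.
have := omega_le s; have := omega_ge0 s; rewrite omegaE => h1 h2.
have -> : cos s - 1 = - (2^-1 * (2 - 2 * cos s)) by field.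
by rewrite normrN ger0_norm; lra.
Qed.

Lemma normr_cosB1_le_sqr (s : R) : `|cos s - 1| <= s ^+ 2.
Proof.
have := omega_le_sqr s; have := omega_ge0 s; rewrite omegaE => h1 h2.
have -> : cos s - 1 = - (2^-1 * (2 - 2 * cos s)) by field.
have := sqr_ge0 s.
by rewrite normrN ger0_norm; lra.
Qed.

Lemma normr_sinB_le (s : R) : `|sin s - s| <= s ^+ 2.
Proof.
wlog s0 : s / 0 <= s => [H|].
  have [/H//|/ltW s0] := leP 0 s.
  have := H (- s); rewrite oppr_ge0 => /(_ s0).
  by rewrite sinN -opprD normrN sqrrN.
pose f (x : R) := sin x - x.
have df (x : R) : is_derive x 1 f (cos x - 1) by apply: is_deriveB.
have cf : {within `[0, s], continuous f}.
  by apply: continuous_subspaceT; exact: is_derive_continuous df.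
have [c] := MVT_segment s0 (fun y _ => df y) cf.
rewrite in_itv /= => /andP[c0 cs].
rewrite /f sin0 !subr0 => ->.
rewrite normrM (ger0_norm s0) expr2; apply: ler_wpM2r => //.
by apply: le_trans (normr_cosB1_le c) _; rewrite ger0_norm.
Qed.

Lemma normc_cis_taylor (s : R) : normc (cis s - 1 - grad_symbol s) <= 2 * s ^+ 2.
Proof.
apply: (le_trans (normc_le_ReIm _)).
have -> : ReC (cis s - 1 - grad_symbol s) = cos s - 1.
  by rewrite ReD ReN ReD ReN /= subr0.
have -> : ImC (cis s - 1 - grad_symbol s) = sin s - s.
  by rewrite ImD ImN ImD ImN /= subr0.
rewrite mulrDl mul1r; apply: lerD; first exact: normr_cosB1_le_sqr.
exact: normr_sinB_le.
Qed.

Lemma normc_difference_quotient (n : nat) (x : R) :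
  normc (n.+1%:R%:C * (cis (n.+1%:R^-1 * x) - 1) - grad_symbol x) <= 2 * x ^+ 2 / n.+1%:R.
Proof.
have n0 : (0 : R) < n.+1%:R by rewrite ltr0n.
have -> : grad_symbol x = n.+1%:R%:C * grad_symbol (n.+1%:R^-1 * x).
  apply: complexP; rewrite ?ReM ?ImM /= !mul0r ?mulr0 ?subr0 ?addr0 //.
  by rewrite mulrA divff ?mul1r// gt_eqF.
rewrite -mulrBr Normc.normcM normcR ger0_norm; last exact: ltW.
apply: (le_trans (ler_wpM2l (ltW n0) (normc_cis_taylor _))).
rewrite le_eqVlt; apply/orP; left; apply/eqP; field.
by rewrite gt_eqF.
Qed.

Lemma cvg_normc (z : nat -> C) (l : C) (M : R) :
  (forall n, normc (z n - l) <= M / n.+1%:R) ->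
  ReC (z n) @[n --> \oo] --> ReC l /\ ImC (z n) @[n --> \oo] --> ImC l.
Proof.
move=> H; split; rewrite -subr_cvg0; apply: (@cvg_invn_bound _ _ M) => n /=;
  apply: le_trans (H n).
  by apply: le_trans (normc_Re _); rewrite ReD ReN.
by apply: le_trans (normc_Im _); rewrite ImD ImN.
Qed.

End Limit.

Section Limit2.
Context {R : realType}.
Notation mu := (@lebesgue_measure R).
Notation C := R[i].
Notation ReC := (@complex.Re R).
Notation ImC := (@complex.Im R).
Implicit Types f g h u v phi a : R -> C.

Lemma normc_cisB1_le (s : R) : normc (cis s - 1) <= `|s|.
Proof.
rewrite -(@ler_pXn2r _ 2)// ?nnegrE ?normc_ge0//.
by rewrite real_normK ?num_real//; exact: omega_le_sqr.
Qed.

(** The quotient n (e^(i xi / n) - 1) tends to i xi and is bounded by |xi|, which gives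
    the majorant |xi| (|g|^2 + |h|^2). *)
Lemma cvg_difference_quotient g h : cmeas g -> cmeas h ->
  rint (fun xi => `|xi| * normc (g xi) ^+ 2) ->
  rint (fun xi => `|xi| * normc (h xi) ^+ 2) ->
  let D n := cintegral (fun xi => n.+1%:R%:C * (mincr n.+1%:R^-1 g xi * h xi)) in
  let l := cintegral (fun xi => grad_symbol xi * g xi * h xi) in
  ReC (D n) @[n --> \oo] --> ReC l /\ ImC (D n) @[n --> \oo] --> ImC l.
Proof.
move=> mg mh ig ih D l.
pose F (n : nat) xi := n.+1%:R%:C * (mincr n.+1%:R^-1 g xi * h xi).
pose d xi := `|xi| * normc (g xi) ^+ 2 + `|xi| * normc (h xi) ^+ 2.
have FE n xi : F n xi = (n.+1%:R%:C * (cis (n.+1%:R^-1 * xi) - 1)) * (g xi * h xi).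
  by rewrite /F /mincr; rewrite -mulrA -[in RHS]mulrA.
have P xi : ReC (F n xi) @[n --> \oo] --> ReC (grad_symbol xi * g xi * h xi) /\
    ImC (F n xi) @[n --> \oo] --> ImC (grad_symbol xi * g xi * h xi).
  apply: (@cvg_normc _ _ _ (2 * xi ^+ 2 * normc (g xi * h xi))) => n.
  rewrite FE -[grad_symbol xi * g xi * h xi]mulrA -mulrBl Normc.normcM.
  rewrite -[leRHS]mulrAC; apply: ler_wpM2r; first exact: normc_ge0.
  exact: normc_difference_quotient.
have id : rint d := rintD ig ih.
have mF n : cmeas (F n).
  apply: cmeasM; first exact: cmeas_cst.
  apply: cmeasM => //; apply: cmeasM => //; exact: cmeas_cisB1.
have dF n xi : normc (F n xi) <= d xi.
  have n0 : (0 : R) < n.+1%:R by rewrite ltr0n.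
  have h1 : normc (n.+1%:R%:C * (cis (n.+1%:R^-1 * xi) - 1)) <= `|xi|.
    rewrite Normc.normcM normcR ger0_norm; last exact: ltW.
    apply: (le_trans (ler_wpM2l (ltW n0) (normc_cisB1_le _))).
    by rewrite normrM ger0_norm ?invr_ge0 ?(ltW n0)// mulrA divff ?mul1r// gt_eqF.
  rewrite FE Normc.normcM.
  apply: (le_trans (ler_wpM2r (normc_ge0 _) h1)); rewrite /d -mulrDr.
  apply: ler_wpM2l; first exact: normr_ge0.
  rewrite Normc.normcM.
  by move: (normc (g xi)) (normc (h xi)) => p q; nra.
by have [_ c1 c2] := CI_dct mF (fun x => (P x).1) (fun x => (P x).2) id dF.
Qed.

(** Since omega(s) is at most s^2 and at most 2 |s|, the integrand tends to 0 and is
    bounded by 2 |xi| q. *)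
Lemma cvg_omega_quotient (q : R -> R) : measurable_fun [set: R] q -> (forall x, 0 <= q x) ->
  rint (fun xi => `|xi| * q xi) ->
  n.+1%:R * \int[mu]_xi (omega (n.+1%:R^-1 * xi) * q xi) @[n --> \oo] --> (0 : R).
Proof.
move=> mq q0 iq.
pose F (n : nat) xi := n.+1%:R * (omega (n.+1%:R^-1 * xi) * q xi).
have FI n : n.+1%:R * \int[mu]_xi (omega (n.+1%:R^-1 * xi) * q xi) = \int[mu]_xi F n xi.
  by rewrite -RIZ//; exact: rint_omega.
rewrite (funext FI).
have mF n : measurable_fun [set: R] (F n).
  apply: measurable_funM => //.
  by apply: measurable_funM => //; exact: measurable_omegaM.
have n0 n : (0 : R) < n.+1%:R by rewrite ltr0n.
have F0 n x : 0 <= F n x by apply: mulr_ge0 => //; apply: mulr_ge0 => //; exact: omega_ge0.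
have cF x : F n x @[n --> \oo] --> 0.
  apply: (@cvg_invn_bound _ _ (x ^+ 2 * q x)) => n; rewrite ger0_norm//.
  rewrite /F [leLHS]mulrA [leRHS]mulrAC; apply: ler_wpM2r => //.
  apply: (le_trans (ler_wpM2l (ltW (n0 n)) (omega_le_sqr _))).
  rewrite le_eqVlt; apply/orP; left; apply/eqP; field; by rewrite gt_eqF.
have dF n x : `|F n x| <= 2 * (`|x| * q x).
  rewrite ger0_norm// /F [leLHS]mulrA [leRHS]mulrA; apply: ler_wpM2r => //.
  apply: (le_trans (ler_wpM2l (ltW (n0 n)) (omega_le _))).
  rewrite normrM ger0_norm ?invr_ge0 ?(ltW (n0 n))//.
  rewrite le_eqVlt; apply/orP; left; apply/eqP; field; by rewrite gt_eqF.
have [_] := RI_dct mF cF (rintZ 2 iq) dF.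
by rewrite RI0.
Qed.

End Limit2.

(** * Cancellation on the sphere *)

Section Sphere.
Context {R : realType}.
Notation mu := (@lebesgue_measure R).
Notation C := R[i].
Notation ReC := (@complex.Re R).
Notation ImC := (@complex.Im R).
Implicit Types f g h u v phi a : R -> C.

Lemma ReC_sum n (F : 'I_n -> C) : ReC (\sum_k F k) = \sum_k ReC (F k).
Proof. by elim/big_ind2 : _ => // x1 x2 y1 y2 <- <-; rewrite ReD. Qed.

Lemma ImC_sum n (F : 'I_n -> C) : ImC (\sum_k F k) = \sum_k ImC (F k).
Proof. by elim/big_ind2 : _ => // x1 x2 y1 y2 <- <-; rewrite ImD. Qed.

Lemma CI_sum n (F : 'I_n -> R -> C) : (forall k, cintegrable (F k)) ->
  cintegral (fun x => \sum_k F k x) = \sum_k cintegral (F k).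
Proof.
move=> iF; apply: complexP.
  rewrite ReC_sum /= -(RI_sum (fun k => (iF k).1)).
  by apply: RI_eq => x; rewrite ReC_sum.
rewrite ImC_sum /= -(RI_sum (fun k => (iF k).2)).
by apply: RI_eq => x; rewrite ImC_sum.
Qed.

(** Expand |q|^2 = |p|^2 + 2 (q - p) . p + |q - p|^2. *)
Lemma sphere_polarization m (p q : 'I_m -> R) :
  \sum_k p k ^+ 2 = 1 -> \sum_k q k ^+ 2 = 1 ->
  \sum_k (q k - p k) * p k = - 2^-1 * \sum_k (q k - p k) ^+ 2.
Proof.
move=> hp hq.
have -> : \sum_k (q k - p k) ^+ 2 =
    \sum_k q k ^+ 2 + (- 2 * \sum_k (q k - p k) * p k - \sum_k p k ^+ 2).
  rewrite mulr_sumr -sumrB -big_split /=; apply: eq_bigr => k _; ring.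
by rewrite hp hq; field.
Qed.

Lemma cvg_sumR m (s : 'I_m -> nat -> R) (l : 'I_m -> R) :
  (forall k, s k n @[n --> \oo] --> l k) ->
  \sum_k s k n @[n --> \oo] --> \sum_k l k.
Proof.
elim: m s l => [|m IH] s l H.
  by rewrite big_ord0; under eq_fun do rewrite big_ord0; exact: cvg_cst.
rewrite big_ord_recl; under eq_fun do rewrite big_ord_recl.
by apply: cvgD; [exact: H|apply: IH => k; exact: H].
Qed.

Section Cancel.
Variables (m : nat) (w : 'I_m -> R -> R) (g : 'I_m -> R -> C) (a : R -> C).
Let W k x : C := (w k x)%:C.
Hypothesis w1 : forall x, \sum_k (w k x) ^+ 2 = 1.
Hypothesis mw : forall k, cmeas (W k).
Hypothesis fw : forall k, is_fourier (W k) (g k).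
Hypothesis ig : forall k, rint (fun xi => `|xi| * normc (g k xi) ^+ 2).
Hypotheses (ia : cintegrable a) (la : L2 a) (ia2 : rint (fun xi => `|xi| * normc (a xi) ^+ 2)).

Let v k x := W k x * fourier a x.
Let h k xi := fhat (v k) (- xi).
Let M := \int[mu]_x normc (a x).

Let W_le1 k x : normc (W k x) <= 1.
Proof.
rewrite normcR -(@ler_pXn2r _ 2)// ?nnegrE ?normr_ge0//.
rewrite real_normK ?num_real// expr1n -(w1 x) (bigD1 k)//= lerDl.
by apply: sumr_ge0 => j _; exact: sqr_ge0.
Qed.

Let tW k : tame (W k). Proof. exact: bounded_tame (mw k) (W_le1 k). Qed.

Let mg k : cmeas (g k). Proof. by case: (fw k). Qed.

Let lv k : L2 (v k).
Proof. by have [] := rint_abs_fhat_mul (mw k) (W_le1 k) (fw k) (ig k) ia la ia2. Qed.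

Let lh k : L2 (fhat (v k)). Proof. by have [] := fhat_L2 (lv k). Qed.

Let ih k : rint (fun xi => `|xi| * normc (h k xi) ^+ 2).
Proof.
have [_ i] := rint_abs_fhat_mul (mw k) (W_le1 k) (fw k) (ig k) ia la ia2.
by have [+ _] := RI_opp i; apply: rint_eq => x; rewrite normrN.
Qed.

Let mh k : cmeas (h k).
Proof. exact: (cmeas_comp (L2_cmeas (lh k)) measurable_opp). Qed.

Let D n := \sum_k cintegral (fun xi => n.+1%:R%:C * (mincr n.+1%:R^-1 (g k) xi * h k xi)).

Let incrW t k x : incr t (W k) x = (w k (x + t) - w k x)%:C.
Proof. by rewrite /incr /W rmorphB. Qed.

Let lo t k : L2 (incr t (W k)).
Proof. by have [] := plancherel_incr t (tW k) (fw k) (ig k). Qed.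

(** Parseval's identity in each component; the sum over the components is the scalar
    product of the increment of w with w, computed on the sphere. *)
Let pairing_incr t : \sum_k cintegral (fun xi => mincr t (g k) xi * h k xi) =
  (2 * pi)%:C * cintegral (fun x => (- 2^-1 * \sum_k (w k (x + t) - w k x) ^+ 2)%:C * fourier a x).
Proof.
have E k : cintegral (fun xi => mincr t (g k) xi * h k xi) =
    (2 * pi)%:C * cintegral (fun x => incr t (W k) x * v k x).
  have [_ lhk vh] := fhat_L2 (lv k).
  rewrite (parseval_mul (lo t k) (lv k) (L2_mincr_homogeneous t (mg k) (ig k)) lhk _ vh) //.
  exact: fpair_incr_is_fourier.
rewrite (eq_bigr _ (fun k _ => E k)) -mulr_sumr; congr (_ * _).
rewrite -CI_sum; last by move=> k; exact: L2M_cint.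
apply: CI_eq => x; rewrite -(sphere_polarization (w1 x) (w1 (x + t))).
rewrite rmorph_sum mulr_suml; apply: eq_bigr => k _.
by rewrite incrW /v /W rmorphM mulrA.
Qed.

Let D_le n : normc (D n) <= 2^-1 * M *
  \sum_k n.+1%:R * \int[mu]_xi (omega (n.+1%:R^-1 * xi) * normc (g k xi) ^+ 2).
Proof.
set t := n.+1%:R^-1.
have ni k : rint (fun x => (w k (x + t) - w k x) ^+ 2).
  apply: rint_eq (L2_rint (lo t k)) => x.
  by rewrite incrW normcR real_normK ?num_real.
have E : D n = n.+1%:R%:C * ((2 * pi)%:C *
    cintegral (fun x => (- 2^-1 * \sum_k (w k (x + t) - w k x) ^+ 2)%:C * fourier a x)).
  rewrite -pairing_incr mulr_sumr; apply: eq_bigr => k _.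
  rewrite CIZ //; apply: L2M_cint; first exact: L2_mincr_homogeneous.
  exact: L2_opp.
have pi0 : (0 : R) <= pi by exact: pi_ge0.
have M0 : 0 <= M by apply: RI_ge0 => x; exact: normc_ge0.
have n0 : (0 : R) <= n.+1%:R by [].
have S k : \int[mu]_xi (omega (t * xi) * normc (g k xi) ^+ 2) =
    2 * pi * \int[mu]_x (w k (x + t) - w k x) ^+ 2.
  have [_ ->] := plancherel_incr t (tW k) (fw k) (ig k); congr (_ * _).
  by apply: RI_eq => x; rewrite incrW normcR real_normK ?num_real.
rewrite (eq_bigr _ (fun k _ => congr1 _ (S k))) E !Normc.normcM !normcR.
rewrite !ger0_norm ?mulr_ge0//.
have -> : 2^-1 * M * \sum_k n.+1%:R * (2 * pi * \int[mu]_x (w k (x + t) - w k x) ^+ 2) =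
    n.+1%:R * (2 * pi * (2^-1 * M * \sum_k \int[mu]_x (w k (x + t) - w k x) ^+ 2)).
  rewrite !mulr_sumr; apply: eq_bigr => k _.
  by move: (\int[mu]_x _) M n.+1%:R => x y z; ring.
apply: ler_wpM2l => //; apply: ler_wpM2l; first exact: mulr_ge0.
rewrite -(RI_sum ni) -(RIZ _ (rint_sum ni)).
apply: CI_normc_le.
- apply: cmeasM; last exact: fourier_cmeas.
  apply: cmeas_real; apply: measurable_funM => //.
  exact: rint_meas (rint_sum ni).
- exact: rintZ (rint_sum ni).
have s0 x : 0 <= \sum_k (w k (x + t) - w k x) ^+ 2.
  by apply: sumr_ge0 => k _; exact: sqr_ge0.
have h0 : (0 : R) <= 2^-1 by rewrite invr_ge0.
move=> x; rewrite Normc.normcM normcR normrM normrN (ger0_norm (s0 x)) (ger0_norm h0).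
rewrite [leRHS]mulrAC; apply: ler_wpM2l; last exact: fourier_le.
exact: mulr_ge0.
Qed.

Let cvg_D : normc (D n) @[n --> \oo] --> (0 : R).
Proof.
apply: (@cvg0_le _ _ (fun n => 2^-1 * M *
  \sum_k n.+1%:R * \int[mu]_xi (omega (n.+1%:R^-1 * xi) * normc (g k xi) ^+ 2))).
  by move=> n; rewrite ger0_norm ?normc_ge0//; exact: D_le.
rewrite -[X in _ --> X](mulr0 (2^-1 * M)); apply: cvgM; first exact: cvg_cst.
rewrite -[X in _ --> X](_ : \sum_(k < m) (0 : R) = 0); last by rewrite big1.
apply: cvg_sumR => k; apply: cvg_omega_quotient => //.
- exact: measurable_normc2.
- by move=> x; exact: sqr_ge0.
Qed.

(** The sums D n converge to this sum by [cvg_difference_quotient], and to 0. *)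
Lemma sphere_cancel :
  \sum_k cintegral (fun xi => grad_symbol xi * g k xi * h k xi) = 0.
Proof.
have L k := cvg_difference_quotient (mg k) (mh k) (ig k) (ih k).
have z (F : nat -> R) (l : R) : F n @[n --> \oo] --> l -> (forall n, `|F n| <= normc (D n)) -> l = 0.
  move=> c b; have c0 := cvg0_le b cvg_D.
  exact: cvg_unique c c0.
apply: complexP => /=.
  rewrite ReC_sum; apply: (z _ _ (cvg_sumR (fun k => (L k).1))) => n.
  by rewrite -ReC_sum; exact: normc_Re.
rewrite ImC_sum; apply: (z _ _ (cvg_sumR (fun k => (L k).2))) => n.
by rewrite -ImC_sum; exact: normc_Im.
Qed.

End Cancel.
End Sphere.

(** * The Riesz transform of u . grad u *)

Section Final.
Context {R : realType}.
Notation mu := (@lebesgue_measure R).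
Notation C := R[i].
Notation ReC := (@complex.Re R).
Notation ImC := (@complex.Im R).
Implicit Types f g h u v phi a : R -> C.

Lemma tempered_ae v v' : cmeas v' -> {ae mu, forall x, v x = v' x} ->
  tempered v -> tempered v'.
Proof.
move=> mv' e [mv [N iN]]; split => //; exists N.
have mw : measurable_fun [set: R] (fun x : R => ((1 + `|x|) ^+ N)^-1).
  apply: continuous_measurable_fun => x; apply: cvgV.
    by rewrite expf_eq0 andbC gt_eqF// ltr_wpDr.
  have c : (1 + `|y|) @[y --> x] --> 1 + `|x|.
    by apply: cvgD; [exact: cvg_cst|exact: cvg_norm].
  exact: (cvg_comp _ _ c (@exprn_continuous _ N _)).
rewrite (_ : (\int[mu]_x _)%E = \int[mu]_x (normc (v x) / (1 + `|x|) ^+ N)%:E)%E //.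
apply: ae_eq_integral => //.
- by apply/measurable_EFinP; apply: measurable_funM => //; exact: measurable_normc.
- by apply/measurable_EFinP; apply: measurable_funM => //; exact: measurable_normc.
by apply: aeS e => x /= -> _.
Qed.

Lemma is_fourier_ae v v' g : cmeas v' -> {ae mu, forall x, v x = v' x} ->
  is_fourier v g -> is_fourier v' g.
Proof.
move=> mv' e [tv mg H]; split => //; first exact: tempered_ae e tv.
move=> phi sp p0; have [i <-] := H phi sp p0; split => //.
have mF := fourier_cmeas (schwartz_cint sp).
apply: CI_ae_eq; [exact: cmeasM|by apply: cmeasM => //; case: tv|].
by apply: aeS e => x /= ->.
Qed.

(** Functions that agree almost everywhere have the same Fourier transforms, so the
    choice made by [fhat] is the same. *)
Lemma fhat_ae v v' : cmeas v -> cmeas v' -> {ae mu, forall x, v x = v' x} ->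
  fhat v = fhat v'.
Proof.
move=> mv mv' e; rewrite /fhat; congr xget; apply/funext => g; apply/propext; split.
  exact: is_fourier_ae.
by apply: is_fourier_ae => //; apply: aeS e => x ->.
Qed.

Lemma dotHhalf_rint v : dotHhalf v -> is_fourier v (fhat v) /\
  rint (fun xi => `|xi| * normc (fhat v xi) ^+ 2).
Proof.
move=> [fv /L2P[_ iv]]; split => //; apply: rint_eq iv => x.
rewrite Normc.normcM exprMn /half_power normcR ger0_norm ?sqrtr_ge0//.
by rewrite sqr_sqrtr.
Qed.

(** On the null set where u leaves the sphere, replace it by the first basis vector. *)
Lemma sphere_everywhere m (u : 'I_m.+1 -> R -> R) :
  (forall k, measurable_fun [set: R] (u k)) ->
  {ae mu, forall x, \sum_k (u k x) ^+ 2 = 1} ->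
  exists w : 'I_m.+1 -> R -> R,
  [/\ forall k, measurable_fun [set: R] (w k), forall x, \sum_k (w k x) ^+ 2 = 1 &
      forall k, {ae mu, forall x, u k x = w k x}].
Proof.
move=> mu_ e.
exists (fun k x => if \sum_k (u k x) ^+ 2 == 1 then u k x else (k == ord0)%:R); split.
- move=> k; apply: measurable_fun_ifT => //.
  apply: measurable_fun_eqr => //; apply: measurable_sum => j.
  exact: measurable_funX.
- move=> x /=; have [//|_] := eqVneq (\sum_k u k x ^+ 2) 1.
  rewrite (bigD1 ord0)//= expr1n big1 ?addr0// => j /negbTE ->.
  by rewrite expr0n.
- by move=> k; apply: aeS e => x ->; rewrite eqxx.
Qed.

(** Correct u on a null set and apply [sphere_cancel]. *)
Lemma sphere_grad_eq0 m (u : 'I_m.+1 -> R -> R) a :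
  (forall k, dotHhalf (fun x => (u k x)%:C)) ->
  {ae mu, forall x, \sum_k (u k x) ^+ 2 = 1} ->
  cintegrable a -> L2 a -> rint (fun xi => `|xi| * normc (a xi) ^+ 2) ->
  \sum_k pairing (fun xi => grad_symbol xi * fhat (fun x => (u k x)%:C) xi)
                 (fun x => (u k x)%:C * fourier a x) = 0.
Proof.
move=> hu e ia la ia2.
have mC k : cmeas (fun x => (u k x)%:C) by case: (hu k) => [[[]]].
have mk k : measurable_fun [set: R] (u k) by case: (mC k).
have [w [mw w1 we]] := sphere_everywhere mk e.
have mWC k : cmeas (fun x => (w k x)%:C) by exact: cmeas_real.
have eC k : {ae mu, forall x, (u k x)%:C = (w k x)%:C}.
  by apply: aeS (we k) => x ->.
have mF := fourier_cmeas ia.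
have E k : fhat (fun x => (u k x)%:C * fourier a x) = fhat (fun x => (w k x)%:C * fourier a x).
  apply: fhat_ae; [exact: cmeasM|exact: cmeasM|].
  by apply: aeS (we k) => x ->.
have H k := dotHhalf_rint (hu k).
rewrite -mulr_sumr.
rewrite (eq_bigr _ (fun k _ => congr1 (fun h => cintegral (fun xi =>
  grad_symbol xi * fhat (fun x => (u k x)%:C) xi * h (- xi))) (E k))).
rewrite (sphere_cancel w1 mWC (fun k => is_fourier_ae (mWC k) (eC k) (H k).1)
  (fun k => (H k).2) ia la ia2).
exact: mulr0.
Qed.

End Final.

Theorem proposition1p2 (R : realType) (m : nat) (hm : (1 <= m)%N)
    (u : R -> 'cV[R]_m) (hu : dotHhalf_sphere u) :
  let U := toC u in
  eq_distr
    (dquarter (of_fun (fmulmx (dot_row U) (fquarter U))))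
    (fun phi =>
       S3 (dot_row U) U phi
       - driesz (of_fun (fmulmx (dot_row (fquarter U)) (friesz (fquarter U)))) phi).
Proof.
case: m hm u hu => // m _ u [hu su] U phi sp.
have Uk k : (fun x => (u x k 0)%:C) = (fun x => U x k 0).
  by apply/funext => x; rewrite /U /toC mxE.
have grad0 : driesz (mul_grad (dot_row U) U) phi = 0.
  have [ia la ia2] := riesz_inv_fourier sp.
  apply/matrixP => i j; rewrite !mxE !ord1.
  rewrite -[RHS](@sphere_grad_eq0 _ _ (fun k x => u x k 0) _ _ su ia la ia2).
    apply: eq_bigr => k _; rewrite Uk; congr pairing; apply/funext => x.
    by rewrite /dot_row /U /toC !mxE.
  by move=> k; rewrite Uk; exact: hu.
have dot_quarter : fquarter (dot_row U) = dot_row (fquarter U).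
  apply/funext => x; apply/matrixP => i j; rewrite !mxE.
  by congr (fmult1 _ _ x); apply/funext => y; rewrite mxE.
by rewrite /S3 grad0 subr0 dot_quarter addrK.
Qed.
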